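(* Let $p:\mathcal G\to X$ be a compact group bundle over a compact Hausdorff space $X$ admitting a left invariant positive $C(X)$-functional $C(\mathcal G)\to C(X)$, let $(\mathcal B,\mathcal G,\alpha)$ be a fibred $C(X)$-system with $\mathcal B$ unital, centre $\mathcal C:=\mathcal B\cap\mathcal B'=C(\Omega)$ and $\mathcal C^\alpha=C(X)$, and let $s\in S_X(\Omega)$. Let $\mathcal H_s$, $\eta:\mathcal B\to\mathcal F_s$, $\beta$, and the induced $C(X)$-system $(S_\beta(\mathcal G,\widehat{\mathcal F}_s),\mathcal G,\widehat\alpha)$ be those constructed from these data as described in the context. Then there is an equivariant $C(X)$-isomorphism $$T:(\mathcal B,\alpha)\to(S_\beta(\mathcal G,\widehat{\mathcal F}_s),\widehat\alpha),\qquad (Tb)(y):=\widehat\eta\circ\alpha(y,\pi_x(b)),\quad b\in\mathcal B,\ y\in\mathcal G,\ x:=p(y).$$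
   Context: **Bundles.** A bundle is a surjective continuous map of locally compact Hausdorff spaces; a group bundle $p:\mathcal G\to X$ is a bundle whose fibres $G_x=p^{-1}(x)$ are locally compact groups in the induced topology; it is compact if $\mathcal G$ is compact. A group subbundle is a subspace that is a group bundle under the restriction of $p$, with fibres subgroups of $G_x$. $S_X(Y)$ is the set of continuous sections of a bundle $Y\to X$. **$C(X)$-algebras.** A unital $C(X)$-algebra is a unital $C^*$-algebra $\mathcal A$ with a unital morphism from $C(X)$ into its centre; $\mathcal A_x$ is the quotient of $\mathcal A$ by $\{fa:f\in C(X),f(x)=0,a\in\mathcal A\}$, with quotient map $\pi_x$. The associated $C^*$-bundle is $\widehat{\mathcal A}:=\bigsqcup_x\mathcal A_x$, with projection $Q$ to $X$ and the topology with basis $\{\sigma: Q(\sigma)\in U,\|\sigma-\pi_{Q(\sigma)}(a)\|<\varepsilon\}$ ($U\subseteq X$ open, $a\in\mathcal A$, $\varepsilon>0$). A $C(X)$-morphism ($C(X)$-linear $*$-morphism) $\eta:\mathcal A\to\mathcal A'$ induces $\widehat\eta:\widehat{\mathcal A}\to\widehat{\mathcal A'}$ with $\widehat\eta(\pi_x(a))=\pi'_x(\eta(a))$. **Fibred systems.** A fibred action of $\mathcal G$ on $\mathcal A$ is a family $\alpha=\{\alpha^x:G_x\to\mathrm{aut}\,\mathcal A_x\}_x$ of strongly continuous actions such that $\alpha:\mathcal G\times_X\widehat{\mathcal A}\to\widehat{\mathcal A}$, $\alpha(y,\sigma):=\alpha^{p(y)}_y(\sigma)$, is continuous; $(\mathcal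 A,\mathcal G,\alpha)$ is a fibred $C(X)$-system, with fixed-point algebra $\mathcal A^\alpha=\{a:\alpha^x_y(\pi_x(a))=\pi_x(a)\ \forall x,\ y\in G_x\}$ (similarly $\mathcal C^\alpha$). A $C(X)$-morphism $T:\mathcal A\to\mathcal A'$ between fibred $C(X)$-systems $(\mathcal A,\mathcal G,\alpha)$, $(\mathcal A',\mathcal G,\alpha')$ is equivariant if $\widehat T(\alpha(y,\sigma))=\alpha'(y,\widehat T(\sigma))$ for all $(y,\sigma)\in\mathcal G\times_X\widehat{\mathcal A}$. **Invariant functional.** A positive $C(X)$-module map $\varphi:C(\mathcal G)\to C(X)$, with induced positive functionals $\varphi_x$ on $C(G_x)$, $\varphi(z)(x)=\varphi_x(z|_{G_x})$, is left invariant if each $\varphi_x$ is invariant under left translations by $G_x$; each $\varphi_x$ is understood to be nonzero (a Haar measure). **Construction.** $q:\Omega\to X$ is the surjection dual to $C(X)\subseteq C(\Omega)=\mathcal C$, $\Omega_x=q^{-1}(x)$. The action $\alpha$ restricts to $\mathcal C$ and gives $\alpha^*:\mathcal G\times_X\Omega\to\Omega$, $\alpha^*(y,\omega):=\omega\circ\alpha^{p(y)}_y$. Set $$\mathcal H_s:=\{h\in\mathcal G:\alpha^*(h,s(p(h)))=s(p(h))\},$$ a compact group subbundle. Let $\phi_s:\mathcal C\to C(X)$, $\phi_s(c):=c\circ s$; let $\ker\phi_s\,\mathcal B$ be the closed ideal of $\mathcal B$ generated by $\{cb:c\in\ker\phi_s,b\in\mathcal B\}$, $\mathcal F_s:=\mathcal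 B/(\ker\phi_s\,\mathcal B)$, and $\eta:\mathcal B\to\mathcal F_s$ the quotient map (a $C(X)$-epimorphism). The fibred action $\beta:\mathcal H_s\times_X\widehat{\mathcal F}_s\to\widehat{\mathcal F}_s$ is determined by $\widehat\eta(\alpha(h,\sigma))=\beta(h,\widehat\eta(\sigma))$, $h\in\mathcal H_s$, $\sigma\in\widehat{\mathcal B}$. Finally $S_\beta(\mathcal G,\widehat{\mathcal F}_s)$ is the $C(X)$-algebra (pointwise operations, sup norm) of continuous maps $F:\mathcal G\to\widehat{\mathcal F}_s$ with $F(y)\in\mathcal F_{s,p(y)}$ for all $y\in\mathcal G$, satisfying $F(hy)=\beta(h,F(y))$ for all $h\in\mathcal H_s$, $y\in\mathcal G$ with $p(h)=p(y)$. Elements of its fibre over $x$ are regarded as maps $G_x\to\mathcal F_{s,x}$, and $\widehat\alpha$ is the right translation action, $[\widehat\alpha(y,F)](y')=F(y'y)$, $y,y'\in G_x$. *)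

(* Defs.v *)
From HB Require Import structures.
From mathcomp Require Import all_boot all_order all_algebra.
From mathcomp Require Import all_classical all_reals all_analysis.
From mathcomp Require Import complex ring lra.

Set Implicit Arguments.
Unset Strict Implicit.
Unset Printing Implicit Defensive.

Import Order.TTheory GRing.Theory Num.Theory.
Import numFieldNormedType.Exports ComplexField.Normc.

Local Open Scope classical_set_scope.
Local Open Scope ring_scope.

(* Unital complex *-algebras.  The product is the [monoidType] product [(a * b)%g]
   and the unit is [1%g]: [lalgType] excludes the zero algebra, which may occur as
   a fibre of a C(X)-algebra, and HB rejects a new join of [pzRingType] and
   [lmodType]. *)
HB.mixin Record Lmodule_isStarAlgebra (R : realType) A
    of GRing.Lmodule R[i] A & Monoid A := {
  amulDl : forall a b c : A, ((a + b)%R * c)%g = (a * c)%g + (b * c)%g ;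
  amulDr : forall a b c : A, (a * (b + c)%R)%g = (a * b)%g + (a * c)%g ;
  amulZl : forall (k : R[i]) (a b : A), ((k *: a) * b)%g = k *: (a * b)%g ;
  amulZr : forall (k : R[i]) (a b : A), (a * (k *: b))%g = k *: (a * b)%g ;
  star : A -> A ;
  starK : involutive star ;
  starD : {morph star : a b / a + b} ;
  starZ : forall (k : R[i]) (a : A), star (k *: a) = k^* *: star a ;
  starM : forall a b : A, star (a * b)%g = (star b * star a)%g
}.

#[short(type="starAlgType")]
HB.structure Definition StarAlgebra (R : realType) :=
  {A of Lmodule_isStarAlgebra R A & GRing.Lmodule R[i] A & Monoid A}.

(* [normc z : R] is the modulus of [z : R[i]]. *)
HB.mixin Record StarAlgebra_isSeminormed (R : realType) A
    of StarAlgebra R A := {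
  cnorm : A -> R ;
  cnormD : forall a b : A, cnorm (a + b) <= cnorm a + cnorm b ;
  cnormZ : forall (k : R[i]) (a : A), cnorm (k *: a) = normc k * cnorm a ;
  cnormM : forall a b : A, cnorm (a * b)%g <= cnorm a * cnorm b ;
  cnorm_star : forall a : A, cnorm (star a) = cnorm a
}.

#[short(type="snStarAlgType")]
HB.structure Definition SeminormedStarAlgebra (R : realType) :=
  {A of StarAlgebra_isSeminormed R A & StarAlgebra R A}.

(* The norm of a [completeNormedModType R[i]] takes its values in [R[i]]. *)
HB.mixin Record Seminormed_isCStar (R : realType) A
    of SeminormedStarAlgebra R A & CompleteNormedModule R[i] A := {
  cnormE : forall a : A, ((cnorm a)%:C)%C = `|a| :> R[i] ;
  cstar_identity : forall a : A, cnorm (star a * a)%g = cnorm a ^+ 2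
}.

#[short(type="cstarAlgType")]
HB.structure Definition CStarAlgebra (R : realType) :=
  {A of Seminormed_isCStar R A & SeminormedStarAlgebra R A
      & CompleteNormedModule R[i] A}.

Section Theory.
Variable R : realType.

Section starTheory.
Variable A : starAlgType R.
Implicit Types a b : A.
Lemma star0 : star (0 : A) = 0.
Proof. by apply: (addrI (star 0)); rewrite -starD !addr0. Qed.
Lemma starN a : star (- a) = - star a.
Proof. by apply: (addrI (star a)); rewrite -starD !subrr star0. Qed.
Lemma starB a b : star (a - b) = star a - star b.
Proof. by rewrite starD starN. Qed.
Lemma star1 : star (1%g : A) = 1%g.
Proof. by rewrite -[LHS]mulg1 -{2}[1%g](@starK _ A) -starM mulg1 starK. Qed.
End starTheory.

Section cnormTheory.
Variable A : snStarAlgType R.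
Implicit Types a b : A.
Lemma cnorm0 : cnorm (0 : A) = 0.
Proof. by rewrite -(scale0r (0 : A)) cnormZ normc0 mul0r. Qed.
Lemma cnormN a : cnorm (- a) = cnorm a.
Proof. by rewrite -scaleN1r cnormZ normcN normc1 mul1r. Qed.
Lemma cnormBC a b : cnorm (a - b) = cnorm (b - a).
Proof. by rewrite -cnormN opprB. Qed.
Lemma cnorm_ge0 a : 0 <= cnorm a.
Proof.
have := cnormD a (- a); rewrite subrr cnorm0 cnormN -mulr2n.
by rewrite pmulrn_lge0.
Qed.
End cnormTheory.

End Theory.

(* C(X): continuous complex functions, with pointwise operations. *)
Notation contfun R X := (continuousType X ((R[i])%type : numFieldType)).

Section contfun_algebra.
Variables (R : realType) (X : topologicalType).
Implicit Types f g h : contfun R X.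

Let addf_cont f g : continuous (fun x => f x + g x).
Proof. by move=> x; apply: cvgD; exact: cts_fun. Qed.
Let oppf_cont f : continuous (fun x => - f x).
Proof. by move=> x; apply: cvgN; exact: cts_fun. Qed.
Let mulf_cont f g : continuous (fun x => f x * g x).
Proof. by move=> x; apply: cvgM; exact: cts_fun. Qed.
Let scalef_cont (k : R[i]) f : continuous (fun x => (k : (R[i] : numFieldType)) * f x).
Proof. by move=> x; apply: cvgM; [exact: cvg_cst | exact: cts_fun]. Qed.
Let conjf_cont f : continuous (fun x => (f x)^*).
Proof.
move=> x; apply/cvgrPdist_lt => e e0.
have /cvgrPdist_lt/(_ e e0) := @cts_fun _ _ f x.
by apply: filterS => t; rewrite -rmorphB norm_conjC.
Qed.

Definition cf_zero : contfun R X := cst 0.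
Definition cf_one : contfun R X := cst 1.
Definition cf_add f g : contfun R X := mkcts (@addf_cont f g).
Definition cf_opp f : contfun R X := mkcts (@oppf_cont f).
Definition cf_mul f g : contfun R X := mkcts (@mulf_cont f g).
Definition cf_scale (k : R[i]) f : contfun R X := mkcts (@scalef_cont k f).
Definition cf_star f : contfun R X := mkcts (@conjf_cont f).

Let addA : associative cf_add.
Proof. by move=> f g h; apply/continuousEP => x; exact: addrA. Qed.
Let addC : commutative cf_add.
Proof. by move=> f g; apply/continuousEP => x; exact: addrC. Qed.
Let add0 : left_id cf_zero cf_add.
Proof. by move=> f; apply/continuousEP => x; exact: add0r. Qed.
Let addN : left_inverse cf_zero cf_opp cf_add.
Proof. by move=> f; apply/continuousEP => x; exact: addNr. Qed.
HB.instance Definition _ :=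
  GRing.isZmodule.Build (contfun R X) addA addC add0 addN.

Let mulA : associative cf_mul.
Proof. by move=> f g h; apply/continuousEP => x; exact: mulrA. Qed.
Let mul1 : left_id cf_one cf_mul.
Proof. by move=> f; apply/continuousEP => x; exact: mul1r. Qed.
Let mulf1 : right_id cf_one cf_mul.
Proof. by move=> f; apply/continuousEP => x; exact: mulr1. Qed.
HB.instance Definition _ := isMonoid.Build (contfun R X) mulA mul1 mulf1.

Let scaleA a b f : cf_scale a (cf_scale b f) = cf_scale (a * b) f.
Proof. by apply/continuousEP => x; exact: mulrA. Qed.
Let scale1 : left_id 1 cf_scale.
Proof. by move=> f; apply/continuousEP => x; exact: mul1r. Qed.
Let scaleDr : right_distributive cf_scale +%R.
Proof. by move=> k f g; apply/continuousEP => x; exact: mulrDr. Qed.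
Let scaleDl f : {morph cf_scale^~ f : a b / a + b}.
Proof. by move=> a b; apply/continuousEP => x; exact: mulrDl. Qed.
HB.instance Definition _ := GRing.Zmodule_isLmodule.Build R[i] (contfun R X)
  scaleA scale1 scaleDr scaleDl.

Let amulDl_ f g h : ((f + g)%R * h)%g = (f * h)%g + (g * h)%g.
Proof. by apply/continuousEP => x; exact: mulrDl. Qed.
Let amulDr_ f g h : (f * (g + h)%R)%g = (f * g)%g + (f * h)%g.
Proof. by apply/continuousEP => x; exact: mulrDr. Qed.
Let amulZl_ (k : R[i]) f g : ((k *: f) * g)%g = k *: (f * g)%g.
Proof. by apply/continuousEP => x; rewrite /= -[LHS]mulrA. Qed.
Let amulZr_ (k : R[i]) f g : (f * (k *: g))%g = k *: (f * g)%g.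
Proof. by apply/continuousEP => x; exact: mulrCA. Qed.
Let starK_ : involutive cf_star.
Proof. by move=> f; apply/continuousEP => x; exact: conjCK. Qed.
Let starD_ : {morph cf_star : f g / f + g}.
Proof. by move=> f g; apply/continuousEP => x; exact: rmorphD. Qed.
Let starZ_ (k : R[i]) f : cf_star (k *: f) = k^* *: cf_star f.
Proof. by apply/continuousEP => x; exact: rmorphM. Qed.
Let starM_ f g : cf_star (f * g)%g = (cf_star g * cf_star f)%g.
Proof.
by apply/continuousEP => x; rewrite /= [RHS]mulrC; exact: rmorphM.
Qed.
HB.instance Definition _ := Lmodule_isStarAlgebra.Build R (contfun R X)
  amulDl_ amulDr_ amulZl_ amulZr_ starK_ starD_ starZ_ starM_.

End contfun_algebra.


Section amul_theory.
Variables (R : realType) (A : starAlgType R).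
Implicit Types a b c : A.
Lemma amul0l a : (0 * a)%g = 0 :> A.
Proof. by rewrite -{1}(scale0r (0 : A)) amulZl scale0r. Qed.
Lemma amul0r a : (a * 0)%g = 0 :> A.
Proof. by rewrite -{1}(scale0r (0 : A)) amulZr scale0r. Qed.
Lemma amulNl a b : ((- a) * b)%g = - (a * b)%g.
Proof. by rewrite -scaleN1r amulZl scaleN1r. Qed.
Lemma amulNr a b : (a * (- b)%R)%g = - (a * b)%g.
Proof. by rewrite -scaleN1r amulZr scaleN1r. Qed.
Lemma amulBl a b c : ((a - b)%R * c)%g = (a * c)%g - (b * c)%g.
Proof. by rewrite amulDl amulNl. Qed.
Lemma amulBr a b c : (a * (b - c)%R)%g = (a * b)%g - (a * c)%g.
Proof. by rewrite amulDr amulNr. Qed.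
Lemma amul_scal1l (k : R[i]) a : ((k *: 1%g) * a)%g = k *: a.
Proof. by rewrite amulZl mul1g. Qed.
End amul_theory.

Record starIdeal (R : realType) (A : starAlgType R) := StarIdeal {
  ideal_set :> A -> Prop ;
  ideal0 : ideal_set 0 ;
  idealD : forall a b, ideal_set a -> ideal_set b -> ideal_set (a + b) ;
  idealMl : forall a b, ideal_set b -> ideal_set (a * b)%g ;
  idealMr : forall a b, ideal_set a -> ideal_set (a * b)%g ;
  ideal_star : forall a, ideal_set a -> ideal_set (star a)
}.

Section quotient.
Variables (R : realType) (A : starAlgType R) (J : starIdeal A).

Lemma idealZ (k : R[i]) a : J a -> J (k *: a).
Proof. by rewrite -amul_scal1l; exact: idealMl. Qed.
Lemma idealN a : J a -> J (- a).
Proof. by rewrite -scaleN1r; exact: idealZ. Qed.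
Lemma idealB a b : J a -> J b -> J (a - b).
Proof. by move=> Ja Jb; apply: idealD => //; exact: idealN. Qed.

Definition ideal_pred : {pred A} := fun a => `[< J a >].

Let ideal_zmod_closed : zmod_closed ideal_pred.
Proof.
split; first exact/asboolP/ideal0.
by move=> a b /asboolP Ja /asboolP Jb; exact/asboolP/idealB.
Qed.
HB.instance Definition _ := GRing.isZmodClosed.Build A ideal_pred ideal_zmod_closed.

Definition quotAlg : Type := Quotient.quot ideal_pred.
HB.instance Definition _ := GRing.Zmodule.on quotAlg.

(* [qpi] is the quotient map and [qlift] a choice of representatives. *)
Definition qpi (a : A) : quotAlg := (\pi_(Quotient.quot ideal_pred) a)%qT.
Definition qlift (u : quotAlg) : A := repr (u : Quotient.quot ideal_pred).

Lemma qliftK : cancel qlift qpi.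
Proof. by move=> u; exact: reprK. Qed.

Lemma qpi_eq a b : qpi a = qpi b <-> J (a - b).
Proof.
split=> [ab|Jab].
  apply/asboolP; change (Quotient.equiv ideal_pred a b).
  have /eqP := ab.
  by rewrite /qpi -(Quotient.idealrBE ideal_pred).
by apply/eqP; rewrite /qpi -(Quotient.idealrBE ideal_pred); exact/asboolP.
Qed.

Lemma qlift_pi a : J (qlift (qpi a) - a).
Proof. by apply/qpi_eq; rewrite qliftK. Qed.

Lemma qpiD : {morph qpi : a b / a + b}.
Proof. by move=> a b; rewrite /qpi; exact: pi_addr. Qed.
Lemma qpiN : {morph qpi : a / - a}.
Proof. by move=> a; rewrite /qpi; exact: pi_oppr. Qed.
Lemma qpi0 : qpi 0 = 0.
Proof. by rewrite -(subrr 0) qpiD qpiN subrr. Qed.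
Lemma qpiB a b : qpi (a - b) = qpi a - qpi b.
Proof. by rewrite qpiD qpiN. Qed.

Definition qmul (u v : quotAlg) : quotAlg := qpi (qlift u * qlift v)%g.
Definition qone : quotAlg := qpi 1%g.
Definition qscale (k : R[i]) (u : quotAlg) : quotAlg := qpi (k *: qlift u).
Definition qstar (u : quotAlg) : quotAlg := qpi (star (qlift u)).

Lemma qpiM_ a b : qpi (a * b)%g = qmul (qpi a) (qpi b).
Proof.
apply/qpi_eq; set a' := qlift _; set b' := qlift _.
have -> : (a * b)%g - (a' * b')%g = (a * (b - b')%R)%g + ((a - a')%R * b')%g.
  by rewrite amulBr amulBl addrA subrK.
by apply: idealD; [apply: idealMl | apply: idealMr];
  rewrite -opprB; apply: idealN; exact: qlift_pi.
Qed.
Lemma qpiZ_ k a : qpi (k *: a) = qscale k (qpi a).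
Proof.
apply/qpi_eq; rewrite -scalerBr; apply: idealZ.
by rewrite -opprB; apply: idealN; exact: qlift_pi.
Qed.
Lemma qpi_star_ a : qpi (star a) = qstar (qpi a).
Proof.
apply/qpi_eq; rewrite -starB; apply: ideal_star.
by rewrite -opprB; apply: idealN; exact: qlift_pi.
Qed.

Let mulA : associative qmul.
Proof.
move=> u v w; rewrite -(qliftK u) -(qliftK v) -(qliftK w).
by rewrite -!qpiM_ mulgA.
Qed.
Let mul1 : left_id qone qmul.
Proof. by move=> u; rewrite -(qliftK u) -qpiM_ mul1g. Qed.
Let mulq1 : right_id qone qmul.
Proof. by move=> u; rewrite -(qliftK u) -qpiM_ mulg1. Qed.
HB.instance Definition _ := isMonoid.Build quotAlg mulA mul1 mulq1.

Let scaleA a b u : qscale a (qscale b u) = qscale (a * b) u.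
Proof. by rewrite -(qliftK u) -!qpiZ_ scalerA. Qed.
Let scale1 : left_id 1 qscale.
Proof. by move=> u; rewrite -(qliftK u) -qpiZ_ scale1r. Qed.
Let scaleDr : right_distributive qscale +%R.
Proof.
move=> k u v; rewrite -(qliftK u) -(qliftK v).
by rewrite -qpiD -!qpiZ_ scalerDr qpiD.
Qed.
Let scaleDl u : {morph qscale^~ u : a b / a + b}.
Proof. by move=> a b; rewrite -(qliftK u) -!qpiZ_ scalerDl qpiD. Qed.
HB.instance Definition _ := GRing.Zmodule_isLmodule.Build R[i] quotAlg
  scaleA scale1 scaleDr scaleDl.

Lemma qpiM a b : qpi (a * b)%g = (qpi a * qpi b)%g.
Proof. exact: qpiM_. Qed.
Lemma qpiZ k a : qpi (k *: a) = k *: qpi a.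
Proof. exact: qpiZ_. Qed.

Let amulDl_ (u v w : quotAlg) : ((u + v)%R * w)%g = (u * w)%g + (v * w)%g.
Proof.
rewrite -(qliftK u) -(qliftK v) -(qliftK w).
by rewrite -qpiD -!qpiM amulDl qpiD.
Qed.
Let amulDr_ (u v w : quotAlg) : (u * (v + w)%R)%g = (u * v)%g + (u * w)%g.
Proof.
rewrite -(qliftK u) -(qliftK v) -(qliftK w).
by rewrite -qpiD -!qpiM amulDr qpiD.
Qed.
Let amulZl_ (k : R[i]) (u v : quotAlg) : ((k *: u) * v)%g = k *: (u * v)%g.
Proof. by rewrite -(qliftK u) -(qliftK v) -qpiZ -!qpiM amulZl qpiZ. Qed.
Let amulZr_ (k : R[i]) (u v : quotAlg) : (u * (k *: v))%g = k *: (u * v)%g.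
Proof. by rewrite -(qliftK u) -(qliftK v) -qpiZ -!qpiM amulZr qpiZ. Qed.
Let starK_ : involutive qstar.
Proof. by move=> u; rewrite -(qliftK u) -!qpi_star_ starK. Qed.
Let starD_ : {morph qstar : u v / u + v}.
Proof.
move=> u v; rewrite -(qliftK u) -(qliftK v).
by rewrite -qpiD -!qpi_star_ starD qpiD.
Qed.
Let starZ_ (k : R[i]) u : qstar (k *: u) = k^* *: qstar u.
Proof. by rewrite -(qliftK u) -qpiZ -!qpi_star_ starZ qpiZ. Qed.
Let starM_ u v : qstar (u * v)%g = (qstar v * qstar u)%g.
Proof.
rewrite -(qliftK u) -(qliftK v).
by rewrite -qpiM -!qpi_star_ starM qpiM.
Qed.
HB.instance Definition _ := Lmodule_isStarAlgebra.Build R quotAlg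
  amulDl_ amulDr_ amulZl_ amulZr_ starK_ starD_ starZ_ starM_.

Lemma qpi_star a : qpi (star a) = star (qpi a).
Proof. exact: qpi_star_. Qed.
Lemma qpi1 : qpi 1%g = 1%g.
Proof. by []. Qed.

End quotient.

Section quotient_seminorm.
Variables (R : realType) (A : snStarAlgType R) (J : starIdeal A).
Local Notation Q := (quotAlg J).

(* The quotient norm. *)
Definition qnorm (u : Q) : R := inf [set cnorm a | a in [set a | qpi J a = u]].

Let lb (u : Q) : lbound [set cnorm a | a in [set a | qpi J a = u]] 0.
Proof. by move=> _ [a _ <-]; exact: cnorm_ge0. Qed.
Let has_infQ (u : Q) : has_inf [set cnorm a | a in [set a | qpi J a = u]].
Proof.
split; last by exists 0; exact: lb.
by exists (cnorm (qlift u)), (qlift u) => //; exact: qliftK.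
Qed.

Lemma qnorm_le a : qnorm (qpi J a) <= cnorm a.
Proof. by apply: ge_inf; [exists 0; exact: lb | exists a]. Qed.

Lemma qnorm_lt (u : Q) e : qnorm u < e -> exists2 a, qpi J a = u & cnorm a < e.
Proof. by move=> /(inf_lt (has_infQ u).1)[_ [a /= au <-] ae]; exists a. Qed.

Lemma qnorm_ge0 (u : Q) : 0 <= qnorm u.
Proof. by apply: lb_le_inf; [case: (has_infQ u) | exact: lb]. Qed.

Let qnormD (u v : Q) : qnorm (u + v) <= qnorm u + qnorm v.
Proof.
apply/ler_addgt0Pr => e e0.
have e2 : 0 < e / 2 by rewrite divr_gt0.
have [|a au ale] := @qnorm_lt u (qnorm u + e / 2); first by rewrite ltrDl.
have [|b bv ble] := @qnorm_lt v (qnorm v + e / 2); first by rewrite ltrDl.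
rewrite -au -bv -qpiD (le_trans (qnorm_le _))// (le_trans (cnormD _ _))//.
rewrite au bv [e in leRHS]splitr addrACA.
by apply: lerD; exact: ltW.
Qed.


Let normc_ge0 (k : R[i]) : 0 <= normc k.
Proof. by case: k => a b; rewrite /normc sqrtr_ge0. Qed.

Let qnormZ_le (k : R[i]) (u : Q) : qnorm (k *: u) <= normc k * qnorm u.
Proof.
have [->|k0] := eqVneq k 0.
  rewrite scale0r normc0 mul0r -(qpi0 J).
  by apply: le_trans (qnorm_le _) _; rewrite cnorm0.
have nk0 : 0 < normc k.
  by rewrite lt_neqAle normc_ge0 andbT eq_sym; apply: contra k0 => /eqP/eq0_normc ->.
rewrite mulrC -ler_pdivrMr//; apply/ler_addgt0Pr => e e0.
have [|a au ale] := @qnorm_lt u (qnorm u + e); first by rewrite ltrDl.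
rewrite ler_pdivrMr// mulrC -au -qpiZ (le_trans (qnorm_le _))//.
by rewrite cnormZ ler_pM2l// -/(Q) au ltW.
Qed.
Let qnormZ (k : R[i]) (u : Q) : qnorm (k *: u) = normc k * qnorm u.
Proof.
apply/eqP; rewrite eq_le qnormZ_le /=.
have [->|k0] := eqVneq k 0; first by rewrite normc0 mul0r qnorm_ge0.
have nk0 : 0 < normc k.
  by rewrite lt_neqAle normc_ge0 andbT eq_sym; apply: contra k0 => /eqP/eq0_normc ->.
rewrite mulrC -ler_pdivlMr// mulrC -normcV.
by rewrite (le_trans _ (qnormZ_le _ _))// scalerA mulVf// scale1r.
Qed.
Let qnormM (u v : Q) : qnorm (u * v)%g <= qnorm u * qnorm v.
Proof.
apply/ler_addgt0Pr => e e0.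
pose M := qnorm u + qnorm v + 1.
have M0 : 0 < M by rewrite ltr_wpDl// addr_ge0// qnorm_ge0.
pose d := Num.min 1 (e / M).
have d0 : 0 < d by rewrite lt_min ltr01 divr_gt0.
have [|a au ale] := @qnorm_lt u (qnorm u + d); first by rewrite ltrDl.
have [|b bv ble] := @qnorm_lt v (qnorm v + d); first by rewrite ltrDl.
rewrite -{1}au -{1}bv -qpiM (le_trans (qnorm_le _))// (le_trans (cnormM _ _))//.
apply: (@le_trans _ _ ((qnorm u + d) * (qnorm v + d))).
  by apply: ler_pM => //; [exact: cnorm_ge0|exact: cnorm_ge0|exact: ltW|exact: ltW].
have -> : (qnorm u + d) * (qnorm v + d)
  = qnorm u * qnorm v + d * (qnorm u + qnorm v + d) by ring.
rewrite lerD2l (@le_trans _ _ (d * M))//.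
  by rewrite ler_pM2l// lerD2l ge_min lexx.
by rewrite -ler_pdivlMr// ge_min lexx orbT.
Qed.
Let qnorm_star_le (u : Q) : qnorm (star u) <= qnorm u.
Proof.
apply/ler_addgt0Pr => e e0.
have [|a au ale] := @qnorm_lt u (qnorm u + e); first by rewrite ltrDl.
rewrite -{1}au -qpi_star (le_trans (qnorm_le _))// cnorm_star.
exact: ltW.
Qed.
Let qnorm_star (u : Q) : qnorm (star u) = qnorm u.
Proof.
by apply/eqP; rewrite eq_le qnorm_star_le -{1}(starK u) qnorm_star_le.
Qed.

HB.instance Definition _ := StarAlgebra_isSeminormed.Build R Q
  qnormD qnormZ qnormM qnorm_star.

Lemma cnorm_pi_le a : cnorm (qpi J a) <= cnorm a.
Proof. exact: qnorm_le. Qed.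
Lemma cnorm_quot_lt (u : Q) e :
  cnorm u < e -> exists2 a, qpi J a = u & cnorm a < e.
Proof. exact: qnorm_lt. Qed.

End quotient_seminorm.

(* Not assumed unital. *)
Record star_morphism (R : realType) (A B : starAlgType R) (f : A -> B) : Prop := {
  smD : {morph f : a b / a + b} ;
  smZ : forall (k : R[i]) a, f (k *: a) = k *: f a ;
  smM : {morph f : a b / (a * b)%g} ;
  sm_star : {morph f : a / star a}
}.

(* [cxCStarAlgType R X] is the type of unital C(X)-algebras.  Quotients and section
   algebras are only built as [cxAlgType R X], i.e. seminormed *-algebras
   with a unital morphism from C(X) into the centre; the C*-identity and completeness play no
   role in the definitions below. *)
HB.mixin Record isCXAlgebra (R : realType) (X : topologicalType) A
    of SeminormedStarAlgebra R A := {
  cxmap : contfun R X -> A ;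
  cxmap_star_morphism : star_morphism cxmap ;
  cxmap1 : cxmap 1%g = 1%g ;
  cxmap_central : forall f (a : A), (cxmap f * a)%g = (a * cxmap f)%g
}.

#[short(type="cxAlgType")]
HB.structure Definition CXAlgebra (R : realType) (X : topologicalType) :=
  {A of isCXAlgebra R X A & SeminormedStarAlgebra R A}.

#[short(type="cxCStarAlgType")]
HB.structure Definition CXCStarAlgebra (R : realType) (X : topologicalType) :=
  {A of CXAlgebra R X A & CStarAlgebra R A}.

Section complex_continuity.
Variables (R : realType) (X : topologicalType).
Implicit Types f g : contfun R X.

Lemma norm_normc (z : R[i]) : `|z| = ((normc z)%:C)%C.
Proof. by []. Qed.

Lemma normc_ge0 (k : R[i]) : 0 <= normc k.
Proof. by case: k => a b; rewrite /normc sqrtr_ge0. Qed.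

Lemma normc_gt0 (k : R[i]) : (0 < normc k) = (k != 0).
Proof.
rewrite lt_neqAle normc_ge0 andbT eq_sym; congr negb.
by apply/eqP/eqP => [/eq0_normc//|->]; exact: normc0.
Qed.

Lemma normc_cont f : continuous (fun x => normc (f x) : R).
Proof.
move=> x; apply/cvgrPdist_lt => e e0.
have eC : 0 < (e%:C)%C :> R[i] by rewrite ltcR.
have /cvgrPdist_lt/(_ _ eC) := @cts_fun _ _ f x.
apply: filterS => t; rewrite norm_normc ltcR; apply: le_lt_trans.
rewrite ler_norml.
have h a b : normc a <= normc (a - b : R[i]) + normc b.
  by rewrite -{1}(subrK b a); exact: le_normcD.
have := h (f x) (f t); have := h (f t) (f x).
rewrite -(normcN (f t - f x)) opprB => h1 h2.
by apply/andP; split; lra.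
Qed.

Lemma real_complex_cont : continuous (fun r : R => (r%:C)%C : (R[i] : numFieldType)).
Proof.
move=> x; apply/cvgrPdist_lt => e e0.
have [d d0 ->] : exists2 d : R, 0 < d & e = (d%:C)%C.
  by case: e e0 => a b; rewrite ltcE /= => /andP[/eqP b0 a0]; exists a => //; rewrite b0.
have /cvgrPdist_lt/(_ _ d0) : id @ x --> x by exact: cvg_id.
apply: filterS => t; rewrite -rmorphB.
by rewrite norm_normc /normc /= expr0n addr0 sqrtr_sqr ltcR.
Qed.

(* [f] and [g] are both multiples of [sqrt (|f| + |g|)]. *)
Lemma common_factor f g : exists h u v : contfun R X,
  [/\ f = (h * u)%g, g = (h * v)%g &
      forall x, f x = 0 -> g x = 0 -> h x = 0].
Proof.
pose w x := normc (f x) + normc (g x).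
have w0 x : 0 <= w x by rewrite addr_ge0// normc_ge0.
pose r x := Num.sqrt (w x).
have wc : continuous w by move=> x; apply: cvgD; exact: normc_cont.
have rc : continuous r.
  by move=> x; apply: continuous_comp; [exact: wc | exact: sqrt_continuous].
have hc : continuous (fun x => ((r x)%:C)%C : (R[i] : numFieldType)).
  by move=> x; apply: continuous_comp; [exact: rc | exact: real_complex_cont].
pose h : contfun R X := mkcts hc.
have quo (k : contfun R X) : (forall x, normc (k x) <= w x) ->
    exists u : contfun R X, k = (h * u)%g.
  move=> kw.
  have k0 x : r x = 0 -> k x = 0.
    move=> /eqP; rewrite sqrtr_eq0 => wx.
    by apply: eq0_normc; apply/eqP; rewrite eq_le normc_ge0 (le_trans (kw x)).
  have uc : continuous (fun x => k x / (((r x)%:C)%C : (R[i] : numFieldType))).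
    move=> x; have [rx0|rx0] := eqVneq (r x) 0; last first.
      apply: cvgM; first exact: cts_fun.
      apply: cvgV; last exact: hc.
      by rewrite (inj_eq (@complexI R)).
    apply/cvgrPdist_lt => e e0.
    have /cvgrPdist_lt/(_ e e0) := hc x.
    apply: filterS => t.
    rewrite (k0 _ rx0) rx0 mul0r !sub0r !normrN; apply: le_lt_trans.
    have [rt0|rt0] := eqVneq (r t) 0; first by rewrite (k0 _ rt0) mul0r normr0.
    have rtp : 0 < r t by rewrite lt_neqAle eq_sym rt0 sqrtr_ge0.
    rewrite !norm_normc lecR normcM normcV ler_pdivrMr ?normc_gt0; last first.
      by rewrite (inj_eq (@complexI R)).
    rewrite -normcM -rmorphM /= -expr2 sqr_sqrtr// (le_trans (kw t))//.
    by rewrite expr0n addr0 sqrtr_sqr ler_norm.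
  exists (mkcts uc); apply/continuousEP => x.
  change (k x = ((r x)%:C)%C * (k x / ((r x)%:C)%C)).
  have [rx0|rx0] := eqVneq (r x) 0; first by rewrite (k0 _ rx0) mul0r mulr0.
  by rewrite mulrC divfK// (inj_eq (@complexI R)).
have [|u fu] := quo f; first by move=> x; rewrite lerDl normc_ge0.
have [|v gv] := quo g; first by move=> x; rewrite lerDr normc_ge0.
exists h, u, v; split=> // x fx gx.
change (((r x)%:C)%C = 0 :> R[i]).
by rewrite /r /w fx gx normc0 addr0 sqrtr0.
Qed.
End complex_continuity.

Section fibres.
Variables (R : realType) (X : topologicalType) (A : cxAlgType R X).
Implicit Types (x : X) (a b : A).

Lemma cxmapD (f g : contfun R X) : cxmap (f + g) = cxmap f + cxmap g :> A.
Proof. exact: smD cxmap_star_morphism _ _. Qed.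
Lemma cxmapZ k (f : contfun R X) : cxmap (k *: f) = k *: cxmap f :> A.
Proof. exact: smZ cxmap_star_morphism _ _. Qed.
Lemma cxmapM (f g : contfun R X) : cxmap (f * g)%g = (cxmap f * cxmap g)%g :> A.
Proof. exact: smM cxmap_star_morphism _ _. Qed.
Lemma cxmap_star (f : contfun R X) : cxmap (star f) = star (cxmap f) :> A.
Proof. exact: sm_star cxmap_star_morphism _. Qed.
Lemma cxmap0 : cxmap 0 = 0 :> A.
Proof. by rewrite -(scale0r (0 : contfun R X)) cxmapZ scale0r. Qed.
Lemma cxmapB (f g : contfun R X) : cxmap (f - g) = cxmap f - cxmap g :> A.
Proof. by rewrite cxmapD -scaleN1r cxmapZ scaleN1r. Qed.

(* This set is an ideal as it stands: no span or closure is needed (see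
   [common_factor] for stability under addition). *)
Definition fibre_ideal_set x : set A :=
  [set a | exists (f : contfun R X) (b : A), f x = 0 /\ a = (cxmap f * b)%g].

Let I0 x : fibre_ideal_set x 0.
Proof. by exists 0, 0; split; [exact: erefl | rewrite amul0r]. Qed.
Let ID x a b :
  fibre_ideal_set x a -> fibre_ideal_set x b -> fibre_ideal_set x (a + b).
Proof.
move=> [f [a' [fx ->]]] [g [b' [gx ->]]].
have [h [u [v [fE gE hx]]]] := common_factor f g.
exists h, ((cxmap u * a')%g + (cxmap v * b')%g); split; first exact: hx.
by rewrite fE gE !cxmapM amulDr !mulgA.
Qed.
Let IMl x a b : fibre_ideal_set x b -> fibre_ideal_set x (a * b)%g.
Proof.
move=> [f [b' [fx ->]]]; exists f, (a * b')%g; split=> //.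
by rewrite !mulgA -cxmap_central.
Qed.
Let IMr x a b : fibre_ideal_set x a -> fibre_ideal_set x (a * b)%g.
Proof. by move=> [f [a' [fx ->]]]; exists f, (a' * b)%g; rewrite mulgA. Qed.
Let I_star x a : fibre_ideal_set x a -> fibre_ideal_set x (star a).
Proof.
move=> [f [b [fx ->]]]; exists (star f), (star b); split.
  by change ((f x)^* = 0); rewrite fx conjC0.
by rewrite starM -cxmap_star -cxmap_central.
Qed.

Definition fibre_ideal x : starIdeal A :=
  StarIdeal (I0 x) (@ID x) (@IMl x) (@IMr x) (@I_star x).

Definition fibre x := quotAlg (fibre_ideal x).
Definition fibre_pi x : A -> fibre x := qpi (fibre_ideal x).

(* The C*-bundle of [A]; its topology is the one generated by [hat_base], not the
   disjoint union topology of [{x & fibre x}]. *)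
Definition hat := {x : X & fibre x}.
Definition hat_mk x (u : fibre x) : hat := existT fibre x u.

HB.instance Definition _ := gen_eqMixin hat.
HB.instance Definition _ := gen_choiceMixin hat.

Definition hat_basic (U : set X) (a : A) (e : R) : set hat :=
  [set s | U (projT1 s) /\ cnorm (projT2 s - fibre_pi (projT1 s) a) < e].

Definition hat_base : set (set hat) :=
  [set V | exists U a e, [/\ open U, 0 < e & V = hat_basic U a e]].

(* upper semicontinuity of the norm *)
Lemma cnorm_usc a x e : cnorm (fibre_pi x a) < e ->
  \forall t \near x, cnorm (fibre_pi t a) < e.
Proof.
move=> /cnorm_quot_lt[b].
move=> /qpi_eq[f [c [fx bE]]] be.
pose d := (e - cnorm b) / (cnorm c + 1).
have c1 : 0 < cnorm c + 1 by rewrite ltr_wpDl// cnorm_ge0.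
have d0 : 0 < d by rewrite divr_gt0// subr_gt0.
have := @normc_cont _ _ f x => /cvgrPdist_lt/(_ _ d0).
apply: filterS => t; rewrite fx normc0 sub0r normrN ger0_norm ?normc_ge0// => ft.
have -> : fibre_pi t a = fibre_pi t (b - f t *: c).
  apply/qpi_eq; exists (f t *: 1%g - f), c; split.
    by change (f t * 1 - f t = 0); rewrite mulr1 subrr.
  by rewrite cxmapB cxmapZ cxmap1 amulBl amulZl mul1g -bE !opprB addrCA.
apply: le_lt_trans (cnorm_pi_le _ _) _; apply: le_lt_trans (cnormD _ _) _.
rewrite cnormN cnormZ -ltrBrDl; apply: (@le_lt_trans _ _ (normc (f t) * (cnorm c + 1))).
  by rewrite ler_wpM2l ?normc_ge0// lerDl.
by rewrite -ltr_pdivlMr.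
Qed.
End fibres.

Section hat_topology.
Variables (R : realType) (X : topologicalType) (A : cxAlgType R X).

Lemma cnorm_near (x : X) (a c : A) e : cnorm (fibre_pi x c - fibre_pi x a) < e ->
  exists2 d, 0 < d & \forall t \near x, forall v : fibre A t,
    cnorm (v - fibre_pi t c) < d -> cnorm (v - fibre_pi t a) < e.
Proof.
move=> ue; pose d := (e - cnorm (fibre_pi x c - fibre_pi x a)) / 2.
have d0 : 0 < d by rewrite divr_gt0// subr_gt0.
exists d => //.
have : cnorm (fibre_pi x (c - a)) < e - d.
  by rewrite [fibre_pi _ _]qpiB /d; lra.
move/cnorm_usc; apply: filterS => t ht v vd.
have -> : v - fibre_pi t a = (v - fibre_pi t c) + fibre_pi t (c - a).
  by rewrite [fibre_pi t (c - a)]qpiB addrA subrK.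
rewrite (le_lt_trans (cnormD _ _))//.
by move: ht vd; lra.
Qed.

Let hat_cover : \bigcup_(i in @hat_base R X A) id i = setT.
Proof.
apply/seteqP; split=> // s _.
exists (hat_basic setT (qlift (projT2 s)) 1).
  by exists setT, (qlift (projT2 s)), 1; split=> //; exact: openT.
by split=> //; rewrite /fibre_pi qliftK subrr cnorm0.
Qed.

Let hat_join i j s : @hat_base R X A i -> @hat_base R X A j -> id i s -> id j s ->
  exists k, [/\ @hat_base R X A k, id k s & id k `<=` id i `&` id j].
Proof.
move=> [U [a [e [oU e0 ->]]]] [V [b [f [oV f0 ->]]]].
case: s => x u [/= Ux ua] [/= Vx ub]; rewrite -(qliftK u) in ua ub.
set c := qlift u in ua ub.
have [d d0 Nd] := cnorm_near ua; have [d' d0' Nd'] := cnorm_near ub.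
pose N := (U `&` V) `&`
  ([set t | forall v : fibre A t,
     cnorm (v - fibre_pi t c) < d -> cnorm (v - fibre_pi t a) < e] `&`
   [set t | forall v : fibre A t,
     cnorm (v - fibre_pi t c) < d' -> cnorm (v - fibre_pi t b) < f]).
have xN : nbhs x N.
  have xU : nbhs x U by exact: open_nbhs_nbhs.
  have xV : nbhs x V by exact: open_nbhs_nbhs.
  exact: filterI (filterI xU xV) (filterI Nd Nd').
exists (hat_basic N^° c (Num.min d d')); split.
- by exists N^°, c, (Num.min d d'); split=> //;
    [exact: open_interior | rewrite lt_min d0].
- by split; [exact: xN |]; rewrite /fibre_pi qliftK subrr cnorm0 lt_min d0.
- move=> [t v] [/= /interior_subset[[Ut Vt] [h1 h2]]]; rewrite lt_min => /andP[v1 v2].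
  by split; split=> //=; [exact: h1 | exact: h2].
Qed.

HB.instance Definition _ :=
  isBaseTopological.Build (hat A) (D := @hat_base R X A) hat_cover hat_join.

Lemma open_hat_basic U a e : open U -> 0 < e -> open (@hat_basic R X A U a e).
Proof.
move=> oU e0; exists [set hat_basic U a e]; last by rewrite bigcup_set1.
by move=> _ ->; exists U, a, e.
Qed.

Lemma nbhs_hat (s : hat A) N : nbhs s N ->
  exists U a e, [/\ open U, 0 < e, hat_basic U a e s & hat_basic U a e `<=` N].
Proof.
rewrite nbhsE => -[B [[D' D'b BE] Bs] BN]; move: Bs; rewrite -BE => -[V VD' Vs].
have [U [a [e [oU e0 VE]]]] := D'b _ VD'; exists U, a, e; split=> //.
  by rewrite -VE.
by rewrite -VE => s' Vs'; apply: BN; rewrite -BE; exists V.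
Qed.

(* A section over [p] is continuous at [y] iff it is norm-close, near [y], to any
   element of the algebra representing its value at [y]. *)
Lemma continuous_sectionP (G : topologicalType) (p : G -> X)
    (F : forall y, fibre A (p y)) : continuous p ->
  continuous (fun y => hat_mk (F y)) <->
  forall y a e, fibre_pi (p y) a = F y -> 0 < e ->
    \forall z \near y, cnorm (F z - fibre_pi (p z) a) < e.
Proof.
move=> pc; split=> [Fc y a e ya e0|H y N].
  have : nbhs (hat_mk (F y)) (hat_basic setT a e).
    apply: open_nbhs_nbhs; split; first exact: open_hat_basic openT e0.
    by split=> //=; rewrite ya subrr cnorm0.
  by move=> /(Fc y) /=; apply: (@filterS _ (nbhs y)) => z /= [].
move=> /nbhs_hat[U [a [e [oU e0 [/= Uy]]]]].
rewrite -(qliftK (F y)) => /cnorm_near[d d0 Nd] sN.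
have Uz : \forall z \near y, U (p z) by apply: pc; exact: open_nbhs_nbhs.
have Hz := H y _ d (qliftK (F y)) d0.
suff : nbhs y [set z | N (hat_mk (F z))] by [].
have Nd' : nbhs y [set z | forall v : fibre A (p z),
    cnorm (v - fibre_pi (p z) (qlift (F y))) < d ->
    cnorm (v - fibre_pi (p z) a) < e] by exact: pc y _ Nd.
apply: filterS3 Nd' Uz Hz => z h {}Uz zd.
by apply: sN; split=> //=; exact: h.
Qed.
End hat_topology.

Section quotient_cx.
Variables (R : realType) (X : topologicalType) (A : cxAlgType R X).
Variable J : starIdeal A.

Lemma qpi_morphism : star_morphism (qpi J).
Proof.
by split; [exact: qpiD | exact: qpiZ | exact: qpiM | exact: qpi_star].
Qed.

Definition quot_cxmap (f : contfun R X) : quotAlg J := qpi J (cxmap f).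

Let quot_cxmap_morphism : star_morphism quot_cxmap.
Proof.
split=> [f g|k f|f g|f]; rewrite /quot_cxmap.
- by rewrite cxmapD qpiD.
- by rewrite cxmapZ qpiZ.
- by rewrite cxmapM qpiM.
- by rewrite cxmap_star qpi_star.
Qed.
Let quot_cxmap1 : quot_cxmap 1%g = 1%g.
Proof. by rewrite /quot_cxmap cxmap1 qpi1. Qed.
Let quot_cxmap_central f (u : quotAlg J) :
  (quot_cxmap f * u)%g = (u * quot_cxmap f)%g.
Proof. by rewrite -(qliftK u) -!qpiM cxmap_central. Qed.
HB.instance Definition _ := isCXAlgebra.Build R X (quotAlg J)
  quot_cxmap_morphism quot_cxmap1 quot_cxmap_central.
End quotient_cx.

Record cxMorphism (R : realType) (X : topologicalType) (A A' : cxAlgType R X) :=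
  CXMorphism {
    cxm_fun :> A -> A' ;
    cxm_morphism : star_morphism cxm_fun ;
    cxm_linear : forall f a, cxm_fun (cxmap f * a)%g = (cxmap f * cxm_fun a)%g
  }.

Definition quot_cxMorphism (R : realType) (X : topologicalType)
    (A : cxAlgType R X) (J : starIdeal A) : cxMorphism A (quotAlg J) :=
  CXMorphism (qpi_morphism J) (fun f a => qpiM J (cxmap f) a).

Section hat_map.
Variables (R : realType) (X : topologicalType) (A A' : cxAlgType R X).
Variable eta : cxMorphism A A'.

Definition fibre_map x (u : fibre A x) : fibre A' x := fibre_pi x (eta (qlift u)).

Definition hat_map (s : hat A) : hat A' := hat_mk (fibre_map (projT2 s)).

Lemma fibre_mapE x a : fibre_map (fibre_pi x a) = fibre_pi x (eta a).
Proof.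
apply/qpi_eq.
have [f [b [fx bE]]] := qlift_pi (fibre_ideal A x) a.
exists f, (eta b); split=> //.
have etaN c : eta (- c) = - eta c.
  by rewrite -scaleN1r (smZ (cxm_morphism eta)) scaleN1r.
by rewrite -cxm_linear -bE (smD (cxm_morphism eta)) etaN.
Qed.
End hat_map.

(* The group operations are functions on [G] whose values matter only on the
   fibred product; continuity is required fibre by fibre.  Local compactness of
   [G] and of its (closed) fibres follows from compactness. *)
Record compactGroupBundle (G X : topologicalType) := CompactGroupBundle {
  bproj :> G -> X ;
  bmul : G -> G -> G ;
  bone : X -> G ;
  binv : G -> G ;
  bundle_compact : compact [set: G] ;
  bundle_hausdorff : hausdorff_space G ;
  bproj_continuous : continuous bproj ;
  bproj_surj : forall x, exists y, bproj y = x ;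
  bproj_mul : forall y z, bproj y = bproj z -> bproj (bmul y z) = bproj y ;
  bproj_one : forall x, bproj (bone x) = x ;
  bproj_inv : forall y, bproj (binv y) = bproj y ;
  bmulA : forall y z w, bproj y = bproj z -> bproj z = bproj w ->
    bmul y (bmul z w) = bmul (bmul y z) w ;
  bmul1 : forall y, bmul (bone (bproj y)) y = y ;
  bmulV : forall y, bmul (binv y) y = bone (bproj y) ;
  bmul_continuous : forall x,
    {within [set yz : G * G | bproj yz.1 = x /\ bproj yz.2 = x],
     continuous (fun yz => bmul yz.1 yz.2)} ;
  binv_continuous : forall x, {within bproj @^-1` [set x], continuous binv}
}.

(* A positive C(X)-module map [phi : C(G) -> C(X)].  The induced functional
   [phi_x] on [C(G_x)] is [phi_x (z|G_x) = phi z x]; every function in [C(G_x)] is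
   such a restriction (Tietze).  [haar_invariant] says that [phi_x] takes the same
   value at [w|G_x] and [z|G_x] when [w|G_x] is the left translate of [z|G_x] by
   [g] in [G_x]. *)
Record haar_functional (R : realType) (G X : topologicalType)
    (p : compactGroupBundle G X) (phi : contfun R G -> contfun R X) : Prop := {
  haarD : {morph phi : z w / z + w} ;
  haar_module : forall (f : contfun R X) (z w : contfun R G),
    (forall y, w y = f (p y) * z y) -> forall x, phi w x = f x * phi z x ;
  haar_ge0 : forall z : contfun R G,
    (forall y, 0 <= (z y : R[i])) -> forall x, 0 <= (phi z x : R[i]) ;
  haar_invariant : forall (z w : contfun R G) (g : G),
    (forall y, p y = p g -> w y = z (bmul p g y)) -> phi w (p g) = phi z (p g) ;
  haar_neq0 : forall x, exists z, phi z x <> 0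
}.

(* A family [act x y : fibre A x -> fibre A x] is meaningful for [p y = x] only;
   [hat_act act y u] is [alpha(y, u)] for [(y, u)] in the fibred product. *)
Definition hat_act (R : realType) (G X : topologicalType) (A : cxAlgType R X)
    (act : forall x, G -> fibre A x -> fibre A x) (y : G) (s : hat A) : hat A :=
  hat_mk (act (projT1 s) y (projT2 s)).

(* Fibred action on [A] of the group subbundle [H] of [p]; [H = setT] gives the
   fibred actions of the whole bundle.  Values [act_fun x y] with [y] outside
   [H] or outside the fibre over [x] are irrelevant. *)
Record fibredAction (R : realType) (G X : topologicalType)
    (p : compactGroupBundle G X) (H : set G) (A : cxAlgType R X) := FibredAction {
  act_fun :> forall x, G -> fibre A x -> fibre A x ;
  act_morphism : forall x y, H y -> p y = x -> star_morphism (@act_fun x y) ;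
  act_bijective : forall x y, H y -> p y = x -> bijective (@act_fun x y) ;
  act_one : forall x u, @act_fun x (bone p x) u = u ;
  act_mul : forall x y z u, H y -> H z -> p y = x -> p z = x ->
    @act_fun x (bmul p y z) u = @act_fun x y (@act_fun x z u) ;
  act_strong : forall x u y (e : R), H y -> p y = x -> 0 < e ->
    \forall z \near within (H `&` p @^-1` [set x]) (nbhs y),
      cnorm (@act_fun x z u - @act_fun x y u) < e ;
  act_continuous :
    {within [set ys : G * hat A | H ys.1 /\ p ys.1 = projT1 ys.2],
     continuous (fun ys => hat_act (@act_fun) ys.1 ys.2)}
}.

Arguments act_fun {R G X p H A} _ x y u.

Section hat_eq.
Variables (R : realType) (X : topologicalType) (A : cxAlgType R X).

Lemma hat_mk_inj (x : X) : injective (@hat_mk R X A x).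
Proof.
move=> u v; rewrite /hat_mk => uv.
apply: (Eqdep_dec.inj_pair2_eq_dec X _ _ _ _ _ uv).
by move=> a b; case: (a =P b) => ?; [left|right].
Qed.

Lemma hat_mk_op1 (op : forall x, fibre A x -> fibre A x) x x'
    (u : fibre A x) (v : fibre A x') :
  hat_mk u = hat_mk v -> hat_mk (op x u) = hat_mk (op x' v).
Proof. by move=> /(congr1 (fun s : hat A => hat_mk (op _ (projT2 s)))). Qed.

Lemma hat_mk_op2 (op : forall x, fibre A x -> fibre A x -> fibre A x) x x'
    (u1 u2 : fibre A x) (v1 v2 : fibre A x') :
  hat_mk u1 = hat_mk v1 -> hat_mk u2 = hat_mk v2 ->
  hat_mk (op x u1 u2) = hat_mk (op x' v1 v2).
Proof.
move=> uv1 uv2; have xx' : x = x' := congr1 (@projT1 _ _) uv1.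
move: v1 v2 uv1 uv2; rewrite -xx' => v1 v2 /hat_mk_inj -> /hat_mk_inj ->.
by [].
Qed.
End hat_eq.

Section continuous_sections.
Variables (R : realType) (X G : topologicalType) (A : cxAlgType R X) (p : G -> X).
Hypothesis pc : continuous p.
Implicit Types F : forall y, fibre A (p y).

Definition csec F := continuous (fun y => hat_mk (F y)).

Lemma csecP F : csec F <-> forall y e, 0 < e ->
  exists2 a, fibre_pi (p y) a = F y &
    \forall z \near y, cnorm (F z - fibre_pi (p z) a) < e.
Proof.
split=> [/(continuous_sectionP F pc) H y e e0|H].
  have ye : fibre_pi (p y) (qlift (F y)) = F y by exact: qliftK.
  by exists (qlift (F y)) => //; exact: H.
apply/(continuous_sectionP F pc) => y a e ya e0.
have e2 : 0 < e / 2 by rewrite divr_gt0.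
have [b yb nb] := H y _ e2.
have : cnorm (fibre_pi (p y) (b - a)) < e / 2.
  by rewrite [fibre_pi _ _]qpiB -/(fibre_pi _ a) ya -yb subrr cnorm0.
move=> /cnorm_usc/pc ab.
have {}ab : \forall z \near y, cnorm (fibre_pi (p z) (b - a)) < e / 2 := ab.
apply: filterS2 nb ab => z zb zab.
have -> : F z - fibre_pi (p z) a = (F z - fibre_pi (p z) b) + fibre_pi (p z) (b - a).
  by rewrite [fibre_pi _ (b - a)]qpiB addrA subrK.
by rewrite (le_lt_trans (cnormD _ _))// [e]splitr ltrD.
Qed.

Lemma csec_pi a : csec (fun y => fibre_pi (p y) a).
Proof.
apply/csecP => y e e0; exists a => //.
by apply: nearW => z; rewrite subrr cnorm0.
Qed.

Lemma csecD F1 F2 : csec F1 -> csec F2 -> csec (fun y => F1 y + F2 y).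
Proof.
move=> /csecP c1 /csecP c2; apply/csecP => y e e0.
have e2 : 0 < e / 2 by rewrite divr_gt0.
have [a ya na] := c1 y _ e2; have [b yb nb] := c2 y _ e2.
exists (a + b); first by rewrite -ya -yb; exact: qpiD.
apply: filterS2 na nb => z za zb.
rewrite [fibre_pi _ (a + b)]qpiD opprD addrACA.
by rewrite (le_lt_trans (cnormD _ _))// [e]splitr ltrD.
Qed.

Lemma csecZ k F : csec F -> csec (fun y => k *: F y).
Proof.
move=> /csecP c; apply/csecP => y e e0.
have k1 : 0 < normc k + 1 by rewrite ltr_wpDl// normc_ge0.
have [|a ya na] := c y (e / (normc k + 1)); first by rewrite divr_gt0.
exists (k *: a); first by rewrite -ya; exact: qpiZ.
apply: filterS na => z za.
rewrite [fibre_pi _ (k *: a)]qpiZ -scalerBr cnormZ.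
apply: (@le_lt_trans _ _ ((normc k + 1) * cnorm (F z - fibre_pi (p z) a))).
  by rewrite ler_wpM2r ?cnorm_ge0// lerDl.
by rewrite mulrC -ltr_pdivlMr.
Qed.

Lemma csec_star F : csec F -> csec (fun y => star (F y)).
Proof.
move=> /csecP c; apply/csecP => y e e0; have [a ya na] := c y e e0.
exists (star a); first by rewrite -ya; exact: qpi_star.
apply: filterS na => z.
by rewrite [fibre_pi _ (star a)]qpi_star -starB cnorm_star.
Qed.

Lemma csecM F1 F2 : csec F1 -> csec F2 -> csec (fun y => (F1 y * F2 y)%g).
Proof.
move=> /(continuous_sectionP F1 pc) c1 /(continuous_sectionP F2 pc) c2.
apply/csecP => y e e0.
pose a := qlift (F1 y); pose b := qlift (F2 y).
have ya : fibre_pi (p y) a = F1 y by exact: qliftK.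
have yb : fibre_pi (p y) b = F2 y by exact: qliftK.
pose M := cnorm a + cnorm b + 1.
have M0 : 0 < M by rewrite ltr_wpDl// addr_ge0// cnorm_ge0.
pose d := Num.min 1 (e / M / 2).
have d0 : 0 < d by rewrite lt_min ltr01 !divr_gt0.
have d1 : d <= 1 by rewrite ge_min lexx.
have dM : d * M <= e / 2.
  rewrite -ler_pdivlMr// mulrAC ge_min.
  by apply/orP; right.
exists (a * b)%g; first by rewrite -ya -yb; exact: qpiM.
apply: filterS2 (c1 y a d ya d0) (c2 y b d yb d0) => z za zb.
rewrite [fibre_pi _ (a * b)%g]qpiM.
set fa := qpi _ a; set fb := qpi _ b.
have fa_le : cnorm fa <= cnorm a by exact: cnorm_pi_le.
have fb_le : cnorm fb <= cnorm b by exact: cnorm_pi_le.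
have -> : (F1 z * F2 z)%g - (fa * fb)%g =
    ((F1 z - fa)%R * (F2 z - fb)%R)%g + ((F1 z - fa)%R * fb)%g
    + (fa * (F2 z - fb)%R)%g.
  by rewrite -amulDr subrK amulBl amulBr addrA subrK.
have h1 := cnormM (F1 z - fa) (F2 z - fb).
have h2 := cnormM (F1 z - fa) fb.
have h3 := cnormM fa (F2 z - fb).
have dd : cnorm (F1 z - fa) * cnorm (F2 z - fb) <= d * 1.
  by apply: ler_pM; rewrite ?cnorm_ge0//; [exact: ltW | exact: le_trans (ltW zb) d1].
have db : cnorm (F1 z - fa) * cnorm fb <= d * cnorm b.
  by apply: ler_pM; rewrite ?cnorm_ge0//; exact: ltW.
have da : cnorm fa * cnorm (F2 z - fb) <= cnorm a * d.
  by apply: ler_pM; rewrite ?cnorm_ge0//; exact: ltW.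
apply: le_lt_trans (cnormD _ _) _.
apply: le_lt_trans (lerD (cnormD _ _) (lexx _)) _.
have : d * M = cnorm a * d + d * cnorm b + d * 1 by rewrite /M; ring.
by lra.
Qed.

Lemma fibre_pi_cxmap (x : X) (f : contfun R X) :
  fibre_pi x (cxmap f : A) = f x *: 1%g.
Proof.
rewrite -(qpi1 (fibre_ideal A _)) -qpiZ.
apply/qpi_eq; exists (f - f x *: 1%g), 1%g; split.
  by change (f x - f x * 1 = 0); rewrite mulr1 subrr.
by rewrite cxmapB cxmapZ cxmap1 mulg1.
Qed.

Lemma csec_scal1 (f : contfun R X) : csec (fun y => f (p y) *: 1%g).
Proof.
apply/csecP => y e e0; exists (cxmap f); first exact: fibre_pi_cxmap.
by apply: nearW => z; rewrite fibre_pi_cxmap subrr cnorm0.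
Qed.

End continuous_sections.

Section invariant_sections.
Variables (R : realType) (G X : topologicalType) (p : compactGroupBundle G X).
Variables (H : set G) (A : cxAlgType R X) (beta : fibredAction p H A).

(* The algebra [S_beta(G, hat A)]; [act_fun beta x h] only enters for [h] in [H]. *)
Record invSection := InvSection {
  sec_fun :> forall y, fibre A (p y) ;
  sec_continuous : continuous (fun y => hat_mk (sec_fun y)) ;
  sec_equivariant : forall h y, H h -> p h = p y ->
    hat_mk (sec_fun (bmul p h y)) = hat_act (act_fun beta) h (hat_mk (sec_fun y))
}.

HB.instance Definition _ := gen_eqMixin invSection.
HB.instance Definition _ := gen_choiceMixin invSection.

Implicit Types F : invSection.

Lemma invSectionP F1 F2 : (forall y, F1 y = F2 y) -> F1 = F2.
Proof.
case: F1 F2 => f1 c1 e1 [f2 c2 e2] /= f12.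
have ff : f1 = f2 by apply: functional_extensionality_dep.
by case: _ / ff in c2 e2 *; congr InvSection; exact: Prop_irrelevance.
Qed.

Let add_eq F1 F2 h y : H h -> p h = p y ->
  hat_mk (F1 (bmul p h y) + F2 (bmul p h y)) =
  hat_act (act_fun beta) h (hat_mk (F1 y + F2 y)).
Proof.
move=> Hh hy; rewrite /hat_act /= (smD (act_morphism beta Hh hy)).
apply: (hat_mk_op2 (fun x => @GRing.add (fibre A x))); exact: sec_equivariant.
Qed.
Let mul_eq F1 F2 h y : H h -> p h = p y ->
  hat_mk (F1 (bmul p h y) * F2 (bmul p h y))%g =
  hat_act (act_fun beta) h (hat_mk (F1 y * F2 y)%g).
Proof.
move=> Hh hy; rewrite /hat_act /= (smM (act_morphism beta Hh hy)).
apply: (hat_mk_op2 (fun x (u v : fibre A x) => (u * v)%g)); exact: sec_equivariant.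
Qed.
Let scale_eq k F h y : H h -> p h = p y ->
  hat_mk (k *: F (bmul p h y)) = hat_act (act_fun beta) h (hat_mk (k *: F y)).
Proof.
move=> Hh hy; rewrite /hat_act /= (smZ (act_morphism beta Hh hy)).
apply: (hat_mk_op1 (fun x => @GRing.scale _ (fibre A x) k)); exact: sec_equivariant.
Qed.
Let star_eq F h y : H h -> p h = p y ->
  hat_mk (star (F (bmul p h y))) = hat_act (act_fun beta) h (hat_mk (star (F y))).
Proof.
move=> Hh hy; rewrite /hat_act /= (sm_star (act_morphism beta Hh hy)).
apply: (hat_mk_op1 (fun x => @star _ (fibre A x))); exact: sec_equivariant.
Qed.
Let scal1_eq (f : contfun R X) h y : H h -> p h = p y ->
  @hat_mk R X A (p (bmul p h y)) (f (p (bmul p h y)) *: 1%g) =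
  hat_act (act_fun beta) h (@hat_mk R X A (p y) (f (p y) *: 1%g)).
Proof.
move=> Hh hy; rewrite /hat_act /= (smZ (act_morphism beta Hh hy)).
have -> : act_fun beta (p y) h 1%g = 1%g.
  have [g gK Kg] := act_bijective beta Hh hy.
  rewrite -[RHS]Kg -[g 1%g]mul1g (smM (act_morphism beta Hh hy)) Kg mulg1.
  by [].
by rewrite bproj_mul// hy.
Qed.

Let pc := @bproj_continuous _ _ p.

Definition sec_add F1 F2 : invSection :=
  InvSection (csecD pc (@sec_continuous F1) (@sec_continuous F2)) (@add_eq F1 F2).
Definition sec_mul F1 F2 : invSection :=
  InvSection (csecM pc (@sec_continuous F1) (@sec_continuous F2)) (@mul_eq F1 F2).
Definition sec_scale (k : R[i]) F : invSection :=
  InvSection (csecZ pc (k := k) (@sec_continuous F)) (@scale_eq k F).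
Definition sec_star F : invSection :=
  InvSection (csec_star pc (@sec_continuous F)) (@star_eq F).
Definition sec_cxmap (f : contfun R X) : invSection :=
  InvSection (csec_scal1 (A := A) pc (f := f)) (@scal1_eq f).
Definition sec_zero : invSection := sec_cxmap 0.
Definition sec_one : invSection := sec_cxmap 1%g.
Definition sec_opp F : invSection := sec_scale (-1) F.

Lemma sec_zeroE y : sec_zero y = 0.
Proof. exact: scale0r. Qed.
Lemma sec_oneE y : sec_one y = 1%g.
Proof. exact: scale1r. Qed.
Lemma sec_oppE F y : sec_opp F y = - F y.
Proof. exact: scaleN1r. Qed.

Let addA : associative sec_add.
Proof. by move=> F1 F2 F3; apply: invSectionP => y; exact: addrA. Qed.
Let addC : commutative sec_add.
Proof. by move=> F1 F2; apply: invSectionP => y; exact: addrC. Qed.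
Let add0 : left_id sec_zero sec_add.
Proof. by move=> F; apply: invSectionP => y /=; rewrite scale0r add0r. Qed.
Let addN : left_inverse sec_zero sec_opp sec_add.
Proof.
by move=> F; apply: invSectionP => y /=; rewrite scaleN1r addNr scale0r.
Qed.
HB.instance Definition _ := GRing.isZmodule.Build invSection addA addC add0 addN.

Let mulA : associative sec_mul.
Proof. by move=> F1 F2 F3; apply: invSectionP => y; exact: mulgA. Qed.
Let mul1 : left_id sec_one sec_mul.
Proof. by move=> F; apply: invSectionP => y /=; rewrite scale1r mul1g. Qed.
Let muls1 : right_id sec_one sec_mul.
Proof. by move=> F; apply: invSectionP => y /=; rewrite scale1r mulg1. Qed.
HB.instance Definition _ := isMonoid.Build invSection mulA mul1 muls1.

Let scaleA a b F : sec_scale a (sec_scale b F) = sec_scale (a * b) F.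
Proof. by apply: invSectionP => y; exact: scalerA. Qed.
Let scale1 : left_id 1 sec_scale.
Proof. by move=> F; apply: invSectionP => y; exact: scale1r. Qed.
Let scaleDr : right_distributive sec_scale +%R.
Proof. by move=> k F1 F2; apply: invSectionP => y; exact: scalerDr. Qed.
Let scaleDl F : {morph sec_scale^~ F : a b / a + b}.
Proof. by move=> a b; apply: invSectionP => y; exact: scalerDl. Qed.
HB.instance Definition _ := GRing.Zmodule_isLmodule.Build R[i] invSection
  scaleA scale1 scaleDr scaleDl.

Let amulDl_ F1 F2 F3 : ((F1 + F2)%R * F3)%g = (F1 * F3)%g + (F2 * F3)%g.
Proof. by apply: invSectionP => y; exact: amulDl. Qed.
Let amulDr_ F1 F2 F3 : (F1 * (F2 + F3)%R)%g = (F1 * F2)%g + (F1 * F3)%g.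
Proof. by apply: invSectionP => y; exact: amulDr. Qed.
Let amulZl_ (k : R[i]) F1 F2 : ((k *: F1) * F2)%g = k *: (F1 * F2)%g.
Proof. by apply: invSectionP => y; exact: amulZl. Qed.
Let amulZr_ (k : R[i]) F1 F2 : (F1 * (k *: F2))%g = k *: (F1 * F2)%g.
Proof. by apply: invSectionP => y; exact: amulZr. Qed.
Let starK_ : involutive sec_star.
Proof. by move=> F; apply: invSectionP => y; exact: starK. Qed.
Let starD_ : {morph sec_star : F1 F2 / F1 + F2}.
Proof. by move=> F1 F2; apply: invSectionP => y; exact: starD. Qed.
Let starZ_ (k : R[i]) F : sec_star (k *: F) = k^* *: sec_star F.
Proof. by apply: invSectionP => y; exact: starZ. Qed.
Let starM_ F1 F2 : sec_star (F1 * F2)%g = (sec_star F2 * sec_star F1)%g.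
Proof. by apply: invSectionP => y; exact: starM. Qed.
HB.instance Definition _ := Lmodule_isStarAlgebra.Build R invSection
  amulDl_ amulDr_ amulZl_ amulZr_ starK_ starD_ starZ_ starM_.

Definition sec_norm F : R := sup (range (fun y => cnorm (F y))).

Lemma sec_bounded F : exists M, forall y, cnorm (F y) <= M.
Proof.
have locb (y : G) : exists n : nat, \forall z \near y, cnorm (F z) < n%:R.
  have [a ya na] := (csecP pc _).1 (@sec_continuous F) y 1 ltr01.
  exists (Num.truncn (cnorm a + 1)).+1; apply: filterS na => z za.
  apply: lt_trans (truncnS_gt _).
  rewrite -(subrK (fibre_pi (p z) a) (F z)) (le_lt_trans (cnormD _ _))//.
  rewrite addrC ler_ltD//; exact: cnorm_pi_le.
have cov : \forall n \near \oo, [set: G] `<=` (fun y => cnorm (F y) < n%:R).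
  apply: ((compact_near_coveringP _).1 (bundle_compact p)) => y _.
  have [n ny] := locb y.
  exists ([set z | cnorm (F z) < n%:R], [set m | (n <= m)%N]).
    by split=> //; exact: nbhs_infty_ge.
  by move=> [z m] [/= zn nm]; rewrite (lt_le_trans zn)// ler_nat.
have [n _ /(_ n (leqnn n)) Fn] := cov.
by exists n%:R => y; exact/ltW/Fn.
Qed.

Let sec_norm_ub F y : cnorm (F y) <= sec_norm F.
Proof.
have [M FM] := sec_bounded F.
by apply: sup_ubound; [exists M => _ [z _ <-] | exists y].
Qed.

Let sec_norm_le F M : 0 <= M -> (forall y, cnorm (F y) <= M) -> sec_norm F <= M.
Proof.
move=> M0 FM; have [S0|/set0P S0] := eqVneq (range (fun y => cnorm (F y))) set0.
  by rewrite /sec_norm S0 sup0.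
by apply: ge_sup => // _ [y _ <-].
Qed.

Let sec_norm_ge0 F : 0 <= sec_norm F.
Proof.
have [S0|/set0P[_ [y _ _]]] := eqVneq (range (fun y => cnorm (F y))) set0.
  by rewrite /sec_norm S0 sup0.
exact: le_trans (cnorm_ge0 _) (sec_norm_ub F y).
Qed.

Let sec_normD F1 F2 : sec_norm (F1 + F2) <= sec_norm F1 + sec_norm F2.
Proof.
apply: sec_norm_le => [|y]; first by rewrite addr_ge0.
by apply: le_trans (cnormD _ _) _; rewrite lerD.
Qed.
Let sec_normZ_le (k : R[i]) F : sec_norm (k *: F) <= normc k * sec_norm F.
Proof.
apply: sec_norm_le => [|y]; first by rewrite mulr_ge0// normc_ge0.
by rewrite [(k *: F) y]/(k *: F y) cnormZ ler_wpM2l// normc_ge0.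
Qed.
Let sec_normZ (k : R[i]) F : sec_norm (k *: F) = normc k * sec_norm F.
Proof.
apply/eqP; rewrite eq_le sec_normZ_le /=.
have [->|k0] := eqVneq k 0; first by rewrite normc0 mul0r.
rewrite mulrC -ler_pdivlMr ?normc_gt0// mulrC -normcV.
by rewrite (le_trans _ (sec_normZ_le _ _))// scalerA mulVf// scale1r.
Qed.
Let sec_normM F1 F2 : sec_norm (F1 * F2)%g <= sec_norm F1 * sec_norm F2.
Proof.
apply: sec_norm_le => [|y]; first by rewrite mulr_ge0.
by apply: le_trans (cnormM _ _) _; rewrite ler_pM// cnorm_ge0.
Qed.
Let sec_norm_star F : sec_norm (star F) = sec_norm F.
Proof.
have le F' : sec_norm (star F') <= sec_norm F'.
  by apply: sec_norm_le => // y; rewrite [star F' y]/(star (F' y)) cnorm_star.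
by apply/eqP; rewrite eq_le le -{1}(starK F) le.
Qed.
HB.instance Definition _ := StarAlgebra_isSeminormed.Build R invSection
  sec_normD sec_normZ sec_normM sec_norm_star.

Let sec_cxmap_morphism : star_morphism sec_cxmap.
Proof.
split=> [f g|k f|f g|f]; apply: invSectionP => y.
- exact: scalerDl.
- by rewrite [RHS]scalerA.
- by rewrite [RHS]amulZl mul1g scalerA.
- by rewrite [RHS]starZ star1.
Qed.
Let sec_cxmap_central f F : (sec_cxmap f * F)%g = (F * sec_cxmap f)%g.
Proof.
apply: invSectionP => y.
by rewrite [LHS]amulZl [RHS]amulZr mul1g mulg1.
Qed.
HB.instance Definition _ := isCXAlgebra.Build R X invSection
  sec_cxmap_morphism erefl sec_cxmap_central.

(* An element [u] of the fibre over [x] regarded as a map on [G_x]: the restriction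
   of any representative, see [sec_resE].  Used for [p y = x]. *)
Definition sec_res x (u : fibre invSection x) (y : G) : hat A := hat_mk (qlift u y).

Lemma sec_resE F y : sec_res (fibre_pi (p y) F) y = hat_mk (F y).
Proof.
have [f [F' [fy E]]] := qlift_pi (fibre_ideal invSection (p y)) F.
congr hat_mk; apply/eqP; rewrite -subr_eq0.
have -> : qlift (fibre_pi (p y) F) y - F y = (qlift (fibre_pi (p y) F) - F) y.
  by rewrite [RHS]/(_ + _); congr (_ + _); rewrite -scaleN1r.
by apply/eqP; rewrite E [LHS]amulZl fy scale0r.
Qed.
End invariant_sections.

Section closed_ideals.
Variables (R : realType) (B : cstarAlgType R).

Definition is_closed_ideal (J : set B) : Prop :=
  [/\ closed J, J 0, forall a b, J a -> J b -> J (a + b),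
      forall a b, J b -> J (a * b)%g & forall a b, J a -> J (a * b)%g].

Definition closed_ideal_gen (S : set B) : set B :=
  [set b | forall J, is_closed_ideal J -> S `<=` J -> J b].

Lemma norm_star (b : B) : `|star b| = `|b|.
Proof. by rewrite -!cnormE cnorm_star. Qed.

Lemma star_continuous : continuous (star : B -> B).
Proof.
move=> b; apply/cvgrPdist_lt => e e0.
have /cvgrPdist_lt/(_ e e0) : id @ b --> b by exact: cvg_id.
by apply: filterS => c; rewrite -starB norm_star.
Qed.

Variable S : set B.
Hypothesis S_star : forall b, S b -> S (star b).

Let gen0 : closed_ideal_gen S 0.
Proof. by move=> J []. Qed.
Let genD a b : closed_ideal_gen S a -> closed_ideal_gen S b ->
  closed_ideal_gen S (a + b).
Proof.
move=> Sa Sb J JI SJ; case: (JI) => _ _ D _ _.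
by apply: D; [exact: Sa | exact: Sb].
Qed.
Let genMl a b : closed_ideal_gen S b -> closed_ideal_gen S (a * b)%g.
Proof. by move=> Sb J JI SJ; case: (JI) => _ _ _ Ml _; apply: Ml; exact: Sb. Qed.
Let genMr a b : closed_ideal_gen S a -> closed_ideal_gen S (a * b)%g.
Proof. by move=> Sa J JI SJ; case: (JI) => _ _ _ _ Mr; apply: Mr; exact: Sa. Qed.
Let gen_star a : closed_ideal_gen S a -> closed_ideal_gen S (star a).
Proof.
move=> Sa J [cJ J0 JD JMl JMr] SJ.
apply: (Sa [set b | J (star b)]); last by move=> b /S_star/SJ.
split.
- by apply: preimage_closed => // b _; exact: star_continuous.
- by rewrite /= star0.
- by move=> b c /= ? ?; rewrite starD; exact: JD.
- by move=> b c /= ?; rewrite starM; exact: JMr.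
- by move=> b c /= ?; rewrite starM; exact: JMl.
Qed.

Definition closed_star_ideal : starIdeal B :=
  StarIdeal gen0 genD genMl genMr gen_star.
End closed_ideals.

Section construction.
Variables (R : realType) (X G Omega : topologicalType).
Variables (p : compactGroupBundle G X) (B : cxCStarAlgType R X).
Variable alpha : fibredAction p [set: G] B.

Definition centre : set B := [set b | forall a, (b * a)%g = (a * b)%g].

Definition fixed_points : set B :=
  [set b | forall x y, p y = x ->
     act_fun alpha x y (fibre_pi x b) = fibre_pi x b].

(* The identification of the centre with C(Omega). *)
Record centreIso := CentreIso {
  cen_fun :> contfun R Omega -> B ;
  cen_morphism : star_morphism cen_fun ;
  cen_one : cen_fun 1%g = 1%g ;
  cen_inj : injective cen_fun ;
  cen_range : range cen_fun = centre
}.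

Variable gamma : centreIso.

(* [q] is the surjection dual to the inclusion of C(X) in C(Omega). *)
Definition dual_projection (q : continuousType Omega X) : Prop :=
  (forall x, exists w, q w = x) /\
  (forall f : contfun R X, gamma (f \o q : contfun R Omega) = cxmap f).

(* [dual_action q y w w'] states [w' = w o alpha_y], for [q w = p y]: points of
   Omega over [x] are viewed as characters of the image of the centre in
   [fibre B x], which [alpha_y] preserves. *)
Definition dual_action (q : Omega -> X) (y : G) (w w' : Omega) : Prop :=
  q w' = p y /\ forall c : contfun R Omega, exists c' : contfun R Omega,
    act_fun alpha (p y) y (fibre_pi (p y) (gamma c)) = fibre_pi (p y) (gamma c')
    /\ c w' = c' w.

(* H_s *)
Definition stabilizer (q : Omega -> X) (s : X -> Omega) : set G :=
  [set h | dual_action q h (s (p h)) (s (p h))].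

Variable s : X -> Omega.

(* [c \o s = 0] means that [c] is in the kernel of phi_s. *)
Definition ker_gen : set B :=
  [set b | exists (c : contfun R Omega) (b' : B),
     (forall x, c (s x) = 0) /\ b = (gamma c * b')%g].

Let ker_gen_star b : ker_gen b -> ker_gen (star b).
Proof.
move=> [c [b' [cs ->]]]; exists (star c), (star b'); split.
  by move=> x; change ((c (s x))^* = 0); rewrite cs conjC0.
have : centre (gamma (star c)) by rewrite -(cen_range gamma); exists (star c).
by rewrite starM -(sm_star (cen_morphism gamma)) => ->.
Qed.

Definition ker_ideal : starIdeal B := closed_star_ideal ker_gen_star.

Definition Fs : cxAlgType R X := quotAlg ker_ideal.
Definition eta : cxMorphism B Fs := quot_cxMorphism ker_ideal.

End construction.

Arguments centre {R X} B.

Definition equivariant (R : realType) (G X : topologicalType)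
    (p : compactGroupBundle G X) (H : set G) (A A' : cxAlgType R X)
    (alpha : fibredAction p H A) (alpha' : fibredAction p H A')
    (T : cxMorphism A A') : Prop :=
  forall y (u : hat A), H y -> p y = projT1 u ->
    hat_map T (hat_act (act_fun alpha) y u) =
    hat_act (act_fun alpha') y (hat_map T u).

(* [[alpha'(y, u)](y') = u(y' y)] on the fibre over [x]. *)
Definition right_translation (R : realType) (G X : topologicalType)
    (p : compactGroupBundle G X) (H : set G) (A : cxAlgType R X)
    (beta : fibredAction p H A)
    (alpha' : fibredAction p [set: G] (invSection beta)) : Prop :=
  forall x (u : fibre (invSection beta) x) y y', p y = x -> p y' = x ->
    sec_res (act_fun alpha' x y u) y' = sec_res u (bmul p y' y).

(* Main.v *)
From HB Require Import structures.
Require Import Defs.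
From mathcomp Require Import all_boot all_order all_algebra.
From mathcomp Require Import all_classical all_reals all_analysis.
From mathcomp Require Import complex ring lra.
Set Implicit Arguments.
Unset Strict Implicit.
Unset Printing Implicit Defensive.
Import Order.TTheory GRing.Theory Num.Theory.
Import numFieldNormedType.Exports ComplexField.Normc.
Local Open Scope classical_set_scope.
Local Open Scope ring_scope.

(** Write [rho y] for the point of [Omega] to which [y] moves [s (p y)], and regard [B] as
    an algebra over [Omega], its centre being [C(Omega)].  The fibre of [F_s] over [x] is
    the fibre of [B] at the point [s x] ([Fs_fibre_norm]), and [alpha_y] moves the fibre at
    [rho y] to the fibre at [s x].  So [(T b)(y)] is the value of [b] at [rho y], up to an
    isomorphism that does not depend on [b].

    [T] is isometric because [rho] is onto, that is, [G_x] is transitive on the fibre of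
    [Omega] over [x] ([dact_transitive]), and because the norm of [b] is the supremum of
    the norms of its values ([fibre_norm_sup]).  Its range is dense: a section [S] agrees
    with some [T b] at a given [y], hence, both being equivariant, on the coset
    [H_s y], which is a fibre of [rho].  By compactness they are close on the preimage of a
    neighbourhood of [rho y], and the elements [b] are glued by a partition of unity on
    [Omega] ([transform_dense]).  An isometry with dense range is onto.  The action on the
    section algebra is transported from [B] along [T]; it is the right translation.

    Three points carry the argument.

    The norms of fibres are controlled by the C*-identity alone.  A unital *-morphism from
    [C(Y)] is contractive because real functions of modulus at most 1 are real parts of
    unitary functions; fibres inherit the C*-identity by cut-offs, their norms are definite
    by Cohen factorisation ([fibre_norm_eq0]), and all estimates by constants are improved
    by taking [2 ^ k]-th powers ([bounded_contractive], [fibre_norm_sup]).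

    The action preserves the image of the centre in the fibres ([act_central]).  This is
    where points of [Omega] get moved to points of [Omega].  The translates of the
    central elements form a lower semicontinuous family of subspaces of the fibres, since
    [p] is open, and a selection of this family, as in Michael's theorem, gives central
    elements of [B].  The map [p] is open because the measures of the Haar functional
    charge all open sets and vary continuously ([haar_open]).

    Transitivity holds because [C(X)] is the algebra of invariant functions: the infimum
    over orbits of a continuous function on [Omega] is invariant, and continuous as [p] is
    open and [G] compact ([orbit_inf_continuous]).  A function separating two orbits over
    the same point of [X] would yield an invariant function that is not in [C(X)]. *)

(** * Real estimates, finite covers, real functions as elements of [C(Y)] *)

Section reals_and_covers.
Variable R : realType.

Lemma bernoulli_le (d : R) n : 0 <= d -> 1 + n%:R * d <= (1 + d) ^+ n.
Proof.
move=> d0; elim: n => [|n IH]; first by rewrite mul0r addr0 expr0.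
rewrite exprS; apply: le_trans (_ : (1 + d) * (1 + n%:R * d) <= _); last first.
  by rewrite ler_wpM2l// addr_ge0.
rewrite -natr1; have : 0 <= n%:R * d * d by rewrite !mulr_ge0.
by nra.
Qed.

(** If [x / y] were larger than 1, its powers would be unbounded.  This removes the
    constant [m] from a bound on all [2 ^ k]-th powers, and it is how the C*-identity
    enters the norm estimates below. *)
Lemma le_of_powers (x y m : R) : 0 <= y ->
  (forall k, x ^+ (2 ^ k) <= m * y ^+ (2 ^ k)) -> x <= y.
Proof.
move=> y0 H; rewrite leNgt; apply/negP => yx.
have [y00|yn0] := eqVneq y 0.
  by have := H 0%N; rewrite y00 mulr0 expr1 leNgt -y00 yx.
have yp : 0 < y by rewrite lt_neqAle eq_sym yn0.
pose d := x / y - 1.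
have d0 : 0 < d by rewrite subr_gt0 ltr_pdivlMr// mul1r.
have rk k : (1 + d) ^+ (2 ^ k) <= m.
  by rewrite /d addrC subrK expr_div_n ler_pdivrMr ?exprn_gt0.
have := archi_boundP (divr_ge0 (ltW (lt_le_trans ltr01 (le_trans _ (rk 0%N)))) (ltW d0)).
rewrite expr1 lerDl (ltW d0) => /(_ isT); set k := Num.bound _ => km.
have := rk k; apply/negP; rewrite -ltNge.
apply: lt_le_trans (bernoulli_le _ (ltW d0)).
rewrite ltr_pdivrMr// in km; apply: (lt_le_trans km).
apply: (@le_trans _ _ ((2 ^ k)%:R * d)); last by rewrite lerDr.
by rewrite ler_pM2r// ler_nat ltnW// ltn_expl.
Qed.

(** The points indexing the finite subcover stay in [K], so that data chosen at the
    points of [K] can be attached to it. *)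
Lemma finite_cover (Y : topologicalType) (K : set Y) (U : Y -> set Y) :
  compact K -> (forall t, K t -> nbhs t (U t)) ->
  exists s : seq Y, (forall t, t \in s -> K t) /\
                    forall t, K t -> exists2 u, u \in s & U u t.
Proof.
move=> cK nU; pose F : set_system (set Y) := [set S |
  exists s : seq Y, (forall t, t \in s -> K t) /\
    forall V : set Y, (forall u, u \in s -> U u `<=` V) -> S V].
have FF : Filter F.
  split; first by exists [::].
    move=> P Q [s [sK sP]] [s' [s'K s'Q]]; exists (s ++ s'); split.
      by move=> t; rewrite mem_cat => /orP[/sK|/s'K].
    move=> V Vs; split; [apply: sP|apply: s'Q] => u us; apply: Vs;
      by rewrite mem_cat us ?orbT.
  by move=> P Q PQ [s [sK sP]]; exists s; split=> // V /sP; exact: PQ.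
have [|s [sK /(_ (fun t => exists2 u, u \in s & U u t))]] :=
    (compact_near_coveringP K).1 cK _ F (fun V t => V t) FF.
  move=> t Kt; exists (U t, [set V | U t `<=` V]).
    split; first exact: nU.
    by exists [:: t]; split=> [u|V]; [rewrite inE => /eqP ->|apply; rewrite inE].
  by move=> [t' V] [/= Ut' UV]; exact: UV.
move=> H; exists s; split=> // t Kt; apply: H => // u us t' Ut'.
by exists u.
Qed.

Lemma geometric_small (C e : R) : 0 <= C -> 0 < e -> exists n, C / 2 ^+ n < e.
Proof.
move=> C0 e0; exists (Num.bound (C / e)).
have := archi_boundP (divr_ge0 C0 (ltW e0)).
rewrite ltr_pdivrMr// => h; rewrite ltr_pdivrMr ?exprn_gt0//; apply: (lt_trans h).
by rewrite mulrC ltr_pM2l// -natrX ltr_nat ltn_expl.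
Qed.

Lemma real_complex_continuous (Y : topologicalType) (f : Y -> R) :
  continuous f -> continuous (fun t => ((f t)%:C)%C : (R[i] : numFieldType)).
Proof.
by move=> cf t; apply: continuous_comp; [exact: cf|exact: real_complex_cont].
Qed.

Definition realf (Y : topologicalType) (f : continuousType Y R) : contfun R Y :=
  mkcts (real_complex_continuous (@cts_fun _ _ f)).

Lemma normc_real (r : R) : normc (r%:C)%C = `|r|.
Proof. by rewrite /normc /= expr0n addr0 sqrtr_sqr. Qed.

Lemma continuous_sq (Y : topologicalType) (f : Y -> R) :
  continuous f -> continuous (fun t => f t ^+ 2).
Proof. by move=> cf t; under eq_fun do rewrite expr2; apply: cvgM; exact: cf. Qed.

End reals_and_covers.

(** * Norms and powers under the C*-identity *)

Section power_trick.
Variables (R : realType) (A A' : snStarAlgType R).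

Definition cstar_like (C : snStarAlgType R) :=
  forall a : C, cnorm (star a * a)%g = cnorm a ^+ 2.

Lemma expg_double (C : snStarAlgType R) (a : C) k :
  (a ^+ (2 ^ k.+1) = (a ^+ (2 ^ k)) * (a ^+ (2 ^ k)))%g.
Proof. by rewrite expnS mul2n -addnn expgnDr. Qed.

Lemma cnorm_sa_power (C : snStarAlgType R) (a : C) k : cstar_like C ->
  star a = a ->
  star (a ^+ (2 ^ k))%g = (a ^+ (2 ^ k))%g /\ cnorm (a ^+ (2 ^ k))%g = cnorm a ^+ (2 ^ k).
Proof.
move=> cC sa; elim: k => [|k [IH1 IH2]]; first by rewrite !expg1 expr1.
rewrite expg_double starM IH1; split=> //.
by rewrite -{1}IH1 cC IH2 -exprM mulnC expnS.
Qed.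

Lemma star_morphism_expg (f : A -> A') (fm : star_morphism f) a k :
  f (a ^+ (2 ^ k))%g = (f a ^+ (2 ^ k))%g.
Proof.
by elim: k => [|k IH]; rewrite ?expg1// !expg_double (smM fm) IH.
Qed.

(** By the C*-identity the norm of a self-adjoint element is multiplicative on its
    [2 ^ k]-th powers, so the bound [K] can be replaced by its [2 ^ k]-th root. *)
Lemma bounded_contractive (f : A -> A') K : cstar_like A -> cstar_like A' ->
  star_morphism f -> (forall a, cnorm (f a) <= K * cnorm a) ->
  forall a, cnorm (f a) <= cnorm a.
Proof.
move=> cA cA' fm fK a.
have sa (C : snStarAlgType R) (c : C) : star (star c * c)%g = (star c * c)%g.
  by rewrite starM starK.
rewrite -(@ler_pXn2r _ 2) ?nnegrE ?cnorm_ge0//.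
rewrite -cA -cA' -(sm_star fm) -(smM fm).
apply: (@le_of_powers R _ _ K) => [|k]; first exact: cnorm_ge0.
have fsa : star (f (star a * a)%g) = f (star a * a)%g by rewrite -(sm_star fm) sa.
rewrite -(cnorm_sa_power k cA' fsa).2 -(cnorm_sa_power k cA (sa _ a)).2.
by rewrite -(star_morphism_expg fm).
Qed.
End power_trick.

Lemma star_morphism0 (R : realType) (C D : starAlgType R) (f : C -> D) :
  star_morphism f -> f 0 = 0.
Proof. by move=> fm; rewrite -(scale0r (0 : C)) (smZ fm) scale0r. Qed.

Lemma star_morphismB (R : realType) (C D : starAlgType R) (f : C -> D) :
  star_morphism f -> {morph f : a b / a - b}.
Proof. by move=> fm a b; rewrite (smD fm) -scaleN1r (smZ fm) scaleN1r. Qed.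

Lemma amul_suml (R : realType) (A : starAlgType R) (I : Type) (s : seq I) (f : I -> A) b :
  ((\sum_(i <- s) f i)%R * b)%g = \sum_(i <- s) (f i * b)%g.
Proof.
elim: s => [|i s IH]; first by rewrite !big_nil amul0l.
by rewrite !big_cons amulDl IH.
Qed.

Section seminorm_estimates.
Variables (R : realType) (A : snStarAlgType R).

Lemma cnorm_sum (I : Type) (s : seq I) (f : I -> A) :
  cnorm (\sum_(i <- s) f i) <= \sum_(i <- s) cnorm (f i).
Proof.
elim: s => [|i s IH]; first by rewrite !big_nil cnorm0.
by rewrite !big_cons (le_trans (cnormD _ _))// lerD2l.
Qed.

Lemma cnorm_expg_le (c : A) k : cnorm (c ^+ (2 ^ k))%g <= cnorm c ^+ (2 ^ k).
Proof.
elim: k => [|k IH]; first by rewrite expg1 expr1.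
rewrite expg_double (le_trans (cnormM _ _))// expnS mul2n -addnn exprD.
by rewrite ler_pM// cnorm_ge0.
Qed.
End seminorm_estimates.


Section fibre_pi_morphism.
Variables (R : realType) (X : topologicalType) (A : cxAlgType R X) (x : X).
Implicit Types a b : A.
Lemma fibre_pi0 : fibre_pi x (0 : A) = 0. Proof. exact: qpi0. Qed.
Lemma fibre_pi1 : fibre_pi x (1%g : A) = 1%g. Proof. exact: qpi1. Qed.
Lemma fibre_piD a b : fibre_pi x (a + b) = fibre_pi x a + fibre_pi x b.
Proof. exact: qpiD. Qed.
Lemma fibre_piB a b : fibre_pi x (a - b) = fibre_pi x a - fibre_pi x b.
Proof. exact: qpiB. Qed.
Lemma fibre_piM a b : fibre_pi x (a * b)%g = (fibre_pi x a * fibre_pi x b)%g.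
Proof. exact: qpiM. Qed.
Lemma fibre_piZ k a : fibre_pi x (k *: a) = k *: fibre_pi x a.
Proof. exact: qpiZ. Qed.
Lemma fibre_pi_surj (u : fibre A x) : exists a, fibre_pi x a = u.
Proof. by exists (qlift u); exact: qliftK. Qed.
End fibre_pi_morphism.

(** * Fibres of a C*-algebra over [C(Y)] *)

Section cx_cstar.
Variables (R : realType) (Y : topologicalType) (A : cxCStarAlgType R Y).
Implicit Types (a b : A) (t : Y).

Lemma cstar_likeA : cstar_like A.
Proof. exact: cstar_identity. Qed.

Lemma cnorm_unitary (u : A) : (star u * u = 1)%g -> cnorm u <= 1.
Proof.
move=> uu; have one1 : cnorm (1%g : A) <= 1.
  have : cnorm (1%g : A) ^+ 2 = cnorm (1%g : A).
    by rewrite -cstar_identity star1 mulg1.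
  by have := cnorm_ge0 (1%g : A); nra.
have : cnorm u ^+ 2 <= 1 by rewrite -cstar_identity uu.
by have := cnorm_ge0 u; nra.
Qed.

(** [h] is the real part of [h + i sqrt (1 - h^2)], which is unitary, and unitary
    elements have norm at most 1 by the C*-identity. *)
Lemma cxmap_real_le1 (h : continuousType Y R) :
  (forall t, `|h t| <= 1) -> cnorm (cxmap (realf h) : A) <= 1.
Proof.
move=> h1.
have cw : continuous (fun t => Num.sqrt (1 - h t ^+ 2) : R).
  move=> t; apply: (@continuous_comp _ _ _ (fun t => 1 - h t ^+ 2) Num.sqrt);
    last exact: sqrt_continuous.
  by apply: cvgB; [exact: cvg_cst|exact/continuous_sq/cts_fun].
pose u : contfun R Y := realf h + 'i%C *: realf (mkcts cw).
have su : (star u * u)%g = 1%g.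
  apply/continuousEP => t.
  change (((h t)%:C%C + 'i%C * (Num.sqrt (1 - h t ^+ 2))%:C%C)^*
    * ((h t)%:C%C + 'i%C * (Num.sqrt (1 - h t ^+ 2))%:C%C) = 1 :> R[i]).
  have s2 : Num.sqrt (1 - h t ^+ 2) ^+ 2 = 1 - h t ^+ 2.
    rewrite sqr_sqrtr// subr_ge0 -real_normK ?num_real//.
    by rewrite expr_le1.
  apply/eqP; rewrite eq_complex /=; apply/andP; split; apply/eqP; last by ring.
  by move: s2; rewrite !expr2 => s2; ring: s2.
have : cnorm (cxmap u : A) <= 1.
  by apply: cnorm_unitary; rewrite -cxmap_star -cxmapM su cxmap1.
move=> nu; have -> : realf h = 2^-1 *: (u + star u).
  apply/continuousEP => t.
  change ((h t)%:C%C = 2^-1 * (((h t)%:C%C + 'i%C * (Num.sqrt (1 - h t ^+ 2))%:C%C)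
    + ((h t)%:C%C + 'i%C * (Num.sqrt (1 - h t ^+ 2))%:C%C)^*) :> R[i]).
  have -> : (2^-1 : R[i]) = ((2^-1 : R)%:C)%C by rewrite fmorphV rmorph_nat.
  apply/eqP; rewrite eq_complex /=; apply/andP; split; apply/eqP; last by ring.
  by field.
have -> : (2^-1 : R[i]) = ((2^-1 : R)%:C)%C by rewrite fmorphV rmorph_nat.
rewrite cxmapZ cnormZ normc_real cxmapD cxmap_star ger0_norm ?invr_ge0//.
have := cnormD (cxmap u : A) (star (cxmap u)); rewrite cnorm_star.
by move: nu; lra.
Qed.

Lemma normc_sq (z : R[i]) : z^* * z = ((normc z ^+ 2)%:C)%C.
Proof.
case: z => x y; apply/eqP; rewrite eq_complex /= sqr_sqrtr ?addr_ge0 ?sqr_ge0//.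
by apply/andP; split; apply/eqP; ring.
Qed.

Lemma cxmap_le1 (g : contfun R Y) : (forall t, normc (g t) <= 1) ->
  cnorm (cxmap g : A) <= 1.
Proof.
move=> g1; have ch : continuous (fun t => normc (g t) ^+ 2 : R).
  exact/continuous_sq/normc_cont.
have E : (star g * g)%g = realf (mkcts ch).
  by apply/continuousEP => t; exact: normc_sq.
have : cnorm (cxmap g : A) ^+ 2 <= 1.
  rewrite -cstar_identity -cxmap_star -cxmapM E; apply: cxmap_real_le1 => t.
  by rewrite ger0_norm ?exprn_ge0 ?normc_ge0// expr_le1 ?normc_ge0.
by have := cnorm_ge0 (cxmap g : A); nra.
Qed.

Lemma cxmap_mul_le (g : contfun R Y) (M : R) b : 0 <= M ->
  (forall t, normc (g t) <= M) -> cnorm (cxmap g * b)%g <= M * cnorm b.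
Proof.
move=> M0 gM; have [M00|Mn0] := eqVneq M 0.
  have -> : g = 0.
    apply/continuousEP => t; apply: eq0_normc; apply/eqP.
    by rewrite eq_le normc_ge0 -M00 gM.
  by rewrite cxmap0 amul0l cnorm0 M00 mul0r.
have Mp : 0 < M by rewrite lt_neqAle eq_sym Mn0.
have -> : g = (M%:C)%C *: ((M^-1%:C)%C *: g).
  rewrite scalerA -rmorphM divff//.
  by rewrite rmorph1 scale1r.
rewrite cxmapZ amulZl cnormZ normc_real (ger0_norm M0) ler_wpM2l//.
apply: le_trans (cnormM _ _) _; rewrite ler_piMl ?cnorm_ge0//.
apply: cxmap_le1 => t; rewrite [normc _](normcM (M^-1%:C)%C (g t)) normc_real.
by rewrite ger0_norm ?invr_ge0// mulrC ler_pdivrMr// mul1r.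
Qed.

Lemma cxmap_realM_le (l : continuousType Y R) (M : R) a : 0 <= M ->
  (forall u, 0 <= l u <= M) -> cnorm (cxmap (realf l) * a)%g <= M * cnorm a.
Proof.
move=> M0 l01; apply: cxmap_mul_le => // u.
by have /andP[? ?] := l01 u; rewrite [normc _]normc_real ger0_norm.
Qed.

(** A representative of small norm differs from [b] by some [f c] with [f t = 0]; the
    cut-off [d / (d + |f|)] is 1 at [t] and makes [f c] as small as needed. *)
Lemma fibre_norm_local t b (r : R) : cnorm (fibre_pi t b) < r ->
  exists l : continuousType Y R,
    [/\ l t = 1, forall u, 0 <= l u <= 1 & cnorm (cxmap (realf l) * b)%g < r].
Proof.
move=> /cnorm_quot_lt[b' /qpi_eq[f [c [ft bE]]] b'r].
pose d := (r - cnorm b') / (cnorm c + 1).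
have c1 : 0 < cnorm c + 1 by rewrite ltr_wpDl// cnorm_ge0.
have d0 : 0 < d by rewrite divr_gt0// subr_gt0.
have df u : 0 < d + normc (f u) by rewrite ltr_pwDl// normc_ge0.
have cl : continuous (fun u => d / (d + normc (f u)) : R).
  move=> u; apply: cvgM; first exact: cvg_cst.
  apply: cvgV; first by rewrite gt_eqF.
  by apply: cvgD; [exact: cvg_cst|exact: normc_cont].
have l01 u : 0 <= d / (d + normc (f u)) <= 1.
  rewrite divr_ge0 ?(ltW d0) ?(ltW (df u))//= ler_pdivrMr// mul1r.
  by rewrite lerDl normc_ge0.
exists (mkcts cl); split => //; first by rewrite /= /mkcts ft normc0 addr0 divff ?gt_eqF.
have -> : b = b' - (cxmap f * c)%g by rewrite -bE opprB addrC subrK.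
rewrite amulBr mulgA -cxmapM.
apply: le_lt_trans (cnormD _ _) _; rewrite cnormN.
have h1 : cnorm (cxmap (realf (mkcts cl)) * b')%g <= 1 * cnorm b'.
  exact: cxmap_realM_le.
have h2 : cnorm (cxmap (realf (mkcts cl) * f) * c)%g <= d * cnorm c.
  apply: cxmap_mul_le => [|u]; first exact: ltW.
  rewrite [normc _](normcM ((d / (d + normc (f u)))%:C)%C (f u)) normc_real.
  have /andP[? ?] := l01 u; rewrite ger0_norm// mulrAC ler_pdivrMr//.
  by rewrite ler_wpM2l ?(ltW d0)// lerDr ltW.
have h3 : d * (cnorm c + 1) = r - cnorm b' by rewrite /d divfK// gt_eqF.
move: h1 h2 h3; rewrite mul1r; nra.
Qed.

Lemma fibre_pi_cxmapM t (f : contfun R Y) a :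
  fibre_pi t (cxmap f * a)%g = f t *: fibre_pi t a.
Proof. by rewrite [LHS]qpiM [qpi _ _]fibre_pi_cxmap amulZl mul1g. Qed.

Lemma star_realf (l : continuousType Y R) : star (realf l) = realf l.
Proof.
apply/continuousEP => u; change (((l u)%:C)%C^* = ((l u)%:C)%C).
by apply/eqP; rewrite eq_complex /= oppr0 !eqxx.
Qed.

Lemma fibre_pi_realfM t (l : continuousType Y R) a :
  l t = 1 -> fibre_pi t (cxmap (realf l) * a)%g = fibre_pi t a.
Proof.
move=> lt; rewrite fibre_pi_cxmapM; change (((l t)%:C)%C *: fibre_pi t a = fibre_pi t a).
by rewrite lt scale1r.
Qed.

(** For a general quotient this needs an approximate unit of the ideal; here a cut-off
    equal to 1 at [t] plays its role. *)
Lemma fibre_cstar_like t : cstar_like (fibre A t).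
Proof.
move=> u; rewrite -(qliftK u); set b := qlift u; rewrite -/(fibre_pi t b).
apply/eqP; rewrite eq_le; apply/andP; split.
  by rewrite expr2 (le_trans (cnormM _ _))// cnorm_star.
rewrite -[(star _ * _)%g]/((star (qpi _ b) * qpi _ b)%g) -qpi_star -qpiM.
rewrite -/(fibre_pi t _).
apply/ler_addgt0Pr => e e0; set r := _ + e.
have [|l [lt l01 lr]] := @fibre_norm_local t (star b * b)%g r.
  by rewrite ltrDl.
rewrite -(fibre_pi_realfM b lt).
apply: (@le_trans _ _ (cnorm (cxmap (realf l) * b)%g ^+ 2)).
  by rewrite lerXn2r ?nnegrE ?cnorm_ge0// cnorm_pi_le.
rewrite -cstar_identity starM -cxmap_star star_realf.
have -> : ((star b * cxmap (realf l)) * (cxmap (realf l) * b) =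
    cxmap (realf l) * (cxmap (realf l) * (star b * b)))%g.
  rewrite -cxmap_central -mulgA; congr (_ * _)%g.
  by rewrite !mulgA; congr (_ * _)%g; rewrite cxmap_central.
apply: le_trans (ltW lr).
by rewrite -[leRHS]mul1r; exact: cxmap_realM_le.
Qed.

Lemma cnorm_eq0 a : cnorm a = 0 -> a = 0.
Proof. by move=> a0; apply/eqP; rewrite -normr_eq0 -cnormE a0. Qed.

Lemma cnorm_complete (a_ : nat -> A) (C : R) :
  (forall n, cnorm (a_ n.+1 - a_ n) <= C / 2 ^+ n) ->
  exists a, forall n, cnorm (a - a_ n) <= 2 * C / 2 ^+ n.
Proof.
move=> aC; have pow0 n : (0 : R) < 2 ^+ n by exact: exprn_gt0.
have C0 : 0 <= C by have := le_trans (cnorm_ge0 _) (aC 0%N); rewrite expr0 divr1.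
have tel n k : cnorm (a_ (n + k)%N - a_ n) <= 2 * C / 2 ^+ n - 2 * C / 2 ^+ (n + k).
  elim: k => [|k IH]; first by rewrite addn0 !subrr cnorm0.
  rewrite addnS -(subrK (a_ (n + k)%N) (a_ (n + k).+1)) -addrA.
  apply: le_trans (cnormD _ _) _; apply: le_trans (lerD (aC _) IH) _.
  rewrite le_eqVlt; apply/orP; left; apply/eqP; rewrite exprS.
  by field; rewrite !gt_eqF.
have tel' n m : (n <= m)%N -> cnorm (a_ m - a_ n) <= 2 * C / 2 ^+ n.
  move=> nm; rewrite -(subnKC nm); apply: le_trans (tel _ _) _.
  by rewrite gerBl divr_ge0 ?mulr_ge0// ltW.
have ce : cauchy_ex (a_ @ \oo).
  move=> e e0; have [d d0 ->] : exists2 d : R, 0 < d & e = (d%:C)%C.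
    case: e e0 => x y; rewrite ltcE /= => /andP[/eqP y0 x0]; exists x => //.
    by rewrite y0.
  have [n nd] := geometric_small (mulr_ge0 (ler0n R 2) C0) d0; exists (a_ n); exists n => // m /= nm.
  rewrite -ball_normE /ball_ /= -cnormE ltcR cnormBC; apply: le_lt_trans nd.
  exact: tel'.
have cv : cvg (a_ @ \oo) by apply: cauchy_cvg; exact: cauchy_exP.
exists (lim (a_ @ \oo)) => n; apply/ler_addgt0Pr => e e0.
have eC : 0 < (e%:C)%C :> R[i] by rewrite ltcR.
have /cvgrPdist_lt/(_ _ eC)[N _ NH] := cv.
pose m := maxn n N; have := NH m (leq_maxr _ _).
rewrite -cnormE ltcR => le; rewrite -(subrK (a_ m) (lim _)) -addrA.
apply: le_trans (cnormD _ _) _; rewrite [leRHS]addrC; apply: lerD; first exact: ltW.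
by apply: tel'; exact: leq_maxl.
Qed.

(** Cohen factorisation: if the class of [b] at [t] has norm 0, then [b = f a] with
    [f t = 0].  The function [f] is the limit of invertible functions [F n], each
    obtained from the preceding one by subtracting a multiple of a cut-off [l n] for
    which [l n * b] is tiny; this makes [(F n)^-1 * b] converge. *)
Lemma fibre_norm_eq0 t (v : fibre A t) : cnorm v = 0 -> v = 0.
Proof.
rewrite -(qliftK v); set b := qlift v; rewrite -/(fibre_pi t b) => b0.
have pow0 n : (0 : R) < 2 ^+ n by exact: exprn_gt0.
have ex n : exists l : continuousType Y R, [/\ l t = 1, forall u, 0 <= l u <= 1 &
    cnorm (cxmap (realf l) * b)%g < 1 / 2 ^+ n / 2 ^+ n].
  by apply: fibre_norm_local; rewrite b0 !divr_gt0.
pose l n := projT1 (cid (ex n)).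
have lt n : l n t = 1 by rewrite /l; case: cid => ? [].
have l01 n u : 0 <= l n u <= 1 by rewrite /l; case: cid => ? [].
have lb n : cnorm (cxmap (realf (l n)) * b)%g < 1 / 2 ^+ n / 2 ^+ n.
  by rewrite /l; case: cid => ? [].
(* [F n = 1 - sum_(k < n) l k / 2 ^ k.+1] is at least [2^-n], with equality at [t]. *)
pose F := fix F n u : R := if n is n'.+1 then F n' u - (2 ^+ n)^-1 * l n' u else 1.
have FS n u : F n.+1 u = F n u - (2 ^+ n.+1)^-1 * l n u by [].
have cF n : continuous (F n).
  elim: n => [|n IH] u; first exact: cvg_cst.
  apply: cvgB; first exact: IH.
  by apply: cvgM; [exact: cvg_cst | exact: cts_fun].
have Ft n : F n t = (2 ^+ n)^-1.
  elim: n => [|n IH]; first by rewrite expr0 invr1.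
  by rewrite FS IH lt exprS; field; rewrite gt_eqF.
have Fstep n u : 0 <= F n u - F n.+1 u <= (2 ^+ n.+1)^-1.
  rewrite FS opprB addrC subrK; have /andP[l0 l1] := l01 n u.
  by rewrite mulr_ge0 ?invr_ge0 ?(ltW (pow0 _))//= ler_piMr// invr_ge0 ltW.
have Fdec n k u : 0 <= F n u - F (n + k)%N u <= (2 ^+ n)^-1 - (2 ^+ (n + k))^-1.
  elim: k => [|k IH]; first by rewrite addn0 !subrr lexx.
  rewrite addnS; have := Fstep (n + k)%N u.
  have : ((2 : R) ^+ (n + k))^-1 = (2 ^+ (n + k).+1)^-1 * 2.
    by rewrite [in RHS]exprS; field; rewrite gt_eqF.
  by move: IH => /andP[? ?] ? /andP[? ?]; apply/andP; split; lra.
have Flow n u : (2 ^+ n)^-1 <= F n u.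
  by have := Fdec 0%N n u; rewrite add0n /= expr0 invr1 => /andP[? ?]; lra.
have F0 n u : 0 < F n u by rewrite (lt_le_trans _ (Flow n u))// invr_gt0.
pose f u := inf (range (F ^~ u)).
have hi u : has_inf (range (F ^~ u)).
  split; first by exists (F 0%N u), 0%N.
  by exists 0 => _ [n _ <-]; exact: ltW.
have fF n u : 0 <= F n u - f u <= (2 ^+ n)^-1.
  rewrite subr_ge0 ge_inf//=; [|exact: (hi u).2|by exists n].
  rewrite lerBlDr -lerBlDl; apply: lb_le_inf; first exact: (hi u).1.
  move=> _ [m _ <-]; case: (leqP n m) => nm.
    have /andP[_] := Fdec n (m - n)%N u; rewrite subnKC//.
    by have := pow0 m; rewrite -invr_gt0; lra.
  have /andP[+ _] := Fdec m (n - m)%N u; rewrite subnKC ?(ltnW nm)//.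
  by have := pow0 n; rewrite -invr_gt0; lra.
have small (e : R) : 0 < e -> exists n, (2 ^+ n)^-1 < e.
  by move=> /(geometric_small ler01)[n]; rewrite div1r; exists n.
have cf : continuous f.
  move=> u; apply/cvgrPdist_lt => e e0.
  have [n ne] := small (e / 3) (divr_gt0 e0 (ltr0Sn _ _)).
  have /cvgrPdist_lt/(_ _ (divr_gt0 e0 (ltr0Sn _ 2))) := cF n u.
  apply: filterS => u'; rewrite !ltr_distl => /andP[h1 h2].
  have /andP[? ?] := fF n u; have /andP[? ?] := fF n u'.
  by apply/andP; split; lra.
have ft0 : f t = 0.
  have f0 : 0 <= f t.
    by apply: lb_le_inf; [exact: (hi t).1|move=> _ [m _ <-]; exact: ltW].
  apply/eqP; rewrite eq_le f0 andbT leNgt; apply/negP => /small[n].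
  by have := fF n t; rewrite Ft => /andP[]; lra.
have cV n : continuous (fun u => (F n u)^-1).
  by move=> u; apply: cvgV; [rewrite gt_eqF|exact: cF].
pose a_ n : A := (cxmap (realf (mkcts (cV n))) * b)%g.
have aE n : b = (cxmap (realf (mkcts (cF n))) * a_ n)%g.
  rewrite /a_ mulgA -cxmapM -[LHS]mul1g -cxmap1; congr (cxmap _ * _)%g.
  apply/continuousEP => u; change (1 = ((F n u)%:C)%C * (((F n u)^-1)%:C)%C :> R[i]).
  by rewrite -rmorphM /= divff ?gt_eqF// rmorph1.
have cD n : continuous (fun u => (2 ^+ n.+1)^-1 * (F n u)^-1 * (F n.+1 u)^-1).
  by move=> u; do 2?[apply: cvgM]; [exact: cvg_cst|exact: cV|exact: cV].
have aS n : cnorm (a_ n.+1 - a_ n) <= 1 / 2 ^+ n.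
  have -> : a_ n.+1 - a_ n =
      (cxmap (realf (mkcts (cD n))) * (cxmap (realf (l n)) * b))%g.
    rewrite /a_ -amulBl mulgA -cxmapB -cxmapM; congr (cxmap _ * _)%g.
    apply/continuousEP => u.
    change (((F n.+1 u)^-1%:C)%C - ((F n u)^-1%:C)%C =
     (((2 ^+ n.+1)^-1 * (F n u)^-1 * (F n.+1 u)^-1)%:C)%C * ((l n u)%:C)%C :> R[i]).
    rewrite -rmorphM -rmorphB; congr (_%:C)%C.
    have F1 : F n u != 0 by rewrite gt_eqF.
    have F2 : F n.+1 u != 0 by rewrite gt_eqF.
    have -> : (2 ^+ n.+1)^-1 * (F n u)^-1 * (F n.+1 u)^-1 * l n u =
       (F n u - F n.+1 u) * (F n u)^-1 * (F n.+1 u)^-1.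
      by rewrite FS opprB addrC; ring.
    by field; rewrite F1 F2.
  apply: le_trans (_ : 2 ^+ n * (1 / 2 ^+ n / 2 ^+ n) <= _); last first.
    by rewrite le_eqVlt; apply/orP; left; apply/eqP; field; rewrite gt_eqF.
  apply: le_trans (cxmap_realM_le (M := 2 ^+ n) _ _ _) _.
  - exact: ltW.
  - move=> u; change (0 <= (2 ^+ n.+1)^-1 * (F n u)^-1 * (F n.+1 u)^-1 <= 2 ^+ n).
    rewrite !mulr_ge0 ?invr_ge0 ?(ltW (F0 _ _)) ?(ltW (pow0 _))//=.
    have h1 : (F n u)^-1 <= 2 ^+ n.
      by rewrite -[leRHS]invrK lef_pV2 ?posrE ?invr_gt0.
    have h2 : (F n.+1 u)^-1 <= 2 ^+ n.+1.
      by rewrite -[leRHS]invrK lef_pV2 ?posrE ?invr_gt0.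
    rewrite -mulrA [leLHS]mulrC ler_pdivrMr//.
    apply: ler_pM => //; rewrite invr_ge0; [exact: (ltW (F0 n u))|exact: (ltW (F0 n.+1 u))].
  - by rewrite ler_wpM2l ?(ltW (pow0 _))// ltW.
have [a aL] := cnorm_complete aS.
suff bE : b = (cxmap (realf (mkcts cf)) * a)%g.
  rewrite bE fibre_pi_cxmapM.
  by change (((f t)%:C)%C *: fibre_pi t a = 0); rewrite ft0 scale0r.
apply/eqP; rewrite -subr_eq0; apply/eqP/cnorm_eq0/eqP.
rewrite eq_le cnorm_ge0 andbT; apply/ler_addgt0Pr => e e0; rewrite add0r.
pose C := cnorm a + 4.
have C0 : 0 < C by rewrite ltr_wpDl// cnorm_ge0.
have [n ne] := small (e / C) (divr_gt0 e0 C0).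
have an := aL n; rewrite mulr1 in an.
have cFf : continuous (fun u => F n u - f u).
  by move=> u; apply: cvgB; [exact: cF|exact: cf].
have -> : b - (cxmap (realf (mkcts cf)) * a)%g =
    (cxmap (realf (mkcts cFf)) * a_ n)%g - (cxmap (realf (mkcts cf)) * (a - a_ n)%R)%g.
  have -> : realf (mkcts cFf) = realf (mkcts (cF n)) - realf (mkcts cf).
    by apply/continuousEP => u; exact: rmorphB.
  by rewrite cxmapB amulBl -aE amulBr opprB addrA subrK.
have N0 := pow0 n; rewrite -invr_gt0 in N0.
have h1 : cnorm (cxmap (realf (mkcts cFf)) * a_ n)%g <= (2 ^+ n)^-1 * cnorm (a_ n).
  by apply: cxmap_realM_le; [exact: ltW|exact: fF].
have h2 : cnorm (cxmap (realf (mkcts cf)) * (a - a_ n)%R)%g <= 1 * cnorm (a - a_ n).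
  apply: cxmap_realM_le => // u; change (0 <= f u <= 1).
  have /andP[+ _] := fF 0%N u; rewrite [F _ _]/= subr_ge0 => ->; rewrite andbT.
  by apply: lb_le_inf; [exact: (hi u).1|move=> _ [m _ <-]; exact: ltW].
have h3 : cnorm (a_ n) <= cnorm a + 2.
  rewrite -[a_ n](subrK a) addrC (le_trans (cnormD _ _))// lerD2l cnormBC.
  apply: le_trans an _; rewrite ler_piMr//.
  by rewrite invf_le1// exprn_ege1// ler1n.
apply: le_trans (cnormD _ _) _; rewrite cnormN.
have ne' : (2 ^+ n)^-1 * C < e by rewrite -ltr_pdivlMr.
apply: le_trans (ltW ne').
move: h1 h2 an; rewrite /C mul1r; move: h3 N0 (cnorm_ge0 (a_ n)).
by nra.
Qed.
End cx_cstar.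

(** * Norms and elements from local data over a compact base *)

Section bumps.
Variables (R : realType) (Y : topologicalType).
Hypotheses (Y_compact : compact [set: Y]) (Y_hausdorff : hausdorff_space Y).

Lemma bump (t : Y) (U : set Y) : nbhs t U ->
  exists f : continuousType Y R,
    [/\ f t = 1, forall u, 0 <= f u <= 1 & forall u, f u != 0 -> U u].
Proof.
move=> tU; have nY : normal_space Y by exact: compact_normal.
have [||||f [cf f0 f1 f01]] := @urysohn_ext_itv Y R nY (~` U°) [set t] 0 1.
- by apply: open_closedC; exact: open_interior.
- exact/accessible_closed_set1/hausdorff_accessible.
- by apply/seteqP; split=> // u [/= Uu ut]; apply: Uu; rewrite ut.
- exact: ltr01.
exists (mkcts cf); split=> [|u|u].
- by apply: f1; exists t.
- by have := f01 (f u); rewrite /= in_itv /=; apply; exists u.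
- move=> fu; apply: interior_subset; apply: contrapT => Uu; move/eqP: fu; apply.
  by apply: f0; exists u.
Qed.

Lemma continuous_sum (I : Type) (s : seq I) (f : I -> Y -> R) :
  (forall i, continuous (f i)) -> continuous (fun u => \sum_(i <- s) f i u).
Proof.
move=> cf; elim: s => [|i s IH] u.
  by under eq_fun do rewrite big_nil; exact: cvg_cst.
under eq_fun do rewrite big_cons.
by apply: cvgD; [exact: cf|exact: IH].
Qed.
End bumps.

Lemma realf_sumE (R : realType) (Y : topologicalType) (I : Type) (s : seq I)
    (f : I -> continuousType Y R) u :
  (\sum_(i <- s) realf (f i)) u = ((\sum_(i <- s) f i u)%:C)%C.
Proof.
elim: s => [|i s IH]; first by rewrite !big_nil.
rewrite !big_cons; change (((f i u)%:C)%C + (\sum_(i <- s) realf (f i)) u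
  = ((f i u + \sum_(i <- s) f i u)%:C)%C).
by rewrite IH -rmorphD.
Qed.

Lemma realf_expg (R : realType) (Y : topologicalType) (l : continuousType Y R) n
    (cl : continuous (fun u => l u ^+ n)) :
  (realf l ^+ n)%g = realf (mkcts cl).
Proof.
apply/continuousEP => u; change ((realf l ^+ n)%g u = ((l u ^+ n)%:C)%C).
elim: n {cl} => [|n IH]; first by rewrite expr0.
rewrite expgS exprS; change (((l u)%:C)%C * (realf l ^+ n)%g u = ((l u * l u ^+ n)%:C)%C).
by rewrite IH -rmorphM.
Qed.

Section patching.
Variables (R : realType) (Y : topologicalType) (A : cxCStarAlgType R Y).
Hypotheses (Y_compact : compact [set: Y]).
Implicit Types (a b : A) (t : Y).

Lemma cxmap_expg (f : contfun R Y) n : (cxmap (f ^+ n)%g = cxmap f ^+ n :> A)%g.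
Proof.
elim: n => [|n IH]; first by rewrite !expg0 cxmap1.
by rewrite !expgS cxmapM IH.
Qed.

Lemma cxmap_sum (I : Type) (s : seq I) (f : I -> contfun R Y) :
  cxmap (\sum_(i <- s) f i) = \sum_(i <- s) cxmap (f i) :> A.
Proof.
elim: s => [|i s IH]; first by rewrite !big_nil cxmap0.
by rewrite !big_cons cxmapD IH.
Qed.

(** The estimate by a partition of unity would need the order of a C*-algebra.
    Instead, take finitely many cut-offs [l i] such that [l i * b] has norm at most [r']
    and some [l i] exceeds [th] at each point.  For [a = star b * b], the element [a ^ N]
    is the quotient of [sum_i (l i ^ 2 * a) ^ N] by [sum_i l i ^ (2 N) >= th ^ (2 N)],
    so that [(norm b)^(2 N) <= m (r' / th)^(2 N)] with [m] terms, for every [N = 2 ^ k];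
    the factor [m] disappears by [le_of_powers]. *)
Lemma fibre_norm_sup b (r : R) : 0 <= r ->
  (forall t, cnorm (fibre_pi t b) <= r) -> cnorm b <= r.
Proof.
move=> r0 br; apply/ler_addgt0Pr => e e0; set r' := r + e.
have r'0 : 0 < r' by rewrite ltr_wpDl.
have br' t : cnorm (fibre_pi t b) < r' by rewrite (le_lt_trans (br t))// ltrDl.
suff H th : 0 < th -> th < 1 -> cnorm b * th <= r'.
  rewrite leNgt; apply/negP => lt; have b0 := lt_trans r'0 lt.
  have := H ((1 + r' / cnorm b) / 2).
  have q1 : r' / cnorm b < 1 by rewrite ltr_pdivrMr// mul1r.
  have q0 : 0 < r' / cnorm b by rewrite divr_gt0.
  have -> : cnorm b * ((1 + r' / cnorm b) / 2) = (cnorm b + r') / 2.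
    by field; rewrite gt_eqF.
  by move: lt q0 q1; set q := r' / _; lra.
move=> th0 th1.
pose l t := projT1 (cid (fibre_norm_local (br' t))).
have lt t : l t t = 1 by rewrite /l; case: cid => ? [].
have l01 t u : 0 <= l t u <= 1 by rewrite /l; case: cid => ? [].
have lb t : cnorm (cxmap (realf (l t)) * b)%g < r'.
  by rewrite /l; case: cid => ? [].
have [|s [_ sU]] := @finite_cover Y setT (fun t => [set u | th < l t u]) Y_compact.
  move=> t _; have /cvgrPdist_lt/(_ (1 - th)) := @cts_fun _ _ (l t) t.
  rewrite subr_gt0 => /(_ th1); apply: filterS => u /=.
  by rewrite lt ltr_distl => /andP[_]; lra.
have {}sU u : exists2 t, t \in s & th < l t u by exact: sU.
pose a : A := (star b * b)%g.
have sa : star a = a by rewrite /a starM starK.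
rewrite -(@ler_pXn2r _ 2) ?nnegrE ?mulr_ge0 ?cnorm_ge0 ?(ltW th0) ?(ltW r'0)//.
rewrite exprMn -cstar_identity -/a -ler_pdivlMr ?exprn_gt0//.
have y0 : 0 <= r' ^+ 2 / th ^+ 2 by rewrite divr_ge0// exprn_ge0// ltW.
apply: (@le_of_powers R _ _ (size s)%:R y0) => k.
rewrite -(cnorm_sa_power k (@cstar_likeA R Y A) sa).2; set N := (2 ^ k)%N.
have cN t : continuous (fun u => l t u ^+ (2 * N)).
  move=> u; elim: (2 * N)%N => [|n IH].
    by under eq_fun do rewrite expr0; exact: cvg_cst.
  by under eq_fun do rewrite exprS; apply: cvgM; [exact: cts_fun|exact: IH].
have cg := continuous_sum (s := s) cN.
set g := (fun u => \sum_(t <- s) l t u ^+ (2 * N)) in cg.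
have gth u : th ^+ (2 * N) <= g u.
  have [t ts thl] := sU u; rewrite /g (perm_big _ (perm_to_rem ts)) big_cons /=.
  apply: le_trans (_ : l t u ^+ (2 * N) <= _).
    by apply: lerXn2r; rewrite ?nnegrE ?(ltW th0) ?(ltW thl)// ltW// (lt_trans th0).
  rewrite lerDl sumr_ge0// => v _; rewrite exprn_ge0//.
  by have /andP[] := l01 v u.
have tN : 0 < th ^+ (2 * N) by rewrite exprn_gt0.
have g0 u : 0 < g u by rewrite (lt_le_trans tN).
have cV : continuous (fun u => (g u)^-1).
  by move=> u; apply: cvgV; [rewrite gt_eqF|exact: cg].
have aNE : (a ^+ N)%g = (cxmap (realf (mkcts cV)) *
    (\sum_(t <- s) (cxmap (realf (mkcts (cN t))) * (a ^+ N))%g)%R)%g :> A.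
  rewrite -amul_suml mulgA -cxmap_sum -cxmapM -[LHS]mul1g -cxmap1.
  congr (cxmap _ * _)%g; apply/continuousEP => u.
  change (1 = ((g u)^-1%:C)%C * (\sum_(t <- s) realf (mkcts (cN t))) u).
  by rewrite realf_sumE -rmorphM mulVf ?gt_eqF// rmorph1.
rewrite aNE.
apply: le_trans (cxmap_realM_le (M := (th ^+ (2 * N))^-1) _ _ _) _.
- by rewrite invr_ge0 ltW.
- by move=> u; rewrite /= /mkcts invr_ge0 (ltW (g0 u))/= lef_pV2 ?posrE.
rewrite mulrC ler_pdivrMr//; apply: le_trans (cnorm_sum _ _) _.
have -> : (size s)%:R * (r' ^+ 2 / th ^+ 2) ^+ N * th ^+ (2 * N) =
    (size s)%:R * (r' ^+ 2) ^+ N.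
  rewrite expr_div_n -[(th ^+ 2) ^+ N]exprM -mulrA divfK//.
  by rewrite gt_eqF.
rewrite -sum1_size natr_sum mulr_suml; apply: ler_sum => t _; rewrite mul1r.
have -> : (cxmap (realf (mkcts (cN t))) * (a ^+ N))%g =
   ((star (cxmap (realf (l t)) * b) * (cxmap (realf (l t)) * b)) ^+ N)%g :> A.
  have -> : (star (cxmap (realf (l t)) * b) * (cxmap (realf (l t)) * b) =
     (cxmap (realf (l t)) ^+ 2) * a)%g.
    rewrite starM -cxmap_star star_realf /a expg2.
    rewrite -(cxmap_central _ (star b)) -!mulgA; congr (_ * _)%g.
    by rewrite !mulgA; congr (_ * _)%g; rewrite cxmap_central.
  rewrite [RHS]expgMn; last first.
    by rewrite /commute -cxmap_expg cxmap_central.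
  by rewrite -expgnA -cxmap_expg (realf_expg (cN t)).
apply: le_trans (cnorm_expg_le _ _) _.
apply: lerXn2r; rewrite ?nnegrE ?cnorm_ge0 ?exprn_ge0 ?(ltW r'0)//.
rewrite cstar_identity; apply: lerXn2r; rewrite ?nnegrE ?cnorm_ge0 ?(ltW r'0)//.
exact: ltW.
Qed.

Lemma fibres_separate b : (forall t, fibre_pi t b = 0) -> b = 0.
Proof.
move=> b0; apply/cnorm_eq0/eqP; rewrite eq_le cnorm_ge0 andbT.
by apply: fibre_norm_sup => // t; rewrite b0 cnorm0.
Qed.

Hypothesis Y_hausdorff : hausdorff_space Y.

(** [E t r u] reads: [u] is [r] times an admissible value at [t].  In this homogeneous
    form convexity of the set of admissible values becomes closure under addition, and a
    partition of unity can be summed term by term. *)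
Lemma patch (E : forall t, R -> fibre A t -> Prop) :
  (forall t, E t 0 0) ->
  (forall t r r' u u', E t r u -> E t r' u' -> E t (r + r') (u + u')) ->
  (forall t k r u, 0 <= k -> E t r u -> E t (k * r) ((k%:C)%C *: u)) ->
  (forall t, exists a, \forall t' \near t, E t' 1 (fibre_pi t' a)) ->
  exists a, forall t, E t 1 (fibre_pi t a).
Proof.
move=> E0 ED EZ loc.
pose a_ t := projT1 (cid (loc t)).
have aE t : \forall t' \near t, E t' 1 (fibre_pi t' (a_ t)).
  by rewrite /a_; case: cid.
pose f t := projT1 (cid (bump R Y_compact Y_hausdorff (aE t))).
have ft t : f t t = 1 by rewrite /f; case: cid => ? [].
have f01 t u : 0 <= f t u <= 1 by rewrite /f; case: cid => ? [].
have fE t u : f t u != 0 -> E u 1 (fibre_pi u (a_ t)).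
  by rewrite /f; case: cid => f' [? ? H]; exact: H.
have [|s [_ sU]] := @finite_cover Y setT (fun t => [set u | 0 < f t u]) Y_compact.
  move=> t _; have /cvgrPdist_lt/(_ 1 ltr01) := @cts_fun _ _ (f t) t.
  by apply: filterS => u /=; rewrite ft ltr_distl => /andP[_]; lra.
have cf t : continuous (f t) by exact: cts_fun.
have cg := continuous_sum (s := s) cf; set g := (fun u => _) in cg.
have g0 u : 0 < g u.
  have [//|t ts tl] := sU u; rewrite /g (perm_big _ (perm_to_rem ts)) big_cons /=.
  by rewrite ltr_wpDr// sumr_ge0// => v _; have /andP[] := f01 v u.
have cw t : continuous (fun u => f t u / g u).
  by move=> u; apply: cvgM; [exact: cf|apply: cvgV; [rewrite gt_eqF|exact: cg]].
exists (\sum_(t <- s) (cxmap (realf (mkcts (cw t))) * a_ t)%g) => u.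
have -> : (1 : R) = \sum_(t <- s) (f t u / g u).
  by rewrite -mulr_suml -/(g u) divff// gt_eqF.
elim: (s) => [|t s' IH].
  by rewrite !big_nil [fibre_pi _ _]qpi0; exact: E0.
rewrite !big_cons [fibre_pi _ _]qpiD; apply: ED; last exact: IH.
rewrite -[qpi _ _]/(fibre_pi u _) fibre_pi_cxmapM.
change (E u (f t u / g u) (((f t u / g u)%:C)%C *: fibre_pi u (a_ t))).
have [->|fu] := eqVneq (f t u) 0; first by rewrite mul0r scale0r; exact: E0.
rewrite -{1}[f t u / g u]mulr1; apply: EZ; last exact: fE.
by have /andP[ftu _] := f01 t u; exact: divr_ge0 ftu (ltW (g0 u)).
Qed.

End patching.

(** * Michael selections *)

Section selection.
Variables (R : realType) (Y : topologicalType) (A : cxCStarAlgType R Y).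
Hypotheses (Y_compact : compact [set: Y]) (Y_hausdorff : hausdorff_space Y).
Variable K : forall t, fibre A t -> Prop.
Arguments K : clear implicits.
Hypothesis K0 : forall t, K t 0.
Hypothesis KD : forall t u v, K t u -> K t v -> K t (u + v).
Hypothesis KZ : forall t k u, K t u -> K t (k *: u).

Definition near_K (t : Y) (e : R) (u : fibre A t) :=
  exists2 v, K t v & cnorm (v - u) <= e.

Hypothesis K_lsc : forall t v, K t v -> forall e, 0 < e ->
  exists2 b : A, fibre_pi t b = v &
    \forall t' \near t, near_K e (fibre_pi t' b).

Let near_KZ t k (r e : R) u : 0 <= k -> near_K (r * e) u ->
  @near_K t (k * r * e) ((k%:C)%C *: u).
Proof.
move=> k0 [v Kv vu]; exists ((k%:C)%C *: v); first exact: KZ.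
by rewrite -scalerBr cnormZ normc_real ger0_norm// -mulrA ler_wpM2l.
Qed.

Let near_KD t (e e' : R) u u' : near_K e u -> near_K e' u' ->
  @near_K t (e + e') (u + u').
Proof.
move=> [v Kv vu] [v' Kv' vu']; exists (v + v'); first exact: KD.
by rewrite opprD addrACA (le_trans (cnormD _ _))// lerD.
Qed.

Let near_K0 t (e : R) : 0 <= e -> @near_K t e 0.
Proof. by move=> e0; exists 0 => //; rewrite subrr cnorm0. Qed.

Let refine (d : A) (e e' : R) : 0 < e -> 0 < e' ->
  (forall t, near_K e (fibre_pi t d)) ->
  exists2 d' : A, forall t, near_K e' (fibre_pi t d') & cnorm (d' - d) <= 2 * e.
Proof.
move=> e0 e'0 dK.
pose E t r (u : fibre A t) :=
  cnorm (u - (r%:C)%C *: fibre_pi t d) <= r * (2 * e) /\ near_K (r * e') u.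
have [|||t|d' d'E] := @patch R Y A Y_compact Y_hausdorff E.
- move=> t; split; last by rewrite mul0r; exact: near_K0.
  by rewrite scale0r subrr cnorm0 mul0r.
- move=> t r r' u u' [h1 h2] [h1' h2']; split; last first.
    by rewrite mulrDl; exact: near_KD.
  rewrite rmorphD scalerDl opprD addrACA (le_trans (cnormD _ _))// mulrDl.
  exact: lerD.
- move=> t k r u k0 [h1 h2]; split; last exact: near_KZ.
  rewrite rmorphM -scalerA -scalerBr cnormZ normc_real ger0_norm// -mulrA.
  exact: ler_wpM2l.
- have [v Kv vd] := dK t; have [b bv bK] := K_lsc Kv e'0; exists b.
  (* the bound [e] at [t] is not strict: only a larger one persists near [t] *)
  have : cnorm (fibre_pi t (b - d)) < 2 * e.
    rewrite [fibre_pi _ _]qpiB -!/(fibre_pi _ _) bv (le_lt_trans vd)//.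
    by rewrite mulrC mulr2n mulrDr mulr1 ltrDl.
  move=> /cnorm_usc; apply: filterS2 bK => t' bK' h; split.
    rewrite rmorph1 scale1r mul1r; move: h; rewrite [fibre_pi _ _]qpiB.
    exact: ltW.
  by rewrite mul1r.
exists d' => [t|]; first by have [_] := d'E t; rewrite mul1r.
apply: fibre_norm_sup => // [|t]; first by rewrite mulr_ge0// ltW.
by have [+ _] := d'E t; rewrite rmorph1 scale1r mul1r [fibre_pi _ (_ - _)]qpiB.
Qed.

(** Michael's argument.  An element close to [K] in every fibre can be patched to one
    that is as close to [K] as desired, moving it by at most twice its distance to [K];
    with distances [e1 / 2 ^ n] these moves are summable.  The limit lies in the closure
    of [K t] for every [t]. *)
Lemma selection t0 v (e : R) : K t0 v -> 0 < e ->
  exists2 d : A, cnorm (fibre_pi t0 d - v) <= e &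
    forall t e', 0 < e' -> near_K e' (fibre_pi t d).
Proof.
move=> Kv e0; pose e1 := e / 4.
have e10 : 0 < e1 by rewrite divr_gt0.
have pow0 n : (0 : R) < 2 ^+ n by exact: exprn_gt0.
have en0 n : 0 < e1 / 2 ^+ n by rewrite divr_gt0.
have [b bv bK] := K_lsc Kv e10.
have [l [lt l01 lK]] := bump R Y_compact Y_hausdorff bK.
pose d0 : A := (cxmap (realf l) * b)%g.
have d0v : fibre_pi t0 d0 = v by rewrite fibre_pi_realfM.
have d0K t : near_K (e1 / 2 ^+ 0) (fibre_pi t d0).
  rewrite expr0 divr1 fibre_pi_cxmapM.
  change (near_K e1 (((l t)%:C)%C *: fibre_pi t b)).
  have [->|l0] := eqVneq (l t) 0; first by rewrite scale0r; exact/near_K0/ltW.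
  have /andP[lt0 lt1] := l01 t.
  have [w Kw wb] := lK t l0; exists (((l t)%:C)%C *: w); first exact: KZ.
  rewrite -scalerBr cnormZ normc_real ger0_norm//.
  by apply: le_trans wb; rewrite ler_piMl// cnorm_ge0.
pose T n := {d : A | forall t, near_K (e1 / 2 ^+ n) (fibre_pi t d)}.
have step n (d : T n) : {d' : T n.+1 | cnorm (sval d' - sval d) <= 2 * (e1 / 2 ^+ n)}.
  have /cid2[d' h1 h2] := refine (en0 n) (en0 n.+1) (svalP d).
  by exists (exist _ d' h1).
pose D := fix D n : T n := if n is n'.+1 then sval (step n' (D n')) else exist _ d0 d0K.
pose d_ n := sval (D n).
have dS n : cnorm (d_ n.+1 - d_ n) <= (2 * e1) / 2 ^+ n.
  by rewrite -mulrA; exact: svalP (step n (D n)).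
have [d dL] := cnorm_complete dS.
have dLt t n : cnorm (fibre_pi t d - fibre_pi t (d_ n)) <= 2 * (2 * e1) / 2 ^+ n.
  apply: le_trans (dL n).
  by rewrite -[X in cnorm X <= _]qpiB; exact: cnorm_pi_le.
exists d.
  have := dLt t0 0%N; rewrite expr0 divr1 [d_ 0%N]/d_ /= d0v /e1.
  by move=> /le_trans; apply; lra.
move=> t e' e'0.
have [n en] := geometric_small (mulr_ge0 (ler0n R 5) (ltW e10)) e'0.
have [w Kw wd] := svalP (D n) t.
exists w => //; rewrite -(subrK (fibre_pi t (d_ n)) w) -addrA.
apply: le_trans (cnormD _ _) _; rewrite (cnormBC (fibre_pi t (d_ n))).
apply: le_trans (lerD wd (dLt t n)) _; apply: le_trans (ltW en).
by rewrite -mulrDl; lra.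
Qed.
End selection.

(** * Group bundles with a Haar functional are open *)

Section group_bundle.
Variables (G X : topologicalType) (p : compactGroupBundle G X).

Lemma bmulrV y : bmul p y (binv p y) = bone p (p y).
Proof.
pose z := binv p y; have pz : p z = p y by exact: bproj_inv.
have pzz : p (binv p z) = p y by rewrite bproj_inv.
have pyz : p (bmul p y z) = p y by rewrite bproj_mul.
have H1 : bone p (p y) = bmul p (binv p z) z by rewrite -pz -bmulV.
rewrite -/z; have -> : bmul p y z = bmul p (bmul p (binv p z) z) (bmul p y z).
  by rewrite -H1 -{1}pyz bmul1.
rewrite -(bmulA (c := p)) ?pzz ?pz ?pyz//.
have -> : bmul p z (bmul p y z) = z; last by rewrite -H1.
by rewrite (bmulA (c := p)) ?pz// bmulV -pz bmul1.
Qed.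

Lemma bmulr1 y : bmul p y (bone p (p y)) = y.
Proof. by rewrite -(bmulV p y) (bmulA (c := p)) ?bproj_inv// bmulrV bmul1. Qed.

Lemma bmulKV y u : p y = p u -> bmul p (bmul p y (binv p u)) u = y.
Proof.
by move=> yu; rewrite -(bmulA (c := p)) ?bproj_inv// bmulV -yu bmulr1.
Qed.
End group_bundle.

Section complex_parts.
Variable R : realType.

Lemma Re_le_normc (z : R[i]) : `|complex.Re z| <= normc z.
Proof.
by case: z => x y /=; rewrite -sqrtr_sqr ler_sqrt ?addr_ge0 ?sqr_ge0// lerDl sqr_ge0.
Qed.
Lemma Im_le_normc (z : R[i]) : `|complex.Im z| <= normc z.
Proof.
by case: z => x y /=; rewrite -sqrtr_sqr ler_sqrt ?addr_ge0 ?sqr_ge0// lerDr sqr_ge0.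
Qed.

Lemma continuous_normc_cont (Y : topologicalType) (f : contfun R Y) (g : Y -> R) :
  (forall t u, `|g t - g u| <= normc (f t - f u)) -> continuous g.
Proof.
move=> gf t; apply/cvgrPdist_lt => e e0.
have eC : 0 < (e%:C)%C :> R[i] by rewrite ltcR.
have /cvgrPdist_lt/(_ _ eC) := @cts_fun _ _ f t.
by apply: filterS => u; rewrite norm_normc ltcR; apply: le_lt_trans.
Qed.

Lemma constant_continuous (Y : topologicalType) (k : R) : continuous (fun _ : Y => k).
Proof. by move=> t; exact: cvg_cst. Qed.

Lemma continuous_bounded (Y : topologicalType) (f : Y -> R) :
  compact [set: Y] -> continuous f -> exists2 M, 0 <= M & forall t, `|f t| <= M.
Proof.
move=> cY cf.
have [t _|s [_ sU]] := @finite_cover Y setT (fun t => [set u | `|f u| <= `|f t| + 1]) cY.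
  have /cvgrPdist_lt/(_ 1 ltr01) := cf t; apply: filterS => u /= h.
  rewrite addrC -lerBlDr; apply: le_trans (ltW h); rewrite distrC.
  exact: lerB_dist.
exists (\sum_(t <- s) (`|f t| + 1)) => [|u].
  by rewrite sumr_ge0// => t _; rewrite addr_ge0.
have [//|t ts h] := sU u; rewrite (perm_big _ (perm_to_rem ts)) big_cons /=.
by apply: le_trans h _; rewrite lerDl sumr_ge0// => v _; rewrite addr_ge0.
Qed.
End complex_parts.

Section haar.
Variables (R : realType) (G X : topologicalType) (p : compactGroupBundle G X).
Hypothesis X_hausdorff : hausdorff_space X.
Variable phi : contfun R G -> contfun R X.
Hypothesis phiH : haar_functional p phi.
Implicit Types (z w : contfun R G) (x : X).

(** Translation by the unit of [G_x] is the restriction to [G_x], so that invariance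
    contains the fact that [phi_x] depends on this restriction only. *)
Lemma haar_local z w x : (forall y, p y = x -> z y = w y) -> phi z x = phi w x.
Proof.
move=> zw; rewrite -(bproj_one p x); apply: (haar_invariant phiH) => y.
by rewrite bproj_one => yx; rewrite -yx bmul1 zw.
Qed.

Lemma haar0 : phi 0 = 0.
Proof. by apply: (addrI (phi 0)); rewrite -(haarD phiH) !addr0. Qed.

Lemma haarZ (k : R[i]) z x : phi (k *: z) x = k * phi z x.
Proof. by rewrite (haar_module phiH (f := cst k) (z := z)). Qed.

Lemma haarN z : phi (- z) = - phi z.
Proof. by apply: (addrI (phi z)); rewrite -(haarD phiH) !subrr haar0. Qed.

Lemma haar_sum (I : Type) (s : seq I) (f : I -> contfun R G) :
  phi (\sum_(i <- s) f i) = \sum_(i <- s) phi (f i).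
Proof.
elim: s => [|i s IH]; first by rewrite !big_nil haar0.
by rewrite !big_cons (haarD phiH) IH.
Qed.

Lemma haar_real (h : continuousType G R) x : (forall y, 0 <= h y) ->
  0 <= (phi (realf h) x : R[i]).
Proof. by move=> h0; apply: (haar_ge0 phiH) => y; rewrite [_ y]/(((h y)%:C)%C) ler0c. Qed.

(** A positive functional that vanishes at 1 vanishes at all bounded functions. *)
Lemma haar_one_neq0 x : phi (realf (mkcts (@constant_continuous R G 1))) x <> 0.
Proof.
move=> one0; have [z] := haar_neq0 phiH x; apply.
have real0 (h : continuousType G R) : phi (realf h) x = 0.
  have [M M0 hM] := continuous_bounded (bundle_compact p) (@cts_fun _ _ h).
  have cD : continuous (fun y => M + h y).
    by move=> y; apply: cvgD; [exact: cvg_cst|exact: cts_fun].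
  have cB : continuous (fun y => M - h y).
    by move=> y; apply: cvgB; [exact: cvg_cst|exact: cts_fun].
  pose o : contfun R G := realf (mkcts (@constant_continuous R G 1)).
  have E1 : realf (mkcts cD) = (M%:C)%C *: o + realf h.
    apply/continuousEP => y; change (((M + h y)%:C)%C = (M%:C)%C * (1%:C)%C + ((h y)%:C)%C).
    by rewrite rmorphD rmorph1 mulr1.
  have E2 : realf (mkcts cB) = (M%:C)%C *: o - realf h.
    apply/continuousEP => y; change (((M - h y)%:C)%C = (M%:C)%C * (1%:C)%C - ((h y)%:C)%C).
    by rewrite rmorphB rmorph1 mulr1.
  have p1 : 0 <= (phi (realf (mkcts cD)) x : R[i]).
    by apply: haar_real => y; have := hM y; rewrite ler_norml /= /mkcts => /andP[]; lra.
  have p2 : 0 <= (phi (realf (mkcts cB)) x : R[i]).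
    by apply: haar_real => y; have := hM y; rewrite ler_norml /= /mkcts => /andP[]; lra.
  move: p1 p2; rewrite E1 E2 !(haarD phiH) haarN.
  change (0 <= phi ((M%:C)%C *: o) x + phi (realf h) x :> R[i] ->
    0 <= phi ((M%:C)%C *: o) x - phi (realf h) x :> R[i] -> phi (realf h) x = 0).
  rewrite haarZ one0 mulr0 add0r sub0r => h1 h2; apply/eqP.
  by rewrite eq_le h1 andbT -oppr_ge0 h2.
have cre : continuous (fun y => complex.Re (z y)).
  by apply: (@continuous_normc_cont _ _ z) => t u; rewrite -raddfB; exact: Re_le_normc.
have cim : continuous (fun y => complex.Im (z y)).
  by apply: (@continuous_normc_cont _ _ z) => t u; rewrite -raddfB; exact: Im_le_normc.
have -> : z = realf (mkcts cre) + 'i%C *: realf (mkcts cim).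
  by apply/continuousEP => y; exact: complexE.
rewrite (haarD phiH); change (phi (realf (mkcts cre)) x + phi ('i%C *: realf (mkcts cim)) x = 0).
by rewrite haarZ !real0 mulr0 addr0.
Qed.

(** The translate of [z] by [g] is defined on the fibre of [g] only; Tietze extends it
    to [G], where the Haar functional can be applied to it. *)
Lemma translate_extension (z : continuousType G R) g : (forall y, 0 <= z y <= 1) ->
  exists w : continuousType G R, forall y, p y = p g -> w y = z (bmul p g y).
Proof.
move=> z01.
have clF : closed (p @^-1` [set p g]).
  apply: preimage_closed; last exact/accessible_closed_set1/hausdorff_accessible.
  by move=> ? _; exact: bproj_continuous.
have nG : normal_space G.
  exact: compact_normal (@bundle_hausdorff _ _ p) (bundle_compact p).
have [|y /= yg|w [wE cw _]] := @continuous_bounded_extension G R nG _ clF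
    (fun y => z (bmul p g y)) 1 ltr01.
- apply/subspace_continuousP => y /= yg.
  have := @bmul_continuous _ _ p (p g) => /subspace_continuousP/(_ (g, y) (conj erefl yg)).
  move=> mc; apply: cvg_comp; last exact: cts_fun.
  move=> N /mc; rewrite /nbhs /= /within /=.
  case=> -[P Q] /= [Pg Qy] PQ; apply: filterS Qy => y' Qy' y'g.
  by apply: (PQ (g, y')) => //; split => //=; exact: nbhs_singleton.
- by have /andP[h0 h1] := z01 (bmul p g y); rewrite ger0_norm.
by exists (mkcts cw) => y yg; rewrite /= /mkcts -wE// inE.
Qed.

(** The measure [phi_x] charges all open sets of [G_x]: if it vanished at a bump
    function [z] at [y0], it would vanish at a sum of finitely many translates of [z]
    that is at least 1/2 on the compact fibre.  So [phi z] does not vanish near [p y0],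
    and [z], which is supported in [U], cannot vanish on the fibres over points near
    [p y0]. *)
Lemma haar_open y0 (U : set G) : nbhs y0 U -> nbhs (p y0) (p @` U).
Proof.
move=> y0U; set x0 := p y0.
have [z [zy z01 zU]] := bump R (bundle_compact p) (@bundle_hausdorff _ _ p) y0U.
suff pos : phi (realf z) x0 <> 0.
  have cpos : 0 < normc (phi (realf z) x0).
    by rewrite normc_gt0; apply/eqP.
  have := @normc_cont _ _ (phi (realf z)) x0 => /cvgrPdist_lt/(_ _ cpos).
  apply: filterS => x; rewrite ltr_distl => /andP[_]; rewrite ltrDr => hx.
  apply: contrapT => nU; move: hx.
  have -> : phi (realf z) x = phi 0 x.
    apply: haar_local => y yx; change (((z y)%:C)%C = 0 :> R[i]).
    have [->|zn] := eqVneq (z y) 0; first by rewrite rmorph0.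
    by case: nU; exists y => //; exact: zU.
  by rewrite haar0 normc0 ltxx.
move=> phi0.
pose F : set G := p @^-1` [set x0].
have clF : closed F.
  apply: preimage_closed; last exact/accessible_closed_set1/hausdorff_accessible.
  by move=> ? _; exact: bproj_continuous.
have cF : compact F by apply: (subclosed_compact clF (bundle_compact p)).
have gx u : F u -> p (bmul p y0 (binv p u)) = x0.
  by move=> /= ux; rewrite bproj_mul// bproj_inv ux.
pose w u := projT1 (cid (translate_extension (bmul p y0 (binv p u)) z01)).
have wE u y : p y = p (bmul p y0 (binv p u)) ->
    w u y = z (bmul p (bmul p y0 (binv p u)) y).
  by rewrite /w; case: cid => w' h; exact: h.
have [u Fu|s [sF sU]] := @finite_cover G F (fun u => [set y | 2^-1 < w u y]) cF.
  have /cvgrPdist_lt/(_ (2^-1)) := @cts_fun _ _ (w u) u.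
  rewrite invr_gt0 ltr0n => /(_ isT); apply: filterS => y /=.
  rewrite [w u u]wE ?gx// bmulKV; last by rewrite Fu.
  by rewrite zy ltr_distl => /andP[_]; lra.
have cw u : continuous (w u) by exact: cts_fun.
have csum := continuous_sum (s := s) cw.
(* equal to twice the sum on the fibre of [y0], and at least 1 on all of [G] *)
have cv : continuous (fun y => Num.max (2 * \sum_(u <- s) w u y) 1).
  move=> y; apply: (@continuous_max R G (fun y => 2 * \sum_(u <- s) w u y) (fun=> 1)).
    by apply: cvgM; [exact: cvg_cst|exact: csum].
  exact: cvg_cst.
pose o : contfun R G := realf (mkcts (@constant_continuous R G 1)).
apply: (@haar_one_neq0 x0); rewrite -/o.
have vphi : phi (realf (mkcts cv)) x0 = 0.
  have -> : phi (realf (mkcts cv)) x0 = phi ((2%:C)%C *: (\sum_(u <- s) realf (w u))) x0.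
    apply: haar_local => y yx.
    change (((Num.max (2 * \sum_(u <- s) w u y) 1)%:C)%C =
       (2%:C)%C * (\sum_(u <- s) realf (w u)) y).
    rewrite realf_sumE -rmorphM /=; congr (_%:C)%C; apply/max_idPl.
    have [//|u us uy] := sU y; rewrite (perm_big _ (perm_to_rem us)) big_cons /=.
    rewrite mulrDr -[leLHS]addr0 lerD//.
      by move: uy; rewrite /=; lra.
    rewrite mulr_ge0// big_seq sumr_ge0// => v vs.
    rewrite wE; first by have /andP[] := z01 (bmul p (bmul p y0 (binv p v)) y).
    by rewrite gx//; exact: sF (mem_rem vs).
  rewrite haarZ haar_sum.
  have -> : (\sum_(u <- s) phi (realf (w u))) x0 = 0; last by rewrite mulr0.
  rewrite big_seq; elim/big_ind : _ => // [f g f0 g0|u us].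
    by change (f x0 + g x0 = 0); rewrite f0 g0 addr0.
  rewrite -phi0 -(gx u (sF u us)); apply: (haar_invariant phiH) => y yg.
  by change (((w u y)%:C)%C = ((z (bmul p (bmul p y0 (binv p u)) y))%:C)%C); rewrite wE.
have cv1 : continuous (fun y => Num.max (2 * \sum_(u <- s) w u y) 1 - 1).
  by move=> y; apply: cvgB; [exact: cv|exact: cvg_cst].
have h1 : 0 <= (phi (realf (mkcts cv1)) x0 : R[i]).
  by apply: haar_real => y; rewrite /= /mkcts subr_ge0 le_max lexx orbT.
have h2 : 0 <= (phi o x0 : R[i]) by apply: haar_real => y; exact: ler01.
apply/eqP; rewrite eq_le h2 andbT -oppr_ge0.
move: h1; have -> : realf (mkcts cv1) = realf (mkcts cv) - o.
  by apply/continuousEP => y; exact: rmorphB.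
rewrite (haarD phiH) haarN.
change (0 <= phi (realf (mkcts cv)) x0 - phi o x0 :> R[i] -> 0 <= - phi o x0 :> R[i]).
by rewrite vphi sub0r.
Qed.
End haar.

(** * Fibred actions and the centre *)

Section fibred_actions.
Variables (R : realType) (G X : topologicalType) (p : compactGroupBundle G X).
Variables (B : cxCStarAlgType R X) (alpha : fibredAction p [set: G] B).

Lemma act_csec (F : forall y, fibre B (p y)) : csec F ->
  csec (fun y => act_fun alpha (p y) y (F y)).
Proof.
move=> cF y; have := @act_continuous _ _ _ _ _ _ alpha.
move=> /subspace_continuousP/(_ (y, hat_mk (F y)) (conj I erefl)) ac.
have : (fun z => (z, hat_mk (F z))) @ y -->
    within [set ys : G * hat B | setT ys.1 /\ p ys.1 = projT1 ys.2] (nbhs (y, hat_mk (F y))).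
  move=> N [[P Q] /= [Py Qy] PQ]; have Qy' := cF y _ Qy.
  by apply: filterS2 Py Qy' => z Pz Qz; exact: (PQ (z, _)).
by move=> h N /ac /h.
Qed.

Lemma act_pi_csec b : csec (fun y => act_fun alpha (p y) y (fibre_pi (p y) b)).
Proof. by apply: act_csec; exact: csec_pi (@bproj_continuous _ _ p) b. Qed.

(** Joint continuity at the zero vector gives a bound on [alpha_y], which the C*-identity
    in the fibres turns into the bound 1. *)
Lemma act_contractive x y u : p y = x -> cnorm (act_fun alpha x y u) <= cnorm u.
Proof.
move=> yx; subst x; have am := act_morphism alpha I (erefl (p y)).
have [d d0 hd] : exists2 d : R, 0 < d & forall v : fibre B (p y), cnorm v < d ->
    cnorm (act_fun alpha (p y) y v) < 1.
  have := @act_continuous _ _ _ _ _ _ alpha.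
  move=> /subspace_continuousP/(_ (y, @hat_mk R X B (p y) 0) (conj I erefl)) ac.
  have : nbhs (hat_act (act_fun alpha) y (@hat_mk R X B (p y) 0)) (hat_basic setT 0 1).
    apply: open_nbhs_nbhs; split; first exact: open_hat_basic openT ltr01.
    by split=> //=; rewrite (star_morphism0 am) [fibre_pi _ _]qpi0 subrr cnorm0.
  move=> /ac[[P Q] /= [Py Qy] PQ].
  have [U [a [e [oU e0 [/= Uy ae] UQ]]]] := nbhs_hat Qy.
  exists (e - cnorm (0 - fibre_pi (p y) a)); first by rewrite subr_gt0.
  move=> v vd; have Qv : Q (hat_mk v).
    apply: UQ; split=> //=; rewrite -[- fibre_pi _ _]sub0r.
    by apply: le_lt_trans (cnormD _ _) _; rewrite -ltrBrDr.
  have [_ /=] := PQ (y, hat_mk v) (conj (nbhs_singleton Py) Qv) (conj I erefl).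
  by rewrite [fibre_pi _ _]qpi0 subr0.
apply: (@bounded_contractive R _ _ _ (2 / d)) => //.
- exact: fibre_cstar_like.
- exact: fibre_cstar_like.
move=> v; have [v0|vn0] := eqVneq (cnorm v) 0.
  by rewrite (fibre_norm_eq0 v0) (star_morphism0 am) cnorm0 mulr0.
have vp : 0 < cnorm v by rewrite lt_neqAle eq_sym vn0 cnorm_ge0.
have k0 : 0 < d / (2 * cnorm v) by rewrite divr_gt0// mulr_gt0.
have := hd (((d / (2 * cnorm v))%:C)%C *: v).
rewrite (smZ am) !cnormZ normc_real ger0_norm ?(ltW k0)//.
have -> : d / (2 * cnorm v) * cnorm v = d / 2 by field.
move=> /(_ _)/ltW H; rewrite mulrAC ler_pdivlMr//.
have {}H := H _; have hd2 : d / 2 < d by lra.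
have := H hd2; rewrite mulrAC ler_pdivrMr ?mulr_gt0// mul1r.
by rewrite mulrC.
Qed.

Lemma actK y u : act_fun alpha (p y) (binv p y) (act_fun alpha (p y) y u) = u.
Proof.
by rewrite -act_mul ?bproj_inv// bmulV act_one.
Qed.

Lemma actVK y u : act_fun alpha (p y) y (act_fun alpha (p y) (binv p y) u) = u.
Proof.
by rewrite -act_mul ?bproj_inv// bmulrV act_one.
Qed.

Lemma act_isometry x y u : p y = x -> cnorm (act_fun alpha x y u) = cnorm u.
Proof.
move=> yx; apply/eqP; rewrite eq_le act_contractive//=.
subst x; rewrite -{1}(@actK y u); apply: act_contractive; exact: bproj_inv.
Qed.

Definition central (C : starAlgType R) (d : C) := forall a : C, (d * a = a * d)%g.

Lemma central_cxmap (d : B) f : central d -> central (cxmap f * d)%g.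
Proof.
by move=> cd a; rewrite -mulgA cd !mulgA cxmap_central.
Qed.

Lemma centralD (d d' : B) : central d -> central d' -> central (d + d').
Proof. by move=> cd cd' a; rewrite amulDl amulDr cd cd'. Qed.

Lemma centralB (d d' : B) : central d -> central d' -> central (d - d').
Proof. by move=> cd cd' a; rewrite amulBl amulBr cd cd'. Qed.

Lemma central_limit (C : snStarAlgType R) (d : C) :
  (forall c : C, cnorm c = 0 -> c = 0) ->
  (forall e, 0 < e -> exists2 d', central d' & cnorm (d' - d) <= e) -> central d.
Proof.
move=> def H a; apply/eqP; rewrite -subr_eq0; apply/eqP/def/eqP.
rewrite eq_le cnorm_ge0 andbT; apply/ler_addgt0Pr => e e0; rewrite add0r.
have c1 : 0 < 2 * (cnorm a + 1) by rewrite mulr_gt0// ltr_wpDl// cnorm_ge0.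
have [d' cd' dd'] := H _ (divr_gt0 e0 c1).
have -> : (d * a)%g - (a * d)%g = ((a * (d' - d)%R)%g - ((d' - d)%R * a)%g).
  by rewrite amulBl amulBr cd' opprB [RHS]addrC addrA subrK.
apply: le_trans (cnormD _ _) _; rewrite cnormN.
have h1 := cnormM a (d' - d); have h2 := cnormM (d' - d) a.
have h3 : cnorm (d' - d) * (2 * (cnorm a + 1)) <= e by rewrite -ler_pdivlMr.
have := cnorm_ge0 (d' - d); have := cnorm_ge0 a.
by move: h1 h2 h3; nra.
Qed.

(** The image of the centre in a fibre is closed.  The successive differences of an
    approximating sequence have small norm at [x]; multiplied by cut-offs equal to 1 at
    [x] they have small norm in [B], are still central and have the same image. *)
Lemma central_lift x (v : fibre B x) :
  (forall e, 0 < e -> exists2 d : B, central d & cnorm (fibre_pi x d - v) <= e) ->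
  exists2 d : B, central d & fibre_pi x d = v.
Proof.
move=> H; have pow0 n : (0 : R) < 2 ^+ n by exact: exprn_gt0.
have en0 n : (0 : R) < 1 / 2 ^+ n by rewrite divr_gt0.
pose T n := {d : B | central d /\ cnorm (fibre_pi x d - v) <= 1 / 2 ^+ n}.
have step n (d : T n) : {d' : T n.+1 | cnorm (sval d' - sval d) <= 3 / 2 ^+ n}.
  apply: cid; have [d' cd' d'v] := H _ (en0 n.+1); have [cd dv] := svalP d.
  have small : cnorm (fibre_pi x (d' - sval d)) < 3 / 2 ^+ n.
    rewrite [fibre_pi _ _]qpiB -(subrK v (qpi _ d')) -addrA.
    apply: le_lt_trans (cnormD _ _) _; rewrite (cnormBC v).
    apply: le_lt_trans (lerD d'v dv) _.
    have -> : 1 / 2 ^+ n.+1 = (1 / 2 ^+ n) / 2 :> R.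
      by rewrite exprS; field; rewrite gt_eqF.
    have -> : 3 / 2 ^+ n = 3 * (1 / 2 ^+ n) :> R by rewrite mul1r.
    by have := en0 n; lra.
  have [l [lx l01 ll]] := fibre_norm_local small.
  pose d2 : B := sval d + (cxmap (realf l) * (d' - sval d)%R)%g.
  have d2P : central d2 /\ cnorm (fibre_pi x d2 - v) <= 1 / 2 ^+ n.+1.
    split; first by apply: centralD => //; apply: central_cxmap; exact: centralB.
    rewrite [fibre_pi _ _]qpiD -!/(fibre_pi _ _) fibre_pi_realfM//.
    by rewrite [fibre_pi x (_ - _)]qpiB -!/(fibre_pi _ _) [X in cnorm (X - v)]addrC subrK.
  by exists (exist _ d2 d2P); rewrite /= /d2 addrAC subrr add0r ltW.
have [d0 cd0 d0v] := H _ (en0 0%N).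
pose D := fix D n : T n :=
  if n is n'.+1 then sval (step n' (D n')) else exist _ d0 (conj cd0 d0v).
pose d_ n := sval (D n).
have dS n : cnorm (d_ n.+1 - d_ n) <= 3 / 2 ^+ n by exact: svalP (step n (D n)).
have [d dL] := cnorm_complete dS.
have small (e : R) : 0 < e -> exists n, 7 / 2 ^+ n <= e.
  by move=> /(geometric_small (ler0n R 7))[n /ltW]; exists n.
exists d.
  apply: central_limit => [c|e e0]; first exact: cnorm_eq0.
  have [n ne] := small e e0; exists (d_ n); first exact: (svalP (D n)).1.
  rewrite cnormBC; apply: le_trans (dL n) _; apply: le_trans ne.
  by rewrite ler_pM2r ?invr_gt0//; lra.
apply/eqP; rewrite -subr_eq0; apply/eqP/fibre_norm_eq0/eqP.
rewrite eq_le cnorm_ge0 andbT; apply/ler_addgt0Pr => e e0; rewrite add0r.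
have [n ne] := small e e0.
rewrite -(subrK (fibre_pi x (d_ n)) (fibre_pi x d)) -addrA.
apply: le_trans (cnormD _ _) _.
have h2 : cnorm (fibre_pi x (d_ n) - v) <= 1 / 2 ^+ n := (svalP (D n)).2.
have h1 : cnorm (fibre_pi x d - fibre_pi x (d_ n)) <= 2 * 3 / 2 ^+ n.
  by rewrite -[X in cnorm X]qpiB; apply: le_trans (dL n); exact: cnorm_pi_le.
apply: le_trans (lerD h1 h2) _; apply: le_trans ne.
by rewrite -mulrDl ler_pM2r ?invr_gt0//; lra.
Qed.

Hypotheses (X_compact : compact [set: X]) (X_hausdorff : hausdorff_space X).
Hypothesis p_open : forall y U, nbhs y U -> nbhs (p y) (p @` U).

(** The linear span of the [alpha_y (pi_x d)] with [d] central, defined impredicatively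
    because it is used through induction on the generation of its elements. *)
Definition central_span x (u : fibre B x) := forall P : fibre B x -> Prop,
  P 0 -> (forall u v, P u -> P v -> P (u + v)) -> (forall k u, P u -> P (k *: u)) ->
  (forall y (d : B), p y = x -> central d -> P (act_fun alpha x y (fibre_pi x d))) -> P u.

Lemma central_span_central x (u : fibre B x) : central_span u -> central u.
Proof.
apply => [a|v w cv cw a|k v cv a|y d yx cd a].
- by rewrite amul0l amul0r.
- by rewrite amulDl amulDr cv cw.
- by rewrite amulZl amulZr cv.
have [g gK Kg] := act_bijective alpha I yx.
have am := act_morphism alpha I yx.
rewrite -(Kg a) -!(smM am); congr act_fun.
by rewrite -(qliftK (g a)) -!qpiM cd.
Qed.

(** The automorphism [alpha_y] preserves the centre of the fibre, but a central element
    of a fibre need not come from a central element of [B].  The spans [central_span]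
    form a lower semicontinuous family, because [p] is open and the sections
    [alpha_y (pi d)] are continuous.  A selection of it is central in every fibre, hence
    central, and it can be chosen close to a given [alpha_y (pi_x d)]. *)
Lemma act_central (d : B) x y : p y = x -> central d ->
  exists2 d' : B, central d' & fibre_pi x d' = act_fun alpha x y (fibre_pi x d).
Proof.
move=> yx cd; apply: central_lift => e e0.
have gen t z c : p z = t -> central c -> central_span (act_fun alpha t z (fibre_pi t c)).
  by move=> zx cc P _ _ _; exact.
have [||||d' d'v dK] := @selection R X B X_compact X_hausdorff central_span _ _ _ _ x _ e
  (gen x y d yx cd) e0.
- by move=> t P.
- move=> t u v Ku Kv P P0 PD PZ PA; apply: (PD); [exact: Ku|exact: Kv].
- by move=> t k u Ku P P0 PD PZ PA; apply: (PZ); exact: Ku.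
- move=> t v Kv f f0.
  pose P (v : fibre B t) := exists2 b : B, fibre_pi t b = v &
      forall f, 0 < f -> \forall t' \near t, near_K central_span f (fibre_pi t' b).
  suff [b bv bK] : P v by exists b => //; exact: bK.
  move: f f0 => _ _; apply: Kv; rewrite /P.
  + exists 0; first exact: qpi0.
    move=> f f0; apply: nearW => t'; exists 0; first by move=> Q.
    by rewrite [fibre_pi _ _]qpi0 subrr cnorm0 ltW.
  + move=> u v' [b bu bK] [c cv cK]; exists (b + c); first by rewrite -bu -cv; exact: qpiD.
    move=> f f0; have f2 : 0 < f / 2 by rewrite divr_gt0.
    apply: filterS2 (bK _ f2) (cK _ f2) => t' [w Kw wb] [w' Kw' wc].
    exists (w + w').
      by move=> Q Q0 QD QZ QA; apply: (QD); [exact: Kw|exact: Kw'].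
    rewrite [fibre_pi _ _]qpiD opprD addrACA (le_trans (cnormD _ _))//.
    by rewrite [f]splitr lerD.
  + move=> k u [b bu bK]; exists (k *: b); first by rewrite -bu; exact: qpiZ.
    move=> f f0; have k1 : 0 < normc k + 1 by rewrite ltr_wpDl// normc_ge0.
    apply: filterS (bK _ (divr_gt0 f0 k1)) => t' [w Kw wb]; exists (k *: w).
      by move=> Q Q0 QD QZ QA; apply: (QZ); exact: Kw.
    rewrite [fibre_pi _ _]qpiZ -scalerBr cnormZ.
    apply: le_trans (_ : (normc k + 1) * (f / (normc k + 1)) <= _).
      by apply: ler_pM; rewrite ?normc_ge0 ?cnorm_ge0// lerDl.
    by rewrite mulrC divfK// gt_eqF.
  + move=> z c zt cc; subst t.
    exists (qlift (act_fun alpha (p z) z (fibre_pi (p z) c))); first exact: qliftK.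
    move=> f f0; set b := qlift _.
    have := (continuous_sectionP _ (@bproj_continuous _ _ p)).1 (@act_pi_csec c) z b f
      (qliftK _) f0.
    move=> /p_open; apply: filterS => t' [z' z'b z't']; subst t'.
    exists (act_fun alpha (p z') z' (fibre_pi (p z') c)); last exact: ltW.
    exact: gen.
- exists d' => // a; apply/eqP; rewrite -subr_eq0; apply/eqP.
  apply: (fibres_separate X_compact) => t.
  have cdt : central (fibre_pi t d').
    apply: central_limit => [c|f f0]; first exact: fibre_norm_eq0.
    by have [w Kw wd] := dK t f f0; exists w => //; exact: central_span_central.
  rewrite [fibre_pi _ _]qpiB; apply/eqP; rewrite subr_eq0; apply/eqP.
  by rewrite !qpiM; exact: cdt.
Qed.
End fibred_actions.

(** * [B] as an algebra over the spectrum of its centre *)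

Section over_Omega.
Variables (R : realType) (X Omega : topologicalType) (B : cxCStarAlgType R X).

(** An alias of [B], which carries its structure over [C(X)] already.  The fibre of the
    alias at [w] consists of the values at [w] of the elements of [B]. *)
Definition overOmega (gamma : centreIso Omega B) : Type := B.

Variable gamma : centreIso Omega B.

HB.instance Definition _ := CStarAlgebra.copy (overOmega gamma) B.

Lemma gamma_central f : central (gamma f : B).
Proof. by have : centre B (gamma f) by rewrite -(cen_range gamma); exists f. Qed.

HB.instance Definition _ := isCXAlgebra.Build R Omega (overOmega gamma)
  (cen_morphism gamma) (cen_one gamma) gamma_central.

Definition BO : cxCStarAlgType R Omega := overOmega gamma.

Lemma central_gamma (d : B) : central d -> exists c, gamma c = d.
Proof.
move=> cd; have : centre B d by [].
by rewrite -(cen_range gamma) => -[c _ <-]; exists c.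
Qed.

Definition fibreO (w : Omega) (b : B) : fibre BO w := @fibre_pi R Omega BO w b.

Lemma fibreO_gammaM w c b : fibreO w (gamma c * b)%g = c w *: fibreO w b.
Proof. exact: (@fibre_pi_cxmapM R Omega BO). Qed.

(** If [1 = gamma f * b] with [f w = 0], then [b] is the inverse of a central element,
    hence central, and [f] is invertible in [C(Omega)]. *)
Lemma fibreO_one_neq0 w : (1%g : fibre BO w) <> 0.
Proof.
rewrite -[1%g](qpi1 (fibre_ideal BO w)) -(qpi0 (fibre_ideal BO w)) => /qpi_eq.
rewrite subr0 => -[f [b [fw E]]].
have cb : central (b : B).
  move=> a; have fa : forall c : B, (gamma f * c = c * gamma f)%g := gamma_central f.
  have E' : (gamma f * b = 1 :> B)%g := esym E.
  have -> : (b * a = b * (a * gamma f) * b)%g by rewrite -mulgA -(mulgA a) E' mulg1.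
  by rewrite -fa mulgA -(fa b) E' mul1g.
have [c cE] := central_gamma cb.
have fc : (f * c)%g = 1%g.
  apply: (@cen_inj _ _ _ _ gamma).
  by rewrite (smM (cen_morphism gamma)) cE cen_one; exact: esym E.
have : (f * c)%g w = 1 by rewrite fc.
by change (f w * c w = 1 -> False); rewrite fw mul0r => /esym/eqP; rewrite oner_eq0.
Qed.

Lemma fibreO_one_norm w : cnorm (1%g : fibre BO w) = 1.
Proof.
have : cnorm (1%g : fibre BO w) = cnorm (1%g : fibre BO w) ^+ 2.
  by rewrite -(@fibre_cstar_like R Omega BO) star1 mulg1.
have [n0|n0] := eqVneq (cnorm (1%g : fibre BO w)) 0.
  by move/fibre_norm_eq0: n0 => /fibreO_one_neq0.
by rewrite expr2 -[X in X = _ -> _]mulr1 => /(mulfI n0).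
Qed.

Lemma fibreO_gamma w c : fibreO w (gamma c) = c w *: (1%g : fibre BO w).
Proof. exact: (@fibre_pi_cxmap R Omega BO). Qed.

Lemma fibreO_gamma_norm w c : cnorm (fibreO w (gamma c)) = normc (c w).
Proof. by rewrite fibreO_gamma cnormZ fibreO_one_norm mulr1. Qed.

Section projection.
Variable q : continuousType Omega X.
Hypothesis q_dual : dual_projection gamma q.

Lemma fibre_pi_fibreO x w b : q w = x -> fibre_pi x b = 0 -> fibreO w b = 0.
Proof.
move=> wx; rewrite -(qpi0 (fibre_ideal B x)) => /qpi_eq; rewrite subr0 => -[f [c [fx ->]]].
rewrite -(q_dual.2 f) fibreO_gammaM.
by change (f (q w) *: fibreO w c = 0); rewrite wx fx scale0r.
Qed.

Lemma fibreO_le x w b : q w = x -> cnorm (fibreO w b) <= cnorm (fibre_pi x b).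
Proof.
move=> wx; apply/ler_addgt0Pr => e e0.
have [|b' bb' b'e] := @cnorm_quot_lt R B _ (fibre_pi x b) (cnorm (fibre_pi x b) + e).
  by rewrite ltrDl.
have -> : fibreO w b = fibreO w b'.
  apply/eqP; rewrite -subr_eq0; apply/eqP; rewrite -[LHS]qpiB.
  apply: (@fibre_pi_fibreO x) => //.
  rewrite fibre_piB; apply/eqP; rewrite subr_eq0; apply/eqP; exact: esym bb'.
by apply: le_trans (ltW b'e); exact: (@cnorm_pi_le R BO).
Qed.

Lemma fibre_pi_gamma_inj x c c' w : q w = x ->
  fibre_pi x (gamma c) = fibre_pi x (gamma c') -> c w = c' w.
Proof.
move=> wx E; apply/eqP; rewrite -subr_eq0; apply/eqP/eq0_normc.
have -> : c w - c' w = (c - c') w by [].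
rewrite -fibreO_gamma_norm; apply/eqP; rewrite eq_le cnorm_ge0 andbT.
apply: le_trans (fibreO_le _ wx) _.
by rewrite (star_morphismB (cen_morphism gamma)) fibre_piB E subrr cnorm0.
Qed.

Hypotheses (X_compact : compact [set: X]) (X_hausdorff : hausdorff_space X).
Hypotheses (Omega_compact : compact [set: Omega]) (Omega_hausdorff : hausdorff_space Omega).

(** The set [D] where [c - c'] is not small has a closed image in [X] that misses [x].
    Multiplied by a bump function at [x] supported off this image, [gamma (c - c')] gets
    small in norm. *)
Lemma fibre_pi_gamma_eq x (c c' : contfun R Omega) : (forall w, q w = x -> c w = c' w) ->
  fibre_pi x (gamma c) = fibre_pi x (gamma c').
Proof.
move=> cc'; apply/eqP; rewrite -subr_eq0; apply/eqP/fibre_norm_eq0/eqP.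
rewrite eq_le cnorm_ge0 andbT; apply/ler_addgt0Pr => e e0; rewrite add0r.
rewrite -fibre_piB.
pose D : set Omega := [set w | e <= normc ((c - c') w)].
have clD : closed D.
  have -> : D = (fun w => normc ((c - c') w)) @^-1` [set r | e <= r] by [].
  by apply: preimage_closed; [move=> ? _; exact: normc_cont|exact: closed_ge].
have cqD : compact (q @` D).
  apply: continuous_compact; last exact: (subclosed_compact clD Omega_compact).
  by apply/continuous_subspaceT; exact: cts_fun.
have clqD : closed (q @` D) by exact: compact_closed.
have xD : nbhs x (~` (q @` D)).
  apply: open_nbhs_nbhs; split; first exact: closed_openC.
  move=> [w wD wx]; move: wD; rewrite /D /=.
  change (e <= normc (c w - c' w) -> False); rewrite cc'// subrr normc0.
  by rewrite leNgt e0.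
have [l [lx l01 lD]] := bump R X_compact X_hausdorff xD.
rewrite -(fibre_pi_realfM _ lx); apply: le_trans (cnorm_pi_le _ _) _.
rewrite -(star_morphismB (cen_morphism gamma)) -(q_dual.2 (realf l)).
rewrite -(smM (cen_morphism gamma)) -[gamma _]mulg1.
rewrite -[(gamma _ * 1)%g]/(cxmap _ * (1%g : BO))%g.
apply: le_trans (@cxmap_mul_le R Omega BO _ e _ (ltW e0) _) _.
  move=> w; change (normc (((l (q w))%:C)%C * (c - c') w) <= e).
  rewrite normcM normc_real; have /andP[l0 l1] := l01 (q w).
  rewrite ger0_norm//; case: (lerP e (normc ((c - c') w))) => h.
    have [->|ln] := eqVneq (l (q w)) 0; first by rewrite mul0r ltW.
    by exfalso; apply: (lD _ ln); exists w.
  by rewrite -[e]mul1r; apply: ler_pM => //; [exact: normc_ge0|exact: ltW].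
rewrite -[leRHS]mulr1 ler_wpM2l ?(ltW e0)//.
by apply: (@cnorm_unitary R Omega BO); rewrite star1 mulg1.
Qed.
End projection.
End over_Omega.

(** * The action on the spectrum of the centre *)

Section characters.
Variables (R : realType) (Y : topologicalType).
Hypotheses (Y_compact : compact [set: Y]).

(** Otherwise finitely many elements of the kernel of [chi] have no common zero, and the
    sum of their squared moduli is an invertible element of the kernel. *)
Lemma character_is_point (chi : contfun R Y -> R[i]) :
  {morph chi : f g / f + g} -> (forall f g, chi (f * g)%g = chi f * chi g) ->
  (forall k f, chi (k *: f) = k * chi f) -> chi 1%g = 1 ->
  exists t, forall f, chi f = f t.
Proof.
move=> chiD chiM chiZ chi1; apply: contrapT => nex.
have chi0 : chi 0 = 0 by rewrite -(scale0r (0 : contfun R Y)) chiZ mul0r.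
have H t : exists d : contfun R Y, chi d = 0 /\ d t <> 0.
  have [f ft] : exists f, chi f <> f t.
    by apply: contrapT => nf; apply: nex; exists t => f; apply: contrapT => ?; apply: nf; exists f.
  exists (f - chi f *: 1%g); split.
    by rewrite chiD -scaleN1r chiZ chiZ chi1 mulr1 mulN1r subrr.
  change (f t - chi f * 1 <> 0); rewrite mulr1 => /eqP.
  by rewrite subr_eq0 => /eqP/esym.
pose d t := projT1 (cid (H t)).
have chid t : chi (d t) = 0 by rewrite /d; case: cid => ? [].
have dt t : d t t <> 0 by rewrite /d; case: cid => ? [].
pose n t u := normc (d t u) ^+ 2.
have cn t : continuous (n t) by exact/continuous_sq/normc_cont.
have [|s [_ sU]] := @finite_cover Y setT (fun t => [set u | 0 < n t u]) Y_compact.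
  move=> t _; have n0 : 0 < n t t by rewrite exprn_gt0// normc_gt0; apply/eqP.
  have /cvgrPdist_lt/(_ _ n0) := cn t t.
  by apply: filterS => u /=; rewrite ltr_distl => /andP[_]; rewrite ltrDr.
have cg := continuous_sum (s := s) cn.
have g0 u : 0 < \sum_(t <- s) n t u.
  have [//|t ts tl] := sU u; rewrite (perm_big _ (perm_to_rem ts)) big_cons /=.
  by rewrite ltr_wpDr// sumr_ge0// => v _; rewrite exprn_ge0// normc_ge0.
have cV : continuous (fun u => (\sum_(t <- s) n t u)^-1).
  by move=> u; apply: cvgV; [rewrite gt_eqF|exact: cg].
pose g : contfun R Y := \sum_(t <- s) (star (d t) * d t)%g.
have gE u : g u = ((\sum_(t <- s) n t u)%:C)%C.
  rewrite /g; elim: (s) => [|t s' IH]; first by rewrite !big_nil.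
  rewrite !big_cons; change ((d t u)^* * d t u + (\sum_(t <- s') (star (d t) * d t)%g) u
     = ((n t u + \sum_(t <- s') n t u)%:C)%C).
  by rewrite IH normc_sq -rmorphD.
have chig : chi g = 0.
  rewrite /g; elim/big_ind : _ => // [f f' f0 f0'|t _]; first by rewrite chiD f0 f0' addr0.
  by rewrite chiM chid mulr0.
have gV : (g * realf (mkcts cV))%g = 1%g.
  apply/continuousEP => u; change (g u * (((\sum_(t <- s) n t u)^-1)%:C)%C = 1).
  by rewrite gE -rmorphM /= divff ?gt_eqF// rmorph1.
by have /eqP := chi1; rewrite -gV chiM chig mul0r eq_sym oner_eq0.
Qed.
End characters.

Section dual_action.
Variables (R : realType) (X G Omega : topologicalType).
Hypotheses (X_compact : compact [set: X]) (X_hausdorff : hausdorff_space X).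
Variable p : compactGroupBundle G X.
Hypothesis p_open : forall y U, nbhs y U -> nbhs (p y) (p @` U).
Variables (B : cxCStarAlgType R X) (alpha : fibredAction p [set: G] B).
Hypotheses (Omega_compact : compact [set: Omega])
  (Omega_hausdorff : hausdorff_space Omega).
Variable gamma : centreIso Omega B.
Variable q : continuousType Omega X.
Hypothesis q_dual : dual_projection gamma q.

Lemma act_gamma y c : exists c', act_fun alpha (p y) y (fibre_pi (p y) (gamma c)) =
  fibre_pi (p y) (gamma c').
Proof.
have [d cd <-] := act_central alpha X_compact X_hausdorff p_open (erefl (p y))
  (gamma_central gamma c).
by have [c' <-] := central_gamma gamma cd; exists c'.
Qed.

Lemma dual_action_exists y w : q w = p y -> exists w', dual_action alpha gamma q y w w'.
Proof.
move=> wy; pose t c := projT1 (cid (act_gamma y c)).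
have tE c : act_fun alpha (p y) y (fibre_pi (p y) (gamma c)) =
  fibre_pi (p y) (gamma (t c)) by rewrite /t; case: cid.
have uniq (c c' : contfun R Omega) : fibre_pi (p y) (gamma c) = fibre_pi (p y) (gamma c') -> c w = c' w.
  exact: (fibre_pi_gamma_inj q_dual wy).
have am := act_morphism alpha I (erefl (p y)).
have gm := cen_morphism gamma.
have am1 : act_fun alpha (p y) y 1%g = 1%g.
  have [g gK Kg] := act_bijective alpha I (erefl (p y)).
  by rewrite -[RHS]Kg -[g 1%g]mul1g (smM am) Kg mulg1.
have qE (f : contfun R X) : t (f \o q : contfun R Omega) w = f (p y).
  rewrite -wy; change (t (f \o q : contfun R Omega) w = (f \o q : contfun R Omega) w).
  by apply: uniq; rewrite -tE (q_dual.2 f) fibre_pi_cxmap (smZ am) am1.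
have [||||w' w'E] := @character_is_point R Omega Omega_compact (fun c => t c w).
- move=> c c'; change (t (c + c') w = (t c + t c') w); apply: uniq.
  by rewrite -tE !(smD gm) !fibre_piD (smD am) !tE.
- move=> c c'; change (t (c * c')%g w = (t c * t c')%g w); apply: uniq.
  by rewrite -tE !(smM gm) !fibre_piM (smM am) !tE.
- move=> k c; change (t (k *: c) w = (k *: t c) w); apply: uniq.
  by rewrite -tE !(smZ gm) !fibre_piZ (smZ am) !tE.
- change (t 1%g w = (1%g : contfun R Omega) w); apply: uniq.
  by rewrite -tE cen_one fibre_pi1 am1.
exists w'; split; last by move=> c; exists (t c); rewrite tE w'E.
apply: contrapT => nq.
have pyU : nbhs (p y) (~` [set q w']).
  apply: open_nbhs_nbhs; split; last by move=> /= /esym.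
  exact/closed_openC/accessible_closed_set1/hausdorff_accessible.
have [f [fp _ fU]] := bump R X_compact X_hausdorff pyU.
have := w'E (realf f \o q : contfun R Omega); rewrite qE.
change (((f (p y))%:C)%C = ((f (q w'))%:C)%C -> False).
rewrite fp => /(congr1 (@complex.Re R)) /= f1.
by apply: (fU (q w')); rewrite -?f1 ?oner_eq0.
Qed.

(** The point to which [y] moves [w]; meaningful for [q w = p y] only. *)
Definition dact y w : Omega := xget w [set w' | dual_action alpha gamma q y w w'].

Lemma dactP y w : q w = p y -> dual_action alpha gamma q y w (dact y w).
Proof. by move=> /dual_action_exists[w' ww']; exact: (xgetPex _ (ex_intro _ w' ww')). Qed.

Lemma q_dact y w : q w = p y -> q (dact y w) = p y.
Proof. by move=> /dactP[]. Qed.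

Lemma dactE y w (c c' : contfun R Omega) : q w = p y ->
  act_fun alpha (p y) y (fibre_pi (p y) (gamma c)) = fibre_pi (p y) (gamma c') ->
  c (dact y w) = c' w.
Proof.
move=> wy E; have [_ /(_ c)[c'' [E' ->]]] := dactP wy.
by apply: (fibre_pi_gamma_inj q_dual wy); rewrite -E -E'.
Qed.

Lemma points_separated (w w' : Omega) : (forall c : contfun R Omega, c w = c w') -> w = w'.
Proof.
move=> cc; apply: contrapT => nw.
have wU : nbhs w (~` [set w']).
  apply: open_nbhs_nbhs; split => //.
  exact/closed_openC/accessible_closed_set1/hausdorff_accessible.
have [f [fw _ fU]] := bump R Omega_compact Omega_hausdorff wU.
have := cc (realf f); change (((f w)%:C)%C = ((f w')%:C)%C -> False).
rewrite fw => /(congr1 (@complex.Re R)) /= f1.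
by apply: (fU w'); rewrite -?f1 ?oner_eq0.
Qed.

Lemma dual_action_dact y w w' : q w = p y -> dual_action alpha gamma q y w w' ->
  w' = dact y w.
Proof.
move=> wy [_ H]; apply: points_separated => c; have [c' [E ->]] := H c.
by rewrite (dactE wy E).
Qed.

Lemma dact_one x w : q w = x -> dact (bone p x) w = w.
Proof.
move=> wx; have wb : q w = p (bone p x) by rewrite bproj_one.
by apply: points_separated => c; apply: dactE => //; rewrite bproj_one act_one.
Qed.

Lemma dact_mul y z w : p y = p z -> q w = p y ->
  dact (bmul p y z) w = dact z (dact y w).
Proof.
move=> yz wy; apply: points_separated => c.
have [c1 E1] := act_gamma z c; have [c2 E2] := act_gamma y c1.
have wz : q (dact y w) = p z by rewrite q_dact.
rewrite (dactE wz E1) (dactE wy E2); apply: dactE; first by rewrite bproj_mul.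
rewrite bproj_mul// act_mul//; move: E1; rewrite -yz => ->.
by rewrite E2.
Qed.

(** Let [c'] represent [alpha_y0 (pi (gamma c))].  By continuity of the action it almost
    represents [alpha_y (pi (gamma c))] for [y] near [y0], and evaluation at points of
    [Omega] does not increase norms. *)
Lemma dact_near (y0 : G) (w0 : Omega) (c : contfun R Omega) (e : R) : 0 < e ->
  q w0 = p y0 -> \forall y \near y0 & w \near w0,
    q w = p y -> normc (c (dact y w) - c (dact y0 w0)) < e.
Proof.
move=> e0 wy; have e2 : 0 < e / 2 by rewrite divr_gt0.
have [c' E] := act_gamma y0 c; rewrite (dactE wy E).
have ny := (continuous_sectionP _ (@bproj_continuous _ _ p)).1 (@act_pi_csec _ _ _ _ _ alpha (gamma c))
  y0 (gamma c') (e / 2) (esym E) e2.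
have nw : \forall w \near w0, normc (c' w - c' w0) < e / 2.
  have eC : 0 < ((e / 2)%:C)%C :> R[i] by rewrite ltcR.
  have /cvgrPdist_lt/(_ _ eC) := @cts_fun _ _ c' w0.
  by apply: filterS => w; rewrite norm_normc ltcR -normcN opprB.
exists ([set y | cnorm (act_fun alpha (p y) y (fibre_pi (p y) (gamma c)) -
   fibre_pi (p y) (gamma c')) < e / 2], [set w | normc (c' w - c' w0) < e / 2]).
  by split; [exact: ny|exact: nw].
move=> [y w] [/= h1 h2] wy'.
have [c'' E''] := act_gamma y c; rewrite (dactE wy' E'').
have -> : c'' w - c' w0 = (c'' - c') w + (c' w - c' w0).
  by change (c'' w - c' w0 = (c'' w - c' w) + (c' w - c' w0)); rewrite addrA subrK.
apply: le_lt_trans (le_normcD _ _) _; rewrite [e]splitr; apply: ltrD => //.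
rewrite -(fibreO_gamma_norm gamma); apply: le_lt_trans (fibreO_le q_dual _ wy') _.
by rewrite (star_morphismB (cen_morphism gamma)) fibre_piB -E''.
Qed.

Section orbit_inf.
Variable h : continuousType Omega R.
Hypothesis h0 : forall w, 0 <= h w.

Definition orbit_inf w : R := inf [set h (dact y w) | y in [set y | q w = p y]].

Lemma orbit_inf_has w : has_inf [set h (dact y w) | y in [set y | q w = p y]].
Proof.
split; last by exists 0 => _ [y _ <-]; exact: h0.
by exists (h (dact (bone p (q w)) w)), (bone p (q w)) => //=; rewrite bproj_one.
Qed.

Lemma orbit_inf_le y w : q w = p y -> orbit_inf w <= h (dact y w).
Proof. by move=> wy; apply: ge_inf; [exact: (orbit_inf_has w).2|exists y]. Qed.

Let h_near y0 w0 (e : R) : 0 < e -> q w0 = p y0 -> \forall y \near y0 & w \near w0,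
  q w = p y -> `|h (dact y w) - h (dact y0 w0)| < e.
Proof.
move=> e0 wy; apply: filterS (dact_near (realf h) e0 wy) => -[y w] H /H.
change (normc (((h (dact y w))%:C)%C - ((h (dact y0 w0))%:C)%C) < e ->
  `|h (dact y w) - h (dact y0 w0)| < e).
by rewrite -rmorphB normc_real.
Qed.

(** Upper semicontinuity holds because [p] is open: an almost minimal [y0] over [q w0]
    has neighbours over all points near [q w0].  Lower semicontinuity is compactness of
    [G]. *)
Lemma orbit_inf_continuous : continuous orbit_inf.
Proof.
move=> w0; apply/cvgrPdist_lt => e e0; have e2 : 0 < e / 2 by rewrite divr_gt0.
have up : \forall w \near w0, orbit_inf w < orbit_inf w0 + e.
  have [_ [y0 /= wy <-] hy] := inf_adherent e2 (orbit_inf_has w0).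
  have [[V W] /= [yV wW] VW] := h_near e2 wy.
  have := p_open yV; rewrite -wy => /(@cts_fun _ _ q w0).
  apply: filterS2 wW => w Ww [y Vy yw].
  apply: le_lt_trans (orbit_inf_le (esym yw)) _.
  have := VW (y, w) (conj Vy Ww) (esym yw).
  by move: hy; rewrite /= -/(orbit_inf w0) ltr_distl => ? /andP[_]; lra.
have lo : \forall w \near w0, setT `<=` (fun y => q w = p y -> orbit_inf w0 - e / 2 < h (dact y w)).
  apply: ((compact_near_coveringP _).1 (bundle_compact p)) => y _.
  have [wy|wy] := pselect (q w0 = p y).
    apply: filterS (h_near e2 wy) => -[y' w] H /H; have := orbit_inf_le wy.
    by rewrite /= ltr_distl => ? /andP[]; lra.
  have [[U V] /= [/set_mem Uq /set_mem Vp] [oU oV UV]] : exists2 UV : set X * set X,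
      (q w0 \in UV.1 /\ p y \in UV.2) & [/\ open UV.1, open UV.2 & UV.1 `&` UV.2 == set0].
    by move: X_hausdorff; rewrite open_hausdorff => /(_ _ _ (introN eqP wy)).
  exists (p @^-1` V, q @^-1` U).
    split; [apply: (@bproj_continuous _ _ p)|apply: (@cts_fun _ _ q)];
      exact: open_nbhs_nbhs.
  move=> [y' w] [/= Vy Uw] wy'; exfalso.
  by move/eqP/seteqP : UV => [/(_ (p y')) + _]; apply; split=> //; rewrite -wy'.
apply: filterS2 up lo => w wu wl.
rewrite ltr_distlC; apply/andP; split; last exact: wu.
apply: (@lt_le_trans _ _ (orbit_inf w0 - e / 2)); first by lra.
apply: lb_le_inf; first exact: (orbit_inf_has w).1.
by move=> _ [y /= wy <-]; apply/ltW; exact: wl.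
Qed.

Lemma orbit_inf_invariant y w : q w = p y -> orbit_inf (dact y w) = orbit_inf w.
Proof.
move=> wy; have qw : q (dact y w) = p y by exact: q_dact.
congr inf; apply/seteqP; split=> _ [z /= wz <-].
  exists (bmul p y z); first by rewrite bproj_mul ?wy// -wz qw.
  by rewrite dact_mul// -wz qw.
have zy : p (binv p y) = p z by rewrite bproj_inv -wy.
exists (bmul p (binv p y) z); first by rewrite /= bproj_mul// bproj_inv.
rewrite -dact_mul ?bproj_mul// ?bproj_inv//; congr (h (dact _ w)).
have yz : p y = p z by rewrite -zy bproj_inv.
by rewrite (bmulA (c := p)) ?bproj_inv// bmulrV yz bmul1.
Qed.
End orbit_inf.

Hypothesis fixed_centre : centre B `&` fixed_points alpha =
  range (cxmap : contfun R X -> B).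

(** [gamma m] is fixed by the action, so that it lies in the image of [C(X)]. *)
Lemma invariant_descends (m : continuousType Omega R) :
  (forall y w, q w = p y -> m (dact y w) = m w) ->
  forall w w', q w = q w' -> m w = m w'.
Proof.
move=> minv; have : (centre B `&` fixed_points alpha) (gamma (realf m)).
  split; first exact: gamma_central.
  move=> _ y <-; have [c E] := act_gamma y (realf m); rewrite E.
  apply: (fibre_pi_gamma_eq q_dual) => // w wy.
  rewrite -(dactE wy E); change (((m (dact y w))%:C)%C = ((m w)%:C)%C).
  by rewrite minv.
rewrite fixed_centre => -[f _]; rewrite -(q_dual.2 f) => /cen_inj fm w w' ww'.
have mE v : ((m v)%:C)%C = f (q v) by change (realf m v = f (q v)); rewrite -fm.
by have := mE w; rewrite ww' -mE => /(congr1 (@complex.Re R)).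
Qed.

(** If [w'] is not in the orbit of [w], a sum of bump functions vanishes at [w'] and is at
    least 1/2 on this orbit.  Its infimum over orbits is invariant and takes different
    values at [w] and [w'], contradicting [invariant_descends]. *)
Lemma dact_transitive w w' : q w = q w' -> exists2 y, p y = q w & dact y w = w'.
Proof.
move=> ww'; apply: contrapT => nex.
pose F : set G := p @^-1` [set q w].
have cF : compact F.
  apply: (subclosed_compact _ (bundle_compact p)) => //.
  apply: preimage_closed; last exact/accessible_closed_set1/hausdorff_accessible.
  by move=> ? _; exact: bproj_continuous.
have bmp y : exists f : continuousType Omega R, F y ->
    [/\ f (dact y w) = 1, forall v, 0 <= f v <= 1 & f w' = 0].
  have [Fy|nF] := pselect (F y); last by exists (mkcts (@constant_continuous R Omega 0)).
  have yU : nbhs (dact y w) (~` [set w']).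
    apply: open_nbhs_nbhs; split; last by move=> /= E; apply: nex; exists y.
    exact/closed_openC/accessible_closed_set1/hausdorff_accessible.
  have [f [f1 f01 fU]] := bump R Omega_compact Omega_hausdorff yU.
  exists f => _; split=> //; apply/eqP; apply: contraT => /fU /=; exact.
pose f y := projT1 (cid (bmp y)).
have fP y : F y -> [/\ f y (dact y w) = 1, forall v, 0 <= f y v <= 1 & f y w' = 0].
  by rewrite /f; case: cid.
have [y Fy|s [sF sU]] := @finite_cover G F
    (fun y => [set z | F z -> 2^-1 < f y (dact z w)]) cF.
  have wy : q w = p y by rewrite Fy.
  have [f1 _ _] := fP _ Fy.
  have [|[V W] /= [yV wW] VW] := @dact_near y w (realf (f y)) (2^-1) _ wy.
    by rewrite invr_gt0.
  apply: filterS yV => z Vz Fz.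
  have := VW (z, w) (conj Vz (nbhs_singleton wW)) (esym Fz).
  change (normc (((f y (dact z w))%:C)%C - ((f y (dact y w))%:C)%C) < 2^-1 -> 2^-1 < f y (dact z w)).
  by rewrite -rmorphB normc_real f1 ltr_distl => /andP[+ _]; lra.
have cf y : continuous (fun v => Num.max (f y v) 0).
  by move=> v; apply: (@continuous_max R Omega (f y) (fun=> 0)); [exact: cts_fun|exact: cvg_cst].
have ch := continuous_sum (s := s) cf.
pose h : continuousType Omega R := mkcts ch.
have h0 v : 0 <= h v by rewrite /h /= /mkcts sumr_ge0// => y _; rewrite le_max lexx orbT.
have cm := orbit_inf_continuous h0.
have := @invariant_descends (mkcts cm) (orbit_inf_invariant h) w w' ww'.
apply/eqP; rewrite gt_eqF//; apply: (@lt_le_trans _ _ 2^-1).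
  apply: (@le_lt_trans _ _ (h (dact (bone p (q w')) w'))).
    by apply: orbit_inf_le => //; rewrite bproj_one.
  rewrite dact_one// /h /= /mkcts big_seq big1 ?invr_gt0// => y ys.
  by have [_ _ ->] := fP _ (sF _ ys); rewrite maxxx.
apply: lb_le_inf; first exact: (orbit_inf_has h0 w).1.
move=> _ [z /= wz <-]; have [y ys yz] := sU z (esym wz).
rewrite /h /= /mkcts (perm_big _ (perm_to_rem ys)) big_cons /=.
apply: le_trans (ltW (yz (esym wz))) _.
rewrite -[leLHS]addr0 lerD ?le_max ?lexx// sumr_ge0// => v _.
by rewrite le_max lexx orbT.
Qed.
End dual_action.

(** * Morphisms on fibres and bundles *)

Section contractive_morphisms.
Variables (R : realType) (X : topologicalType) (A A' : cxAlgType R X).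
Variable T : cxMorphism A A'.

Lemma fibre_map_morphism x : star_morphism (fibre_map T (x := x)).
Proof.
have Tm := cxm_morphism T.
split=> [u v|k u|u v|u]; rewrite -(qliftK u).
- by rewrite -(qliftK v) -qpiD !fibre_mapE (smD Tm) fibre_piD.
- by rewrite -qpiZ !fibre_mapE (smZ Tm) fibre_piZ.
- by rewrite -(qliftK v) -qpiM !fibre_mapE (smM Tm) fibre_piM.
- by rewrite -qpi_star !fibre_mapE (sm_star Tm) [LHS]qpi_star.
Qed.

Hypothesis T_contractive : forall a, cnorm (T a) <= cnorm a.

Lemma fibre_map_contractive x (u : fibre A x) : cnorm (fibre_map T u) <= cnorm u.
Proof.
apply/ler_addgt0Pr => e e0.
have [|a au ae] := @cnorm_quot_lt R A _ u (cnorm u + e); first by rewrite ltrDl.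
rewrite -{1}au fibre_mapE; apply: le_trans (cnorm_pi_le _ _) _.
by apply: le_trans (T_contractive _) _; exact: ltW.
Qed.

Lemma hat_map_continuous : continuous (hat_map T).
Proof.
move=> [x u] N /nbhs_hat[U [a' [e [oU e0 [/= Ux]]]]].
rewrite -(qliftK u); set a := qlift u; rewrite fibre_mapE => /cnorm_near[d d0 Nd] sN.
have xU : nbhs x U by exact: open_nbhs_nbhs.
have /= oV := @open_interior X (U `&` [set t | forall v : fibre A' t,
  cnorm (v - fibre_pi t (T a)) < d -> cnorm (v - fibre_pi t a') < e]).
apply: (@filterS _ _ _ (hat_basic (U `&` [set t | forall v : fibre A' t,
  cnorm (v - fibre_pi t (T a)) < d -> cnorm (v - fibre_pi t a') < e])° a d)).
  move=> [t v] [/= /interior_subset[Ut H] vd]; apply: sN; split=> //=; apply: H.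
  rewrite -fibre_mapE -(star_morphismB (@fibre_map_morphism t)).
  exact: le_lt_trans (fibre_map_contractive _) vd.
apply: open_nbhs_nbhs; split; first exact: open_hat_basic.
split=> /=; last by rewrite subrr cnorm0.
exact: filterI.
Qed.

Lemma fibre_map_csec (G : topologicalType) (p : G -> X) (F : forall y, fibre A (p y)) :
  csec F -> csec (fun y => fibre_map T (F y)).
Proof.
move=> cF y; have := @hat_map_continuous (hat_mk (F y)).
exact: (@continuous_comp _ _ _ (fun y => hat_mk (F y)) (hat_map T) y (cF y)).
Qed.
End contractive_morphisms.

(** * The fibre of [F_s] over [x] is the fibre of [B] at [s x] *)

Section quotient_fibres.
Variables (R : realType) (X Omega : topologicalType) (B : cxCStarAlgType R X).
Variables (gamma : centreIso Omega B) (q : continuousType Omega X).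
Hypothesis q_dual : dual_projection gamma q.
Variable s : continuousType X Omega.
Hypothesis s_section : forall x, q (s x) = x.

Local Notation F := (Fs gamma s).
Local Notation et := (eta gamma s).

Lemma fibreOD w (a b : B) : fibreO gamma w (a + b) = fibreO gamma w a + fibreO gamma w b.
Proof. exact: qpiD. Qed.
Lemma fibreOB w (a b : B) : fibreO gamma w (a - b) = fibreO gamma w a - fibreO gamma w b.
Proof. exact: qpiB. Qed.
Lemma fibreOZ w k (b : B) : fibreO gamma w (k *: b) = k *: fibreO gamma w b.
Proof. exact: qpiZ. Qed.
Lemma fibreOM w (a b : B) :
  fibreO gamma w (a * b)%g = (fibreO gamma w a * fibreO gamma w b)%g.
Proof. exact: qpiM. Qed.

(** The elements of [B] that vanish at [s x] form a closed ideal, because the norm of the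
    fibre at [s x] is definite. *)
Lemma ker_ideal_fibreO x b : ker_ideal gamma s b -> fibreO gamma (s x) b = 0.
Proof.
move=> kb; have H : closed_ideal_gen (ker_gen gamma s) b by exact: kb.
apply: (H [set b | fibreO gamma (s x) b = 0]); last first.
  by move=> _ [c [b' [cs ->]]]; rewrite /= fibreO_gammaM cs scale0r.
split=> [|||a c /= c0|a c /= a0].
- have -> : [set b | fibreO gamma (s x) b = 0] =
      (fun b => cnorm (fibreO gamma (s x) b)) @^-1` [set r | r <= 0].
    apply/seteqP; split=> c /= c0; first by rewrite c0 cnorm0.
    by apply: fibre_norm_eq0; apply/eqP; rewrite eq_le c0 cnorm_ge0.
  apply: preimage_closed; last exact: closed_le.
  move=> c _; apply/cvgrPdist_lt => e e0.
  have eC : 0 < (e%:C)%C :> R[i] by rewrite ltcR.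
  have /cvgrPdist_lt/(_ _ eC) : id @ c --> c by exact: cvg_id.
  apply: filterS => c'; rewrite -cnormE ltcR; apply: le_lt_trans.
  have h a a' : cnorm (fibreO gamma (s x) a) <= cnorm (a - a') + cnorm (fibreO gamma (s x) a').
    rewrite -{1}(subrK a' a) fibreOD; apply: le_trans (cnormD _ _) _.
    by apply: lerD => //; exact: (@cnorm_pi_le R (BO gamma)).
  rewrite ler_norml; have := h c c'; have := h c' c; rewrite (cnormBC c' c) => h1 h2.
  by apply/andP; split; lra.
- exact: qpi0.
- by move=> a c /= a0 c0; rewrite fibreOD a0 c0 addr0.
- by rewrite fibreOM c0 amul0r.
- by rewrite fibreOM a0 amul0l.
Qed.

Lemma fibreO_eq0 w (b : B) : fibreO gamma w b = 0 ->
  exists (c : contfun R Omega) (a : B), c w = 0 /\ b = (gamma c * a)%g.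
Proof.
rewrite -(qpi0 (fibre_ideal (BO gamma) w)) => /qpi_eq; rewrite subr0 => -[c [a [cw E]]].
by exists c, a.
Qed.

Lemma fibreO_cxmap w f (b : B) : fibreO gamma w (cxmap f * b)%g = f (q w) *: fibreO gamma w b.
Proof. by rewrite -(q_dual.2 f) fibreO_gammaM. Qed.

(** A function [c] that vanishes at [s x] is the sum of [c - c o s o q], which vanishes
    on the image of [s], and of [c o s o q], which comes from a function on [X] that
    vanishes at [x]. *)
Lemma Fs_fibre_eq0 x b : fibre_pi x (et b) = 0 <-> fibreO gamma (s x) b = 0.
Proof.
split.
  rewrite -(qpi0 (fibre_ideal F x)) => /qpi_eq; rewrite subr0 => -[f [u [fx]]].
  rewrite -(qliftK u); set a := qlift u => E.
  have /(@ker_ideal_fibreO x) : ker_ideal gamma s (b - (cxmap f * a)%g).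
    by apply/qpi_eq; rewrite qpiM; exact: E.
  rewrite fibreOB fibreO_cxmap s_section fx scale0r subr0.
  exact.
move=> /fibreO_eq0[c [a [cx ->]]].
pose f : contfun R X := c \o s.
pose d : contfun R Omega := c - (f \o q : contfun R Omega).
have H : closed_ideal_gen (ker_gen gamma s) (gamma d * a)%g.
  move=> J JI; apply; exists d, a; split=> // t.
  by change (c (s t) - c (s (q (s t))) = 0); rewrite s_section subrr.
have k0 : et (gamma d * a)%g = 0.
  by rewrite -(qpi0 (ker_ideal gamma s)); apply/qpi_eq; rewrite subr0; exact: H.
have -> : (gamma c * a)%g = (gamma d * a)%g + (cxmap f * a)%g :> B.
  by rewrite -(q_dual.2 f) -amulDl -(smD (cen_morphism gamma)) subrK.
rewrite (smD (cxm_morphism et)) k0 add0r cxm_linear [LHS]qpiM.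
rewrite -!/(fibre_pi _ _) fibre_pi_cxmap.
by change ((c (s x) *: 1%g) * fibre_pi x (et a) = 0)%g; rewrite cx scale0r amul0l.
Qed.

Lemma Fs_fibre_norm x b : cnorm (fibre_pi x (et b)) = cnorm (fibreO gamma (s x) b).
Proof.
apply/eqP; rewrite eq_le; apply/andP; split; apply/ler_addgt0Pr => e e0.
  have [|b' bb' b'e] := @cnorm_quot_lt R (BO gamma) _ (fibreO gamma (s x) b)
     (cnorm (fibreO gamma (s x) b) + e); first by rewrite ltrDl.
  have -> : fibre_pi x (et b) = fibre_pi x (et b').
    apply/eqP; rewrite -subr_eq0; apply/eqP; rewrite -fibre_piB.
    rewrite -(star_morphismB (cxm_morphism et)); apply/Fs_fibre_eq0.
    by rewrite fibreOB -bb' subrr.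
  apply: le_trans (ltW b'e); apply: le_trans (cnorm_pi_le _ _) _.
  exact: cnorm_pi_le.
have [|u ub ue] := @cnorm_quot_lt R F _ (fibre_pi x (et b)) (cnorm (fibre_pi x (et b)) + e).
  by rewrite ltrDl.
have [b' b'u b'e] := cnorm_quot_lt ue.
have -> : fibreO gamma (s x) b = fibreO gamma (s x) b'.
  apply/eqP; rewrite -subr_eq0; apply/eqP; rewrite -fibreOB.
  apply/Fs_fibre_eq0; rewrite (star_morphismB (cxm_morphism et)) fibre_piB.
  by apply/eqP; rewrite subr_eq0; apply/eqP; rewrite -ub -b'u.
by apply: le_trans (ltW b'e); exact: (@cnorm_pi_le R (BO gamma)).
Qed.

Lemma Fs_norm_eq0 x (v : fibre F x) : cnorm v = 0 -> v = 0.
Proof.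
rewrite -(qliftK v) -(qliftK (qlift v)); set b := qlift (qlift v).
rewrite -/(fibre_pi _ _) -[qpi _ b]/(et b) Fs_fibre_norm => /fibre_norm_eq0 b0.
exact/Fs_fibre_eq0.
Qed.

Lemma fibre_eta_surj x (v : fibre F x) : fibre_map et (fibre_pi x (qlift (qlift v))) = v.
Proof. by rewrite fibre_mapE [et _]qliftK; exact: qliftK. Qed.
End quotient_fibres.

(** * The action of the stabilizer on [F_s] *)

Section stabilizer_action.
Variables (R : realType) (X G Omega : topologicalType).
Hypotheses (X_compact : compact [set: X]) (X_hausdorff : hausdorff_space X).
Variable p : compactGroupBundle G X.
Hypothesis p_open : forall y U, nbhs y U -> nbhs (p y) (p @` U).
Variables (B : cxCStarAlgType R X) (alpha : fibredAction p [set: G] B).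
Hypotheses (Omega_compact : compact [set: Omega])
  (Omega_hausdorff : hausdorff_space Omega).
Variable gamma : centreIso Omega B.
Variable q : continuousType Omega X.
Hypothesis q_dual : dual_projection gamma q.
Variable s : continuousType X Omega.
Hypothesis s_section : forall x, q (s x) = x.

Local Notation F := (Fs gamma s).
Local Notation et := (eta gamma s).
Local Notation H := (stabilizer alpha gamma q s).
Local Notation em := (fibre_map (eta gamma s)).
Local Notation dact := (dact alpha gamma q).

Local Notation dactP' := (dactP X_compact X_hausdorff p_open alpha Omega_compact q_dual).
Local Notation q_dact' := (q_dact X_compact X_hausdorff p_open alpha Omega_compact q_dual).
Local Notation dactE' := (dactE X_compact X_hausdorff p_open Omega_compact q_dual).
Local Notation act_gamma' := (act_gamma X_compact X_hausdorff p_open alpha gamma).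
Local Notation dact_mul' :=
  (dact_mul X_compact X_hausdorff p_open alpha Omega_compact Omega_hausdorff q_dual).
Local Notation dact_one' :=
  (dact_one X_compact X_hausdorff p_open alpha Omega_compact Omega_hausdorff q_dual).
Local Notation dual_action_dact' :=
  (dual_action_dact X_compact X_hausdorff p_open Omega_compact Omega_hausdorff q_dual).

Lemma stabilizerP h : H h <-> dact h (s (p h)) = s (p h).
Proof.
have qs : q (s (p h)) = p h by rewrite s_section.
split=> [Hh|E]; last first.
  by have := dactP' qs; rewrite E.
by apply/esym; exact: dual_action_dact' qs Hh.
Qed.

Let qs (y : G) : q (s (p y)) = p y. Proof. by rewrite s_section. Qed.
Lemma stabilizerV h : H h -> H (binv p h).
Proof.
move=> /stabilizerP E; apply/stabilizerP; rewrite bproj_inv -{1}E.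
rewrite -dact_mul' ?bproj_inv ?qs// bmulrV dact_one'//.
Qed.

(** The inverse of [alpha_y] carries cut-offs at [w] to cut-offs at [dact y w]. *)
Lemma fibreO_act y w (b b' : B) : q w = p y ->
  act_fun alpha (p y) y (fibre_pi (p y) b) = fibre_pi (p y) b' ->
  cnorm (fibreO gamma (dact y w) b) <= cnorm (fibreO gamma w b').
Proof.
move=> wy E; apply/ler_addgt0Pr => e e0; set r := _ + e.
have [|l [lw l01 lr]] := @fibre_norm_local R Omega (BO gamma) w b' r.
  by rewrite ltrDl.
have [m mE] := act_gamma' (binv p y) (realf l); rewrite bproj_inv in mE.
have E1 : act_fun alpha (p y) y (fibre_pi (p y) (gamma m)) = fibre_pi (p y) (gamma (realf l)).
  by rewrite -mE actVK.
have m1 : m (dact y w) = 1.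
  by rewrite (dactE' wy E1); change (((l w)%:C)%C = 1 :> R[i]); rewrite lw.
have am := act_morphism alpha I (erefl (p y)).
have E2 : act_fun alpha (p y) y (fibre_pi (p y) (gamma m * b)%g) =
    fibre_pi (p y) (gamma (realf l) * b')%g.
  by rewrite !fibre_piM (smM am) E E1.
have -> : fibreO gamma (dact y w) b = fibreO gamma (dact y w) (gamma m * b)%g.
  by rewrite fibreO_gammaM m1 scale1r.
apply: le_trans (fibreO_le q_dual _ (q_dact' wy)) _.
rewrite -(act_isometry alpha _ (erefl (p y))) E2; apply: le_trans (cnorm_pi_le _ _) _.
exact: ltW.
Qed.

(** With [em_act_eq0] below: [em (alpha_y (pi b))] is the value of [b] at the point
    [dact y (s (p y))], up to an isomorphism that does not depend on [b]. *)
Lemma em_act_norm y (b : B) :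
  cnorm (fibreO gamma (dact y (s (p y))) b) <=
  cnorm (em (act_fun alpha (p y) y (fibre_pi (p y) b))).
Proof.
have [b' E] := fibre_pi_surj (act_fun alpha (p y) y (fibre_pi (p y) b)).
rewrite -E fibre_mapE (Fs_fibre_norm q_dual s_section).
exact: fibreO_act.
Qed.

Lemma em_act_eq0 y (b : B) : fibreO gamma (dact y (s (p y))) b = 0 ->
  em (act_fun alpha (p y) y (fibre_pi (p y) b)) = 0.
Proof.
move=> /fibreO_eq0[c [a [cw ->]]].
have [c' E] := act_gamma' y c.
have [a' Ea] := fibre_pi_surj (act_fun alpha (p y) y (fibre_pi (p y) a)).
have am := act_morphism alpha I (erefl (p y)).
rewrite fibre_piM (smM am) E -Ea -fibre_piM fibre_mapE.
apply/(Fs_fibre_eq0 q_dual s_section); rewrite fibreO_gammaM.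
by rewrite -(dactE' (qs y) E) cw scale0r.
Qed.

(** [qlift (qlift v)] lifts [v] to [F_s] and then to [B]. *)
Definition stab_act x (h : G) (v : fibre F x) : fibre F x :=
  em (act_fun alpha x h (fibre_pi x (qlift (qlift v)))).

Let etm x : star_morphism (fibre_map et (x := x)) := fibre_map_morphism et x.

(** The lift does not matter: for [h] in the stabilizer, [alpha_h] preserves the
    elements that vanish at [s x]. *)
Lemma stab_actE x h u : H h -> p h = x ->
  stab_act h (em u) = em (act_fun alpha x h u).
Proof.
move=> Hh hx; subst x; have am := act_morphism alpha I (erefl (p h)).
rewrite /stab_act; set u' := fibre_pi _ (qlift _).
have E : em u' = em u by exact: fibre_eta_surj.
apply/eqP; rewrite -subr_eq0 -(star_morphismB (etm (p h))) -(star_morphismB am).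
move: E => /eqP; rewrite -subr_eq0 -(star_morphismB (etm (p h))) => /eqP.
have [b <-] := fibre_pi_surj (u' - u); rewrite fibre_mapE.
move=> /(Fs_fibre_eq0 q_dual s_section) b0; apply/eqP/em_act_eq0.
by have /stabilizerP -> := Hh.
Qed.

Let em_surj x (v : fibre F x) : exists u, em u = v.
Proof. by exists (fibre_pi x (qlift (qlift v))); exact: fibre_eta_surj. Qed.

Let em_le x (u : fibre B x) : cnorm (em u) <= cnorm u.
Proof. by apply: fibre_map_contractive => a; exact: cnorm_pi_le. Qed.

Lemma stab_act_morphism x h : H h -> p h = x -> star_morphism (@stab_act x h).
Proof.
move=> Hh hx; have am := act_morphism alpha I hx.
split=> [v w|k v|v w|v].
- have [u <-] := em_surj v; have [u' <-] := em_surj w.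
  by rewrite -(smD (etm x)) !stab_actE// (smD am) (smD (etm x)).
- have [u <-] := em_surj v.
  by rewrite -(smZ (etm x)) !stab_actE// (smZ am) (smZ (etm x)).
- have [u <-] := em_surj v; have [u' <-] := em_surj w.
  by rewrite -(smM (etm x)) !stab_actE// (smM am) (smM (etm x)).
- have [u <-] := em_surj v.
  by rewrite -(sm_star (etm x)) !stab_actE// (sm_star am) (sm_star (etm x)).
Qed.

Lemma stab_act_contractive x h v : H h -> p h = x -> cnorm (@stab_act x h v) <= cnorm v.
Proof.
move=> Hh hx; apply/ler_addgt0Pr => e e0.
have [|c cv ce] := @cnorm_quot_lt R F _ v (cnorm v + e); first by rewrite ltrDl.
have [b bc be] := cnorm_quot_lt ce.
have vE : v = em (fibre_pi x b) by rewrite fibre_mapE -cv -bc.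
rewrite {1}vE stab_actE//; apply: le_trans (em_le _) _.
apply: le_trans (act_contractive alpha _ hx) _; apply: le_trans (cnorm_pi_le _ _) _.
exact: ltW.
Qed.

Lemma stab_act_bijective x h : H h -> p h = x -> bijective (@stab_act x h).
Proof.
move=> Hh hx; exists (stab_act (binv p h)) => v; have [u <-] := em_surj v; subst x.
  by rewrite !stab_actE// ?actK ?bproj_inv//; exact: stabilizerV.
by rewrite !stab_actE// ?actVK ?bproj_inv//; exact: stabilizerV.
Qed.

Lemma stab_act_one x u : @stab_act x (bone p x) u = u.
Proof. by rewrite /stab_act act_one fibre_eta_surj. Qed.

Lemma stab_act_mul x y z u : H y -> H z -> p y = x -> p z = x ->
  @stab_act x (bmul p y z) u = stab_act y (stab_act z u).
Proof.
move=> Hy Hz yx zx; rewrite [in RHS]/stab_act -/(stab_act _ _) stab_actE//.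
by rewrite -act_mul.
Qed.

Lemma stab_act_strong x u y (e : R) : H y -> p y = x -> 0 < e ->
  \forall z \near within (H `&` p @^-1` [set x]) (nbhs y),
    cnorm (@stab_act x z u - stab_act y u) < e.
Proof.
move=> Hy yx e0; have := act_strong alpha (fibre_pi x (qlift (qlift u))) I yx e0.
move=> hs; rewrite near_withinE; move: hs; rewrite near_withinE.
apply: filterS => z h [Hz zx].
rewrite /stab_act -(star_morphismB (etm x)); apply: le_lt_trans (em_le _) _.
by apply: h; split.
Qed.

Lemma em_act_csec (b : B) : csec (fun y => em (act_fun alpha (p y) y (fibre_pi (p y) b))).
Proof.
exact: (@fibre_map_csec R X B F et (fun a => cnorm_pi_le _ a) G p _
  (@act_pi_csec _ _ _ _ _ alpha b)).
Qed.

(** As [stab_act h] is contractive, a vector near [em (pi b)] may be replaced by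
    [em (pi b)] itself, and [em (alpha_h (pi b))] is a continuous function of [h]. *)
Lemma stab_act_continuous :
  {within [set ys : G * hat F | H ys.1 /\ p ys.1 = projT1 ys.2],
     continuous (fun ys => hat_act (@stab_act) ys.1 ys.2)}.
Proof.
apply/subspace_continuousP => -[h0 [x0 v0]] /= [Hh0 hx0]; subst x0.
have [u0 uv] := em_surj v0; have [b bu] := fibre_pi_surj u0; subst u0 v0.
move=> N /nbhs_hat[U [a [e [oU e0 [/= Ux]]]]].
rewrite stab_actE//; set w := em (act_fun _ _ _ _).
rewrite -(qliftK w); set c := qlift w => /cnorm_near[d d0 Nd] sN.
have d2 : 0 < d / 2 by rewrite divr_gt0.
have sec := (continuous_sectionP _ (@bproj_continuous _ _ p)).1 (@em_act_csec b)
  h0 c (d / 2) (qliftK w) d2.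
have nU : \forall h \near h0, U (p h).
  have xU : nbhs (p h0) U by exact: open_nbhs_nbhs.
  exact: (@bproj_continuous _ _ p h0 _ xU).
have nN : \forall h \near h0, forall v : fibre F (p h),
    cnorm (v - fibre_pi (p h) c) < d -> cnorm (v - fibre_pi (p h) a) < e.
  exact: (@bproj_continuous _ _ p h0 _ Nd).
exists ([set h | U (p h)] `&` [set h | forall v : fibre F (p h),
    cnorm (v - fibre_pi (p h) c) < d -> cnorm (v - fibre_pi (p h) a) < e] `&`
    [set h | cnorm (em (act_fun alpha (p h) h (fibre_pi (p h) b)) - fibre_pi (p h) c) < d / 2],
  hat_basic setT (et b) (d / 2)).
  split; first by apply: filterI => //; exact: filterI.
  apply: open_nbhs_nbhs; split; first exact: open_hat_basic openT d2.
  by split=> //=; rewrite fibre_mapE subrr cnorm0.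
move=> [h [x v]] [/= [[Uh Nh] hb] [_ /= vb]] [/= Hh hx]; subst x.
apply: sN; split=> //=; apply: Nh.
have -> : stab_act h v - fibre_pi (p h) c = stab_act h (v - fibre_pi (p h) (et b)) +
    (em (act_fun alpha (p h) h (fibre_pi (p h) b)) - fibre_pi (p h) c).
  rewrite (star_morphismB (stab_act_morphism Hh (erefl _))) -(fibre_mapE et) stab_actE//.
  by rewrite addrA subrK.
apply: le_lt_trans (cnormD _ _) _; rewrite [d]splitr; apply: ltrD => //.
exact: le_lt_trans (stab_act_contractive _ Hh (erefl _)) vb.
Qed.

Definition stab_action : fibredAction p H F :=
  FibredAction stab_act_morphism stab_act_bijective stab_act_one stab_act_mul
    stab_act_strong stab_act_continuous.
End stabilizer_action.

Lemma sec_le (R : realType) (G X : topologicalType) (p : compactGroupBundle G X)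
    (H : set G) (A : cxAlgType R X) (beta : fibredAction p H A) (S : invSection beta) y :
  cnorm (S y) <= cnorm S.
Proof.
have [M SM] := sec_bounded S.
by apply: sup_ubound; [exists M => _ [z _ <-]|exists y].
Qed.

Lemma sec_norm_le (R : realType) (G X : topologicalType) (p : compactGroupBundle G X)
    (H : set G) (A : cxAlgType R X) (beta : fibredAction p H A) (S : invSection beta) M :
  0 <= M -> (forall y, cnorm (S y) <= M) -> cnorm S <= M.
Proof.
move=> M0 SM; have [S0|/set0P S0] := eqVneq (range (fun y => cnorm (S y))) set0.
  by change (sup (range (fun y => cnorm (S y))) <= M); rewrite S0 sup0.
by apply: ge_sup => // _ [y _ <-].
Qed.

(** * The isomorphism *)

Section transform.
Variables (R : realType) (X G Omega : topologicalType).
Hypotheses (X_compact : compact [set: X]) (X_hausdorff : hausdorff_space X).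
Variable p : compactGroupBundle G X.
Hypothesis p_open : forall y U, nbhs y U -> nbhs (p y) (p @` U).
Variables (B : cxCStarAlgType R X) (alpha : fibredAction p [set: G] B).
Hypotheses (Omega_compact : compact [set: Omega])
  (Omega_hausdorff : hausdorff_space Omega).
Variable gamma : centreIso Omega B.
Variable q : continuousType Omega X.
Hypothesis q_dual : dual_projection gamma q.
Variable s : continuousType X Omega.
Hypothesis s_section : forall x, q (s x) = x.
Hypothesis fixed_centre : centre B `&` fixed_points alpha =
  range (cxmap : contfun R X -> B).

Local Notation F := (Fs gamma s).
Local Notation et := (eta gamma s).
Local Notation H := (stabilizer alpha gamma q s).
Local Notation em := (fibre_map (eta gamma s)).
Local Notation dact := (dact alpha gamma q).
Local Notation q_dact' := (q_dact X_compact X_hausdorff p_open alpha Omega_compact q_dual).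
Local Notation dact_near' := (dact_near X_compact X_hausdorff p_open alpha Omega_compact q_dual).
Local Notation dact_mul' :=
  (dact_mul X_compact X_hausdorff p_open alpha Omega_compact Omega_hausdorff q_dual).
Local Notation dact_one' :=
  (dact_one X_compact X_hausdorff p_open alpha Omega_compact Omega_hausdorff q_dual).

Definition stab_beta : fibredAction p H F :=
  stab_action X_compact X_hausdorff p_open alpha Omega_compact Omega_hausdorff q_dual s_section.

Let qs (y : G) : q (s (p y)) = p y. Proof. by rewrite s_section. Qed.
Let etm x : star_morphism (fibre_map et (x := x)) := fibre_map_morphism et x.

Lemma stab_betaE x h u : H h -> p h = x ->
  act_fun stab_beta x h (em u) = em (act_fun alpha x h u).
Proof.
exact: (stab_actE X_compact X_hausdorff p_open Omega_compact Omega_hausdorff q_dual s_section).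
Qed.

Definition transform_fun (b : B) (y : G) : fibre F (p y) :=
  em (act_fun alpha (p y) y (fibre_pi (p y) b)).

Lemma transform_continuous b : continuous (fun y => hat_mk (transform_fun b y)).
Proof. by move=> y; exact: (@em_act_csec _ _ _ _ _ _ alpha gamma s b y). Qed.

Lemma transform_equivariant b h y : H h -> p h = p y ->
  hat_mk (transform_fun b (bmul p h y)) =
  hat_act (act_fun stab_beta) h (hat_mk (transform_fun b y)).
Proof.
move=> Hh hy; have E : p (bmul p h y) = p y by rewrite bproj_mul.
rewrite /transform_fun /hat_act [projT1 _]/= [projT2 _]/= stab_betaE// E.
by rewrite act_mul.
Qed.

Definition transform_section (b : B) : invSection stab_beta :=
  InvSection (@transform_continuous b) (@transform_equivariant b).

Lemma transform_morphism : star_morphism transform_section.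
Proof.
have am y := act_morphism alpha I (erefl (p y)).
split=> [a b|k a|a b|a]; apply: invSectionP => y.
- change (transform_fun (a + b) y = transform_fun a y + transform_fun b y).
  by rewrite /transform_fun fibre_piD (smD (am y)) (smD (etm _)).
- change (transform_fun (k *: a) y = k *: transform_fun a y).
  by rewrite /transform_fun fibre_piZ (smZ (am y)) (smZ (etm _)).
- change (transform_fun (a * b)%g y = (transform_fun a y * transform_fun b y)%g).
  by rewrite /transform_fun fibre_piM (smM (am y)) (smM (etm _)).
- change (transform_fun (star a) y = star (transform_fun a y)).
  by rewrite /transform_fun [fibre_pi _ _]qpi_star (sm_star (am y)) (sm_star (etm _)).
Qed.

Lemma transform_linear f a : transform_section (cxmap f * a)%g = (cxmap f * transform_section a)%g.
Proof.
have am y := act_morphism alpha I (erefl (p y)).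
apply: invSectionP => y.
change (transform_fun (cxmap f * a)%g y = ((f (p y) *: 1%g) * transform_fun a y)%g).
rewrite amulZl mul1g /transform_fun fibre_pi_cxmapM.
by rewrite (smZ (am y)) (smZ (etm _)).
Qed.

Definition transform : cxMorphism B (invSection stab_beta) := CXMorphism transform_morphism transform_linear.

Lemma transform_contractive b : cnorm (transform b) <= cnorm b.
Proof.
apply: sec_norm_le => [|y]; first exact: cnorm_ge0.
change (cnorm (transform_fun b y) <= cnorm b); rewrite /transform_fun.
apply: le_trans (@fibre_map_contractive R X B F et (fun a => cnorm_pi_le _ a) _ _) _.
apply: le_trans (act_contractive alpha _ (erefl _)) _.
exact: cnorm_pi_le.
Qed.

(** By transitivity every point of [Omega] is of the form [dact y (s (p y))], where the
    value of [b] has the norm of the value at [y] of its transform. *)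
Lemma transform_expansive b : cnorm b <= cnorm (transform b).
Proof.
apply: (@fibre_norm_sup R Omega (BO gamma) Omega_compact b) => [|w]; first exact: cnorm_ge0.
have sw : q (s (q w)) = q w by rewrite s_section.
have [y yw wE] := dact_transitive X_compact X_hausdorff p_open Omega_compact Omega_hausdorff
  q_dual fixed_centre sw.
apply: le_trans (sec_le (transform b) y).
have := em_act_norm X_compact X_hausdorff p_open alpha Omega_compact q_dual s_section y b.
have -> : dact y (s (p y)) = w by rewrite -[RHS]wE yw s_section.
exact.
Qed.

Lemma transform_eq0 b y : fibreO gamma (dact y (s (p y))) b = 0 -> transform_fun b y = 0.
Proof.
exact: (em_act_eq0 X_compact X_hausdorff p_open Omega_compact q_dual s_section).
Qed.

Lemma transform_funB a b y : transform_fun (a - b) y = transform_fun a y - transform_fun b y.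
Proof.
have am := act_morphism alpha I (erefl (p y)).
by rewrite /transform_fun fibre_piB (star_morphismB am) (star_morphismB (etm _)).
Qed.
Lemma transform_funD a b y : transform_fun (a + b) y = transform_fun a y + transform_fun b y.
Proof.
have am := act_morphism alpha I (erefl (p y)).
by rewrite /transform_fun fibre_piD (smD am) (smD (etm _)).
Qed.
Lemma transform_funZ k b y : transform_fun (k *: b) y = k *: transform_fun b y.
Proof.
have am := act_morphism alpha I (erefl (p y)).
by rewrite /transform_fun fibre_piZ (smZ am) (smZ (etm _)).
Qed.

Lemma transform_fun_fibreO w y a b : dact y (s (p y)) = w ->
  fibreO gamma w a = fibreO gamma w b -> transform_fun a y = transform_fun b y.
Proof.
move=> yw E; apply/eqP; rewrite -subr_eq0 -transform_funB; apply/eqP/transform_eq0.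
by rewrite yw fibreOB E subrr.
Qed.

Lemma orbit_map_continuous : continuous (fun y => dact y (s (p y))).
Proof.
move=> y0 U nU.
have [f [f1 _ fU]] := bump R Omega_compact Omega_hausdorff nU.
have [[V W] /= [yV wW] VW] := dact_near' (realf f) ltr01 (qs y0).
have sW : \forall y \near y0, W (s (p y)).
  exact: (@bproj_continuous _ _ p y0 _ (@cts_fun _ _ s (p y0) _ wW)).
apply: filterS2 yV sW => y Vy Wy; apply: fU.
have := VW (y, s (p y)) (conj Vy Wy) (qs y).
change (normc (((f (dact y (s (p y))))%:C)%C - ((f (dact y0 (s (p y0))))%:C)%C) < 1 ->
  f (dact y (s (p y))) != 0).
rewrite -rmorphB normc_real f1; apply: contraTneq => ->.
by rewrite sub0r normrN normr1 ltxx.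
Qed.

Lemma transform_surj_at y (v : fibre F (p y)) : exists b, transform_fun b y = v.
Proof.
pose u := fibre_pi (p y) (qlift (qlift v)).
have [b bu] := fibre_pi_surj (act_fun alpha (p y) (binv p y) u).
by exists b; rewrite /transform_fun bu actVK fibre_eta_surj.
Qed.

(** Points of [G] with the same image in [Omega] differ by an element of the stabilizer,
    for which both sections are equivariant. *)
Lemma section_same_orbit_point (S : invSection stab_beta) b y0 y :
  dact y0 (s (p y0)) = dact y (s (p y)) -> transform_fun b y0 = S y0 -> transform_fun b y = S y.
Proof.
move=> yy E; have pp : p y0 = p y.
  by have := congr1 q yy; rewrite !q_dact' ?qs.
pose h := bmul p y (binv p y0).
have ph : p h = p y by rewrite bproj_mul// bproj_inv.
have Hh : H h.
  apply/(stabilizerP X_compact X_hausdorff p_open alpha Omega_compact Omega_hausdorff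
    q_dual s_section).
  rewrite ph /h dact_mul' ?qs ?bproj_inv// -yy -pp.
  by rewrite -dact_mul' ?qs ?bproj_inv// bmulrV dact_one' ?qs.
have hy : y = bmul p h y0 by rewrite bmulKV.
have h1 := transform_equivariant b Hh (etrans ph (esym pp)).
have h2 := @sec_equivariant _ _ _ _ _ _ _ S h y0 Hh (etrans ph (esym pp)).
rewrite -hy in h1 h2; rewrite E -h2 in h1.
exact: hat_mk_inj h1.
Qed.

(** [S] agrees with the transform of some [b] at a point over [w0], hence at all points
    over [w0]; by compactness of [G] they are close at all points over a neighbourhood of
    [w0] in [Omega].  The elements [b] are patched over [Omega]. *)
Lemma transform_dense (S : invSection stab_beta) (e : R) : 0 < e ->
  exists b, forall y, cnorm (transform_fun b y - S y) <= e.
Proof.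
move=> e0.
(* values at [w] of elements whose transforms are close to [r *: S] over [w] *)
pose E w r (u : fibre (BO gamma) w) := forall y, dact y (s (p y)) = w ->
  forall b : B, fibreO gamma w b = u -> cnorm (transform_fun b y - (r%:C)%C *: S y) <= r * e.
have [|||w0|b bE] := @patch R Omega (BO gamma) Omega_compact Omega_hausdorff E.
- move=> w y yw b b0.
  by rewrite transform_eq0 ?yw// scale0r subrr cnorm0 mul0r.
- move=> w r r' u u' Eu Eu' y yw b bu.
  have [b1 b1u] : exists b1 : B, fibreO gamma w b1 = u by exact: (@fibre_pi_surj R Omega (BO gamma)).
  have b2u : fibreO gamma w (b - b1) = u' by rewrite fibreOB bu b1u addrC addKr.
  have h1 := Eu y yw b1 b1u; have h2 := Eu' y yw _ b2u.
  have -> : transform_fun b y = transform_fun b1 y + transform_fun (b - b1) y.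
    by rewrite -transform_funD addrC subrK.
  rewrite rmorphD scalerDl opprD addrACA mulrDl.
  by apply: le_trans (cnormD _ _) _; apply: lerD.
- move=> w k r u k0 Eu y yw b bu.
  have [b1 b1u] : exists b1 : B, fibreO gamma w b1 = u by exact: (@fibre_pi_surj R Omega (BO gamma)).
  rewrite (@transform_fun_fibreO w y b ((k%:C)%C *: b1)) ?fibreOZ ?b1u// transform_funZ.
  rewrite rmorphM -scalerA -scalerBr cnormZ normc_real ger0_norm// -mulrA.
  by apply: ler_wpM2l => //; exact: Eu.
- have sw : q (s (q w0)) = q w0 by rewrite s_section.
  have [y0 yw wE] := dact_transitive X_compact X_hausdorff p_open Omega_compact
    Omega_hausdorff q_dual fixed_centre sw.
  rewrite s_section in yw; rewrite -yw in wE.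
  have [b bS] := transform_surj_at (S y0); exists b.
  have cov : \forall w \near w0, setT `<=`
      (fun y => dact y (s (p y)) = w -> cnorm (transform_fun b y - S y) < e).
    apply: ((compact_near_coveringP _).1 (bundle_compact p)) => y _.
    have [yE|yE] := pselect (dact y (s (p y)) = w0).
      have bSy : transform_fun b y = S y.
        by apply: section_same_orbit_point bS; rewrite wE yE.
      have [V Vy] : exists2 V : set G, nbhs y V &
          forall z, V z -> cnorm (transform_fun b z - S z) < e.
        have cS : csec (fun z => S z) by exact: sec_continuous.
        have cN : csec (fun z => - transform_fun b z).
          have := csecZ (@bproj_continuous _ _ p) (k := -1) (@transform_continuous b).
          have -> // : (fun z => -1 *: transform_section b z) = (fun z => - transform_fun b z).
          by apply: functional_extensionality_dep => z; exact: scaleN1r.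
        have cD := csecD (@bproj_continuous _ _ p) cS cN.
        exists [set z | cnorm (transform_fun b z - S z) < e] => //.
        have y0E : fibre_pi (p y) 0 = S y - transform_fun b y by rewrite fibre_pi0 bSy subrr.
        have := (continuous_sectionP _ (@bproj_continuous _ _ p)).1 cD y 0 e y0E e0.
        by apply: filterS => z; rewrite fibre_pi0 subr0 cnormBC.
      move=> VS; exists (V, setT); first by split => //; exact: filterT.
      by move=> [z w] [/= Vz _] _; exact: VS.
    have [[U V] /= [/set_mem Uy /set_mem Vw] [oU oV UV]] : exists2 UV : set Omega * set Omega,
      (dact y (s (p y)) \in UV.1 /\ w0 \in UV.2) &
      [/\ open UV.1, open UV.2 & UV.1 `&` UV.2 == set0].
      by move: Omega_hausdorff; rewrite open_hausdorff => /(_ _ _ (introN eqP yE)).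
    exists ([set z | U (dact z (s (p z)))], V).
      split; last exact: open_nbhs_nbhs.
      by apply: (@orbit_map_continuous y); exact: open_nbhs_nbhs.
    move=> [z w] [/= Uz Vw'] zw; exfalso.
    by move/eqP/seteqP : UV => [/(_ w) + _]; apply; split=> //; rewrite -zw.
  apply: filterS cov => w wS y yw' b' b'E.
  rewrite rmorph1 scale1r mul1r (@transform_fun_fibreO w y b' b)//.
  by apply/ltW/wS.
exists b => y; have := bE _ y (erefl _) b (erefl _).
by rewrite rmorph1 scale1r mul1r.
Qed.

(** An isometry of a complete space with dense range is onto. *)
Lemma transform_bijective : bijective transform.
Proof.
have inj b : transform b = 0 -> b = 0.
  move=> b0; apply/cnorm_eq0/eqP; rewrite eq_le cnorm_ge0 andbT.
  by apply: le_trans (transform_expansive b) _; rewrite b0 cnorm0.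
have surj S : exists b, transform b = S.
  have pow0 n : (0 : R) < 2 ^+ n by exact: exprn_gt0.
  have en0 n : (0 : R) < 1 / 2 ^+ n by rewrite divr_gt0.
  pose b_ n := projT1 (cid (transform_dense S (en0 n))).
  have bS n y : cnorm (transform_fun (b_ n) y - S y) <= 1 / 2 ^+ n by rewrite /b_; case: cid.
  have stepb n : cnorm (b_ n.+1 - b_ n) <= 2 / 2 ^+ n.
    apply: le_trans (transform_expansive _) _; apply: sec_norm_le => [|y].
      by rewrite divr_ge0// ltW.
    change (cnorm (transform_fun (b_ n.+1 - b_ n) y) <= 2 / 2 ^+ n).
    rewrite transform_funB -(subrK (S y) (transform_fun (b_ n.+1) y)) -addrA.
    apply: le_trans (cnormD _ _) _; rewrite (cnormBC (S y)).
    apply: le_trans (lerD (bS _ _) (bS _ _)) _.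
    have -> : 1 / 2 ^+ n.+1 = (1 / 2 ^+ n) / 2 :> R.
      by rewrite exprS; field; rewrite gt_eqF.
    have -> : 2 / 2 ^+ n = 2 * (1 / 2 ^+ n) :> R by rewrite mul1r.
    by have := en0 n; lra.
  have [b bL] := cnorm_complete stepb.
  exists b; apply: invSectionP => y; change (transform_fun b y = S y).
  apply/eqP; rewrite -subr_eq0; apply/eqP/(Fs_norm_eq0 q_dual s_section)/eqP.
  rewrite eq_le cnorm_ge0 andbT; apply/ler_addgt0Pr => e e0; rewrite add0r.
  have [n /ltW ne] := geometric_small (ler0n R 5) e0.
  rewrite -(subrK (transform_fun (b_ n) y) (transform_fun b y)) -addrA -transform_funB.
  apply: le_trans (cnormD _ _) _.
  have h1 : cnorm (transform_fun (b - b_ n) y) <= 2 * 2 / 2 ^+ n.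
    apply: le_trans (sec_le (transform (b - b_ n)) y) _.
    exact: le_trans (transform_contractive _) (bL n).
  apply: le_trans (lerD h1 (bS n y)) _; apply: le_trans ne.
  by rewrite -mulrDl ler_pM2r ?invr_gt0//; lra.
pose g S := projT1 (cid (surj S)).
have gT S : transform (g S) = S by rewrite /g; case: cid.
exists g => // b; apply/eqP; rewrite -subr_eq0; apply/eqP/inj.
by rewrite (star_morphismB (cxm_morphism transform)) gT subrr.
Qed.
End transform.

(** * Transport of an action along an isomorphism *)

Section transport.
Variables (R : realType) (G X : topologicalType) (p : compactGroupBundle G X).
Variables (H : set G) (A A' : cxAlgType R X) (alpha : fibredAction p H A).
Variables (T : cxMorphism A A') (S : cxMorphism A' A).
Hypotheses (TK : cancel T S) (SK : cancel S T).
Hypotheses (T_contractive : forall a, cnorm (T a) <= cnorm a)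
  (S_contractive : forall a, cnorm (S a) <= cnorm a).

Lemma fibre_mapK x : cancel (@fibre_map R X A A' T x) (fibre_map S (x := x)).
Proof. by move=> u; have [a <-] := fibre_pi_surj u; rewrite !fibre_mapE TK. Qed.

Lemma fibre_mapVK x : cancel (@fibre_map R X A' A S x) (fibre_map T (x := x)).
Proof. by move=> u; have [a <-] := fibre_pi_surj u; rewrite !fibre_mapE SK. Qed.

Definition transport_act x (y : G) (u : fibre A' x) : fibre A' x :=
  fibre_map T (act_fun alpha x y (fibre_map S u)).

Lemma transport_morphism x y : H y -> p y = x -> star_morphism (@transport_act x y).
Proof.
move=> Hy yx; have am := act_morphism alpha Hy yx.
have Tm := fibre_map_morphism T x; have Sm := fibre_map_morphism S x.
rewrite /transport_act; split=> [u v|k u|u v|u].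
- by rewrite (smD Sm) (smD am) (smD Tm).
- by rewrite (smZ Sm) (smZ am) (smZ Tm).
- by rewrite (smM Sm) (smM am) (smM Tm).
- by rewrite (sm_star Sm) (sm_star am) (sm_star Tm).
Qed.

Lemma transport_bijective x y : H y -> p y = x -> bijective (@transport_act x y).
Proof.
move=> Hy yx; have [g gK Kg] := act_bijective alpha Hy yx.
exists (fun u => fibre_map T (g (fibre_map S u))) => u; rewrite /transport_act fibre_mapK.
  by rewrite gK fibre_mapVK.
by rewrite Kg fibre_mapVK.
Qed.

Lemma transport_one x u : @transport_act x (bone p x) u = u.
Proof. by rewrite /transport_act act_one fibre_mapVK. Qed.

Lemma transport_mul x y z u : H y -> H z -> p y = x -> p z = x ->
  @transport_act x (bmul p y z) u = transport_act y (transport_act z u).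
Proof. by move=> Hy Hz yx zx; rewrite /transport_act fibre_mapK act_mul. Qed.

Lemma transport_strong x u y (e : R) : H y -> p y = x -> 0 < e ->
  \forall z \near within (H `&` p @^-1` [set x]) (nbhs y),
    cnorm (@transport_act x z u - transport_act y u) < e.
Proof.
move=> Hy yx e0; have hs := act_strong alpha (fibre_map S u) Hy yx e0.
rewrite near_withinE; move: hs; rewrite near_withinE.
apply: filterS => z h /h; apply: le_lt_trans.
rewrite /transport_act -(star_morphismB (fibre_map_morphism T x)).
exact: fibre_map_contractive.
Qed.

Lemma transport_continuous :
  {within [set ys : G * hat A' | H ys.1 /\ p ys.1 = projT1 ys.2],
     continuous (fun ys => hat_act (@transport_act) ys.1 ys.2)}.
Proof.
apply/subspace_continuousP => -[y s] /= [Hy ys].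
have ac := @act_continuous _ _ _ _ _ _ alpha.
move: ac => /subspace_continuousP/(_ (y, hat_map S s) (conj Hy ys)) ac.
move=> N nN.
have nN' : nbhs (hat_act (act_fun alpha) y (hat_map S s)) (hat_map T @^-1` N).
  have nN2 : nbhs (hat_map T (hat_act (act_fun alpha) y (hat_map S s))) N by exact: nN.
  exact: (@hat_map_continuous _ _ _ _ T T_contractive _ N nN2).
have [[V W] /= [yV sW] VW] := ac _ nN'.
exists (V, hat_map S @^-1` W).
  split; first exact: yV.
  exact: (@hat_map_continuous _ _ _ _ S S_contractive s W sW).
by move=> [y' s'] [/= Vy Ws] [Hy' ys']; exact: (VW (y', hat_map S s')).
Qed.

Definition transport_action : fibredAction p H A' :=
  FibredAction transport_morphism transport_bijective transport_one transport_mul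
    transport_strong transport_continuous.

Lemma transport_equivariant : equivariant alpha transport_action T.
Proof.
move=> y [x u] Hy /= yx; rewrite /hat_map /hat_act /= /transport_act.
by rewrite fibre_mapK.
Qed.
End transport.

Lemma inverse_cxMorphism (R : realType) (X : topologicalType) (A A' : cxAlgType R X)
    (T : cxMorphism A A') :
  bijective T -> exists S : cxMorphism A' A, cancel T S /\ cancel S T.
Proof.
move=> [g gK Kg]; have Tm := cxm_morphism T; have inj := can_inj gK.
have gm : star_morphism g.
  split=> [a b|k a|a b|a]; apply: inj.
  - by rewrite (smD Tm) !Kg.
  - by rewrite (smZ Tm) !Kg.
  - by rewrite (smM Tm) !Kg.
  - by rewrite (sm_star Tm) !Kg.
have gl f a : g (cxmap f * a)%g = (cxmap f * g a)%g.
  by apply: inj; rewrite cxm_linear !Kg.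
by exists (CXMorphism gm gl).
Qed.

Theorem proposition6p4 (R : realType) (X G Omega : topologicalType)
    (X_compact : compact [set: X]) (X_hausdorff : hausdorff_space X)
    (p : compactGroupBundle G X)
    (haar : exists phi : contfun R G -> contfun R X, haar_functional p phi)
    (B : cxCStarAlgType R X) (alpha : fibredAction p [set: G] B)
    (Omega_compact : compact [set: Omega])
    (Omega_hausdorff : hausdorff_space Omega)
    (gamma : centreIso Omega B)
    (fixed_centre : centre B `&` fixed_points alpha =
                    range (cxmap : contfun R X -> B))
    (q : continuousType Omega X) (q_dual : dual_projection gamma q)
    (s : continuousType X Omega) (s_section : forall x, q (s x) = x) :
  exists beta : fibredAction p (stabilizer alpha gamma q s) (Fs gamma s),
    (forall h (u : hat B), stabilizer alpha gamma q s h -> p h = projT1 u ->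
       hat_map (eta gamma s) (hat_act (act_fun alpha) h u) =
       hat_act (act_fun beta) h (hat_map (eta gamma s) u)) /\
    exists alphahat : fibredAction p [set: G] (invSection beta),
      right_translation alphahat /\
      exists T : cxMorphism B (invSection beta),
        [/\ bijective T,
            equivariant alpha alphahat T &
            forall b y, T b y =
              fibre_map (eta gamma s) (act_fun alpha (p y) y (fibre_pi (p y) b))].
Proof.
have [phi phiH] := haar.
have p_open := haar_open X_hausdorff phiH.
pose bt := stab_beta X_compact X_hausdorff p_open alpha Omega_compact Omega_hausdorff q_dual s_section.
pose t : cxMorphism B (invSection bt) :=
  transform X_compact X_hausdorff p_open alpha Omega_compact Omega_hausdorff q_dual s_section.
exists bt; split.
  move=> h [x u] Hh /= hx; rewrite /hat_map /hat_act /=; congr hat_mk.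
  by apply/esym; exact: (stab_betaE X_compact X_hausdorff p_open Omega_compact
    Omega_hausdorff q_dual s_section).
have t_bij : bijective t by exact: transform_bijective.
have [S [TK SK]] := inverse_cxMorphism t_bij.
have t_le b : cnorm (t b) <= cnorm b by exact: transform_contractive.
have S_le F : cnorm (S F) <= cnorm F.
  by rewrite -{2}(SK F); exact: transform_expansive.
exists (transport_action alpha TK SK t_le S_le); split; last first.
  by exists t; split=> //; exact: transport_equivariant.
(* transported by [t], [alpha_y] is right translation: [alpha_(y' y) = alpha_y' alpha_y] *)
move=> x u y y' + yx'; subst x => yx.
have [F <-] := fibre_pi_surj u; rewrite -(SK F); set b := S F.
have [b' E] := fibre_pi_surj (act_fun alpha (p y') y (fibre_pi (p y') b)).
rewrite [act_fun _ _ _ _]/(transport_act alpha t S y _) /transport_act.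
rewrite fibre_mapE TK -E fibre_mapE sec_resE.
have res x z (F' : invSection bt) : p z = x -> sec_res (fibre_pi x F') z = hat_mk (F' z).
  by move=> <-; exact: sec_resE.
have pyy : p (bmul p y' y) = p y' by rewrite bproj_mul.
rewrite (res _ _ _ pyy).
change (hat_mk (fibre_map (eta gamma s) (act_fun alpha (p y') y' (fibre_pi (p y') b'))) =
  hat_mk (fibre_map (eta gamma s) (act_fun alpha (p (bmul p y' y)) (bmul p y' y)
    (fibre_pi (p (bmul p y' y)) b)))).
by rewrite E pyy act_mul.
Qed.
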